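(* Let $\mu\in(0,\infty)$ and let $P$ be a probability measure on $\mathbb{Z}_+\times[0,1]$ of the form $P(dx,dy)=p(dx)\,\delta_{q(x)}(dy)$ with $$p(x)=(a+o(1))x^{-\alpha}\ \text{ as }x\to\infty\qquad\text{and}\qquad q(x)=\min\{1,bx^{-\beta}\},$$ with exponents $\alpha>2$, $\beta\in[0,1)$, $\alpha+\beta>3$ and constants $a,b>0$, where in the case $\beta=0$ (when $q$ is constant) it is required that $b<1$. Let $(D_1^*,D_2^* )$ be a random vector with the limiting bidegree distribution $\bar f_2$ determined by $\mu$ and $P$. Then as $t\to\infty$, $$\mathbb{P}(D_1^*=t)=(1+o(1))\,c'\,t^{-\frac{\alpha-2}{1-\beta}},\qquad c'=a\,b^{\frac{\alpha-2}{1-\beta}}(1-\beta)^{-1}P_{21}^{-1}.$$ Denote $\delta_t=t^{1/2}\ln^4(2+t)$. For $t_1,t_2\to+\infty$ such that $(t_2-t_1)/\delta_{t_2}\to+\infty$, $$\mathbb{P}(D_1^*=t_1,\,D_2^*=t_2)=(1+o(1))\,c''\,(t_2-t_1)^{-1-\frac{\alpha-2}{1-\beta}}\;t_1^{-\frac{\alpha-2}{1-\beta}},$$ where $c''=\mu\,a^2\,b^{\frac{2(\alpha-2)}{1-\beta}}(1-\beta)^{-2}P_{21}^{-1}$.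
   Context: Notation: $\mathbb{Z}_+=\{0,1,2,\dots\}$, $(x)_r=x(x-1)\cdots(x-r+1)$, $\mathrm{Bin}(x,y)(s)=\binom{x}{s}(1-y)^{x-s}y^s$, $\delta_x$ (with $x$ a point) is the Dirac measure at $x$, $\otimes$ is the product of measures and $\ast$ is convolution of probability measures on $\mathbb{Z}_+^2$. $p$ is a probability measure on $\mathbb{Z}_+$ with $p(x)=p(\{x\})$. $P_{rs}=\mathbb{E}\big((X)_rY^s\big)$ for $(X,Y)\sim P$; here $Y=q(X)$. Limiting bidegree distribution determined by $\mu$ and $P$: $\bar f_2=\delta_{(1,1)}\ast(\bar f_1\otimes\bar f_1)\ast f_2'$. Here $\bar f_1$ is the law of $\sum_{k=1}^{\Lambda}H_k$, where $\Lambda,H_1,H_2,\dots$ are independent, $\Lambda$ is Poisson with mean $\mu P_{10}$, and each $H_k$ has law $g(s)=\int_{\mathbb{Z}_+\times[0,1]}\mathrm{Bin}(x-1,y)(s)\frac{x\,P(dx,dy)}{P_{10}}$, $s\in\mathbb{Z}_+$; and $$f_2'(s,t)=\int_{\mathbb{Z}_+\times[0,1]}\mathrm{Bin}(x-2,y)(s)\,\mathrm{Bin}(x-2,y)(t)\,\frac{(x)_2\,y\,P(dx,dy)}{P_{21}}.$$ Equivalently, $(D_1^*,D_2^* )=(1+D_1+D_1',\,1+D_2+D_2')$ in law, with $D_1$, $D_2$, $(D_1',D_2')$ mutually independent, $D_1,D_2\sim\bar f_1$ and $(D_1',D_2')\sim f_2'$. *)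

(* Defs.v *)
(* MathComp-Analysis, over an arbitrary R : realType. *)
From HB Require Import structures.
From mathcomp Require Import all_boot all_order all_algebra.
From mathcomp Require Import all_classical all_reals all_analysis.
From mathcomp Require Import measurable_realfun.

Set Implicit Arguments.
Unset Strict Implicit.
Unset Printing Implicit Defensive.

Import Order.TTheory GRing.Theory Num.Theory.
Import numFieldNormedType.Exports.

Local Open Scope classical_set_scope.
Local Open Scope ring_scope.

Definition mutually_independent (R : realType) (d d' : measure_display)
    (Omega : measurableType d) (T : measurableType d')
    (Pr : probability Omega R) (I : eqType) (X : I -> {RV Pr >-> T}) : Prop :=
  forall (J : seq I) (A : I -> set T), uniq J ->
    (forall i, measurable (A i)) ->
    Pr (\bigcap_(i in [set` J]) (X i @^-1` A i)) =
    (\prod_(i <- J) Pr (X i @^-1` A i))%E.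

(* In this file a measure on Z_+ x [0,1] is a measure P on nat * R; that it is
   carried by nat * [0,1] comes from the choice of P (see edge_weight). *)

(* P_{rs} = E ((X)_r Y^s) for (X, Y) ~ P *)
Definition moment (R : realType) (P : probability (nat * R)%type R)
    (r s : nat) : R :=
  \int[P]_z ((z.1 ^_ r)%:R * z.2 ^+ s).

(* z.1.-1 and z.1 - 2 are truncated subtractions, which differ from the integer
   ones only where the weight z.1%:R, respectively z.1 ^_ 2, vanishes. *)
Definition g_pmf (R : realType) (P : probability (nat * R)%type R)
    (s : nat) : R :=
  \int[P]_z (binomial_pmf z.1.-1 z.2 s * (z.1%:R / moment P 1 0)).

Definition f2'_pmf (R : realType) (P : probability (nat * R)%type R)
    (s t : nat) : R :=
  \int[P]_z (binomial_pmf (z.1 - 2) z.2 s * binomial_pmf (z.1 - 2) z.2 t *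
             ((z.1 ^_ 2)%:R * z.2 / moment P 2 1)).

(* f1 is the law of H_1 + ... + H_Lam, where Lam, H_1, H_2, ... are independent,
   Lam ~ Poisson(mu P_{10}) and H_k ~ g.  The variable H 0 is not used. *)
Definition is_f1_bar (R : realType) (mu : R) (P : probability (nat * R)%type R)
    (f1 : probability nat R) : Prop :=
  exists (d : measure_display) (Omega : measurableType d)
    (Pr : probability Omega R)
    (Lam : {RV Pr >-> nat}) (H : nat -> {RV Pr >-> nat}),
  [/\ mutually_independent (fun k : nat => if k is 0%N then Lam else H k),
      forall n, Pr (Lam @^-1` [set n]) = (poisson_pmf (mu * moment P 1 0) n)%:E,
      forall k s, (0 < k)%N -> Pr (H k @^-1` [set s]) = (g_pmf P s)%:E &
      forall A, measurable A ->
        f1 A = Pr [set w | A (\sum_(1 <= k < (Lam w).+1) H k w)%N]].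

Definition is_f2' (R : realType) (P : probability (nat * R)%type R)
    (f2' : probability (nat * nat)%type R) : Prop :=
  forall s t, f2' [set (s, t)] = (f2'_pmf P s t)%:E.

Definition add_pair (z : (nat * nat) * (nat * nat)) : nat * nat :=
  (z.1.1 + z.2.1, z.1.2 + z.2.2)%N.

Lemma measurable_add_pair : measurable_fun [set: _] add_pair.
Proof.
apply: measurable_fun_pair => /=; apply: measurable_fun_addn;
  by apply: measurableT_comp.
Qed.

HB.instance Definition _ := isMeasurableFun.Build _ _
  ((nat * nat) * (nat * nat))%type (nat * nat)%type
  add_pair measurable_add_pair.

Definition convolution (R : realType)
    (m1 m2 : probability (nat * nat)%type R) : probability (nat * nat)%type R :=
  distribution (m1 \x m2)%E add_pair.

Definition is_limiting_bidegree_law (R : realType) (mu : R)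
    (P : probability (nat * R)%type R)
    (f2 : probability (nat * nat)%type R) : Prop :=
  exists (f1 : probability nat R) (f2' : probability (nat * nat)%type R),
  [/\ is_f1_bar mu P f1, is_f2' P f2' &
      forall A, measurable A ->
        f2 A = convolution
                 (convolution (\d_((1, 1)%N : nat * nat)) (f1 \x f1)%E) f2' A].

(* min {1, b x^{-beta}}.  In the library 0 `^ (- beta) = 0 for beta != 0, so
   the value 0^{-beta} = +oo for beta > 0 is treated separately. *)
Definition edge_weight (R : realType) (b beta : R) (x : nat) : R :=
  if (x == 0%N) && (0 < beta) then 1
  else Num.min 1 (b * x%:R `^ (- beta)).

(* P(dx, dy) = p(dx) delta_{q(x)}(dy) *)
Definition is_graph_measure (R : realType) (p : probability nat R)
    (q : nat -> R) (P : probability (nat * R)%type R) : Prop :=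
  forall A, measurable A -> P A = (\int[p]_x \d_(q x) (xsection A x))%E.

Definition delta (R : realType) (t : nat) : R :=
  Num.sqrt t%:R * ln (2 + t%:R) ^+ 4.

(* Main.v *)
(* Write kappa = (alpha - 2) / (1 - beta).  The binomial law with parameters x - r
   and q(x) ~ b x^(-beta) has mean ~ b x^(1-beta), so a mixture of these laws over
   x charges s mostly through the x close to (s / b)^(1/(1-beta)), where a regularly
   varying mixing weight is almost constant.  The remaining sum of
   q(x) Bin(x - r, q(x))(s) over such x telescopes: from x to x + 1 the binomial
   distribution function at s drops by (1 - beta) q(x) Bin(x - r, q(x))(s), up to a
   small relative error, and it drops from about 1 to about 0 over the window.  This
   gives g(s) of order s^(-1-kappa) and the marginal of f2' of order s^(-kappa), with
   explicit constants.

   The compound Poisson law satisfies t f1(t) = lam sum_j j g(j) f1(t - j), where a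
   single large j dominates, so that f1(t) ~ lam g(t).  Hence D_1^* inherits the
   heavier tail of the marginal of f2'.  Given x, both coordinates of f2' lie within
   o(delta) of the same mean, up to superpolynomially small probability.  When
   t2 - t1 is much larger than delta, the pair (t1, t2) can thus only arise from f2'
   near (t1, t1), while the second copy of f1 supplies the difference t2 - t1. *)
Require Import Defs.
From mathcomp Require Import all_boot all_order all_algebra.
From mathcomp Require Import all_classical all_reals all_analysis.
From mathcomp Require Import measurable_realfun.
From mathcomp Require Import ring lra.
Set Implicit Arguments.
Unset Strict Implicit.

Import Order.TTheory GRing.Theory Num.Theory.
Import numFieldNormedType.Exports.

Local Open Scope classical_set_scope.
Local Open Scope ring_scope.

(** * Binomial probabilities *)

(** Binomial probabilities are never approximated one by one: only their sum over the window enters.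
    It is read off from distribution functions, with Chebyshev's inequality at the two ends of the
    window and Chernoff's bound outside it. The obstacle is that q(x) moves together with the number
    of trials. The extra trial lowers the distribution function by q Bin, while the drop of q raises
    it by about beta q Bin; this is the origin of the factors 1 - beta in the constants.

    Since beta < 1, the condition alpha + beta > 3 says that kappa > 1. It makes P_21 finite, and it
    makes j g(j), of order j^(-kappa), summable, on which the single large jump rests. The recursion
    for f1 is circular, because f1 stands on both sides; a crude bound of the right order, by strong
    induction, breaks the circle.

    The square of delta_t divided by t is ln^8 (2 + t), so Chernoff's bound at distance delta/2
    gives exp (- ln^8 / 64). This beats every power of t2, as it must: t1 and t2 - t1 may be of
    quite different orders, and the error is compared with powers of both. *)

Lemma binomial_pmfE (R : realType) n (q : R) k :
  binomial_pmf n q k = 'C(n, k)%:R * q ^+ k * (1 - q) ^+ (n - k).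
Proof. by rewrite /binomial_pmf/unstable.onem -mulr_natl mulrA. Qed.

Lemma binomial_pmf_small (R : realType) n (q : R) k : (n < k)%N ->
  binomial_pmf n q k = 0.
Proof. by move=> nk; rewrite binomial_pmfE bin_small// !mul0r. Qed.

Lemma binomial_pmfS0 (R : realType) n (q : R) :
  binomial_pmf n.+1 q 0 = (1 - q) * binomial_pmf n q 0.
Proof. by rewrite !binomial_pmfE !bin0 !subn0 !expr0 exprS; ring. Qed.

Lemma binomial_pmfSS (R : realType) n (q : R) k :
  binomial_pmf n.+1 q k.+1 =
  q * binomial_pmf n q k + (1 - q) * binomial_pmf n q k.+1.
Proof.
have [kn|nk] := ltnP k n.
  by rewrite !binomial_pmfE subSS binS natrD !exprS -(subnSK kn) exprS; ring.
move: nk; rewrite leq_eqVlt => /orP[/eqP <-|nk]; last first.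
  by rewrite !binomial_pmf_small ?mulr0 ?addr0//; apply: ltnW.
by rewrite (@binomial_pmf_small _ n _ n.+1)// !binomial_pmfE !binn !subnn !exprS; ring.
Qed.

Definition binomial_mean (R : realType) n (q : R) (phi : nat -> R) : R :=
  \sum_(0 <= k < n.+1) binomial_pmf n q k * phi k.

(** Conditioning on one trial. Moments and exponential moments then follow by induction on n,
    without manipulating binomial sums. *)
Lemma binomial_meanS (R : realType) n (q : R) phi :
  binomial_mean n.+1 q phi =
  q * binomial_mean n q (phi \o S) + (1 - q) * binomial_mean n q phi.
Proof.
rewrite /binomial_mean big_nat_recl//= binomial_pmfS0.
under eq_bigr do rewrite binomial_pmfSS mulrDl -!mulrA.
rewrite big_split/= -!mulr_sumr addrCA -mulrA -mulrDr; congr (_ + _ * _).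
rewrite [RHS]big_nat_recl//=; congr (_ + _).
by rewrite big_nat_recr//= binomial_pmf_small// mul0r addr0.
Qed.

Lemma binomial_mean0E (R : realType) (q : R) phi : binomial_mean 0 q phi = phi 0%N.
Proof. by rewrite /binomial_mean big_nat1 binomial_pmfE bin0 !expr0; ring. Qed.

Lemma binomial_mean_ext (R : realType) n (q : R) phi psi : phi =1 psi ->
  binomial_mean n q phi = binomial_mean n q psi.
Proof. by move=> e; apply: eq_bigr => k _; rewrite e. Qed.

Lemma binomial_mean1 (R : realType) n (q : R) : binomial_mean n q (fun=> 1) = 1.
Proof.
elim: n => [|n IH]; first by rewrite binomial_mean0E.
by rewrite binomial_meanS/= (binomial_mean_ext _ _ (psi := fun=> 1))// IH; ring.
Qed.

(** The centre c is left free because the induction step moves it to c - 1. *)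
Lemma binomial_mean_sqr (R : realType) n (q c : R) :
  binomial_mean n q (fun k => (k%:R - c) ^+ 2) =
  n%:R * q * (1 - q) + (n%:R * q - c) ^+ 2.
Proof.
elim: n c => [|n IH] c; first by rewrite binomial_mean0E; ring.
rewrite binomial_meanS/= (binomial_mean_ext _ _ (psi := fun k => (k%:R - (c - 1)) ^+ 2)).
  by rewrite !IH -natr1; ring.
by move=> k /=; rewrite -natr1; ring.
Qed.

Lemma binomial_mean_exp (R : realType) n (q z : R) :
  binomial_mean n q (fun k => z ^+ k) = (1 - q + q * z) ^+ n.
Proof.
elim: n => [|n IH]; first by rewrite binomial_mean0E.
rewrite binomial_meanS exprS -IH [RHS]mulrDl addrC; congr (_ + _).
rewrite -[RHS]mulrA; congr (_ * _); rewrite mulr_sumr; apply: eq_bigr => k _.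
by rewrite /= exprS; ring.
Qed.

Lemma binomial_pmf_le_mean (R : realType) n (q : R) phi k : 0 <= q <= 1 ->
  (forall k, 0 <= phi k) -> binomial_pmf n q k * phi k <= binomial_mean n q phi.
Proof.
move=> q01 phi0.
have [kn|nk] := leqP k n; last first.
  by rewrite binomial_pmf_small// mul0r; apply: sumr_ge0 => i _;
    rewrite mulr_ge0// binomial_pmf_ge0.
rewrite /binomial_mean (@bigD1_seq _ _ _ _ _ k) ?mem_index_iota ?iota_uniq ?ltnS//=.
by rewrite lerDl sumr_ge0// => i _; rewrite mulr_ge0// binomial_pmf_ge0.
Qed.

Lemma binomial_pmf_le1 (R : realType) n (q : R) k : 0 <= q <= 1 -> binomial_pmf n q k <= 1.
Proof.
move=> q01; rewrite -(binomial_mean1 n q) -[leLHS]mulr1.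
by apply: (@binomial_pmf_le_mean _ _ _ (fun=> 1)).
Qed.

(** Inverting 1 - x <= exp (- x) gives exp x <= 1 / (1 - x). Negative x are included, so that a
    single computation serves both tails of the binomial. *)
Lemma expR_le_quad (R : realType) (x : R) : x <= 2^-1 -> expR x <= 1 + x + 2 * x ^+ 2.
Proof.
move=> x2; have e := expR_ge1Dx (- x); rewrite -[x in leLHS]opprK expRN.
have p : 0 < 1 - x by lra.
rewrite (@le_trans _ _ (1 - x)^-1)//; first by rewrite lef_pV2 ?posrE ?expR_gt0.
rewrite -[leLHS]mul1r ler_pdivrMr//.
have : 0 <= x ^+ 2 * (1 - 2 * x) by rewrite mulr_ge0 ?sqr_ge0//; lra.
nra.
Qed.

Lemma binomial_chernoff (R : realType) n (q : R) s : 0 <= q <= 1 ->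
  binomial_pmf n q s <=
  expR (- ((s%:R - n%:R * q) ^+ 2 / (8 * Num.max s%:R (n%:R * q)))).
Proof.
move=> q01; set m := n%:R * q; set M := Num.max _ _.
have q0 : 0 <= q by case/andP: q01.
have m0 : 0 <= m by rewrite mulr_ge0.
have sM : s%:R <= M by rewrite le_max lexx.
have mM : m <= M by rewrite le_max lexx orbT.
have s0 : 0 <= s%:R :> R by [].
(* If M = 0, the quotient in the exponent is 0 by the convention for inverses, and the claim is that
   a probability is at most 1. *)
have [M0|M0] := eqVneq M 0.
  by rewrite M0 mulr0 invr0 mulr0 oppr0 expR0 binomial_pmf_le1.
have Mp : 0 < M by rewrite lt_neqAle eq_sym M0 (le_trans m0).
(* This [th] minimises - th (s - m) + 2 M th^2, the exponent left by the quadratic bound on the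
   exponential once m is replaced by M in the square term. Its sign is that of s - m. *)
pose th : R := (s%:R - m) / (4 * M).
have thle : th <= 2^-1 by rewrite /th ler_pdivrMr ?mulr_gt0//; lra.
have H := @binomial_pmf_le_mean R n q (fun k => expR th ^+ k) s q01
  (fun k => exprn_ge0 _ (expR_ge0 _)).
rewrite binomial_mean_exp in H.
have H2 : (1 - q + q * expR th) ^+ n <= expR (m * (th + 2 * th ^+ 2)).
  rewrite /m -mulrA expRM_natl lerXn2r ?nnegrE ?expR_ge0//.
    by case/andP: q01 => _ ?; rewrite addr_ge0 ?subr_ge0// mulr_ge0 ?expR_ge0.
  apply: le_trans (expR_ge1Dx _).
  have := ler_wpM2l q0 (expR_le_quad thle); lra.
have := le_trans H H2.
rewrite -expRM_natr -ler_pdivlMr ?expR_gt0// -expRN -expRD => /le_trans; apply.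
rewrite ler_expR.
have -> : (s%:R - m) ^+ 2 / (8 * M) = 2 * M * th ^+ 2.
  by rewrite /th; field; rewrite M0.
have thE : s%:R - m = 4 * M * th by rewrite /th; field.
have -> : m * (th + 2 * th ^+ 2) - th * s%:R = - (4 * M * th ^+ 2) + 2 * m * th ^+ 2.
  by have -> : s%:R = m + 4 * M * th by [lra|]; ring.
have : 0 <= th ^+ 2 by exact: sqr_ge0.
nra.
Qed.

(** * Binomial distribution functions *)

Definition binomial_cdf (R : realType) n (q : R) s : R :=
  \sum_(0 <= k < s.+1) binomial_pmf n q k.

(** One further trial moves the count out of [0, s] exactly when the count stood at s and the trial
    succeeds. *)
Lemma binomial_cdfS (R : realType) n (q : R) s :
  binomial_cdf n.+1 q s = binomial_cdf n q s - q * binomial_pmf n q s.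
Proof.
elim: s => [|s IH]; first by rewrite /binomial_cdf !big_nat1 binomial_pmfS0; ring.
rewrite /binomial_cdf big_nat_recr//= -/(binomial_cdf _ _ _) IH.
rewrite [\sum_(0 <= k < s.+2) _]big_nat_recr//= -/(binomial_cdf _ _ _).
by rewrite binomial_pmfSS; ring.
Qed.

(** The probability as a polynomial in the success parameter, so that differentiation in that
    parameter is formal. *)
Definition binomial_poly (R : realType) n s : {poly R} :=
  'C(n, s)%:R *: ('X^s * (1 - 'X) ^+ (n - s)).

Lemma horner_binomial_poly (R : realType) n s (q : R) :
  (binomial_poly R n s).[q] = binomial_pmf n q s.
Proof. by rewrite binomial_pmfE /binomial_poly !hornerE/= -?mulrA. Qed.

Lemma deriv_binomial_poly0 (R : realType) n :
  (binomial_poly R n.+1 0)^`() = - n.+1%:R *: binomial_poly R n 0.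
Proof.
rewrite /binomial_poly !bin0 !scale1r !expr0 !mul1r !subn0.
by rewrite deriv_exp poly.derivB derivC poly.derivX sub0r mulN1r scaleNr scaler_nat mulNrn.
Qed.

Lemma deriv_binomial_polyS (R : realType) n s :
  (binomial_poly R n.+1 s.+1)^`() =
  n.+1%:R *: (binomial_poly R n s - binomial_poly R n s.+1).
Proof.
rewrite /binomial_poly.
rewrite !(poly.derivZ, poly.derivM, deriv_exp, poly.derivB, derivC, poly.derivX) subSS mul1r sub0r mulN1r scalerBr.
have e1 : ('C(n.+1, s.+1) * s.+1)%:R = (n.+1 * 'C(n, s))%:R :> R.
  by rewrite mul_bin_diag mulnC.
have e2 : ('C(n.+1, s.+1) * (n - s))%:R = (n.+1 * 'C(n, s.+1))%:R :> R.
  by congr (_%:R); rewrite mulnC -subSS -mul_bin_down.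
rewrite !natrM in e1 e2.
rewrite !scalerA -e1 -e2 subnS.
move: ('C(n.+1, s.+1)%:R) => c {e1 e2}.
by rewrite -!scalerA !scaler_nat -scalerBr mulrnAl mulrnAr mulrN mulNrn.
Qed.

(** Summed over k <= s, the derivatives in the success parameter telescope to one binomial
    probability with a trial less; the mean value theorem then evaluates it at an unknown
    intermediate parameter. *)
Lemma binomial_cdf_mvt (R : realType) n s (q' q : R) : q' <= q ->
  exists2 u, q' <= u <= q & binomial_cdf n.+1 q' s - binomial_cdf n.+1 q s =
    n.+1%:R * (q - q') * binomial_pmf n u s.
Proof.
move=> qq.
pose P : {poly R} := \sum_(0 <= k < s.+1) binomial_poly R n.+1 k.
have PE x : P.[x] = binomial_cdf n.+1 x s.
  by rewrite horner_sum; apply: eq_bigr => k _; rewrite horner_binomial_poly.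
have dP : P^`() = - n.+1%:R *: binomial_poly R n s.
  rewrite /P; elim: s {P PE} => [|s IH]; first by rewrite big_nat1 deriv_binomial_poly0.
  rewrite big_nat_recr//= derivD IH deriv_binomial_polyS scalerBr scaleNr scaleNr.
  by rewrite addrA addNr add0r.
have [] := @MVT_segment R (horner P) (horner P^`()) q' q qq (fun x _ => is_derive_poly P x).
  by apply: derivable_within_continuous => x _; exact: derivable_horner.
move=> u; rewrite in_itv/= => uq; rewrite !PE => e; exists u => //.
rewrite -opprB e dP hornerZ horner_binomial_poly; ring.
Qed.

Lemma binomial_chebyshev (R : realType) n (q d : R) (A : pred nat) :
  0 <= q <= 1 -> 0 < d -> (forall k, A k -> d <= `|k%:R - n%:R * q|) ->
  \sum_(0 <= k < n.+1 | A k) binomial_pmf n q k <= n%:R * q / d ^+ 2.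
Proof.
move=> q01 d0 Ad; rewrite ler_pdivlMr ?exprn_gt0//.
apply: (@le_trans _ _ (binomial_mean n q (fun k => (k%:R - n%:R * q) ^+ 2))); last first.
  rewrite binomial_mean_sqr subrr expr0n/= addr0.
  have : 0 <= n%:R * q * q by rewrite !mulr_ge0//; case/andP: q01.
  lra.
rewrite mulr_suml big_mkcond/=; apply: ler_sum => k _; case: ifP => Ak; last first.
  by rewrite mulr_ge0 ?binomial_pmf_ge0 ?sqr_ge0.
rewrite ler_wpM2l ?binomial_pmf_ge0// -[leRHS]real_normK ?num_real// lerXn2r ?nnegrE ?Ad//.
exact: ltW.
Qed.

Lemma binomial_cdf_widen (R : realType) n (q : R) s N : (n < N)%N -> (s < N)%N ->
  binomial_cdf n q s = \sum_(0 <= k < n.+1 | (k <= s)%N) binomial_pmf n q k.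
Proof.
move=> nN sN; transitivity (\sum_(0 <= k < N | (k <= s)%N) binomial_pmf n q k).
  by rewrite /binomial_cdf (big_nat_widen _ _ N).
rewrite [in RHS](big_nat_widen _ _ N)// [LHS]big_mkcond [RHS]big_mkcond/=.
apply: eq_bigr => k _; rewrite ltnS; case: (leqP k s) => //= _.
by case: (leqP k n) => //= nk; rewrite binomial_pmf_small.
Qed.

Lemma binomial_cdf_ge0 (R : realType) n (q : R) s : 0 <= q <= 1 -> 0 <= binomial_cdf n q s.
Proof. by move=> q01; apply: sumr_ge0 => k _; apply: binomial_pmf_ge0. Qed.

Lemma binomial_cdf_le1 (R : realType) n (q : R) s : 0 <= q <= 1 -> binomial_cdf n q s <= 1.
Proof.
move=> q01; rewrite (@binomial_cdf_widen _ _ _ _ (n + s).+1) ?ltnS ?leq_addr ?leq_addl//.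
rewrite -(binomial_mean1 n q) big_mkcond; apply: ler_sum => k _.
by rewrite mulr1; case: ifP => // _; apply: binomial_pmf_ge0.
Qed.

Lemma binomial_cdf_upper (R : realType) n (q : R) s : 0 <= q <= 1 -> s%:R < n%:R * q ->
  binomial_cdf n q s <= n%:R * q / (n%:R * q - s%:R) ^+ 2.
Proof.
move=> q01 sm; rewrite (@binomial_cdf_widen _ _ _ _ (n + s).+1) ?ltnS ?leq_addr ?leq_addl//.
apply: binomial_chebyshev; rewrite ?subr_gt0// => k ks.
have : k%:R <= s%:R :> R by rewrite ler_nat.
by move=> ?; rewrite ler0_norm; lra.
Qed.

Lemma binomial_cdf_lower (R : realType) n (q : R) s : 0 <= q <= 1 -> n%:R * q < s%:R ->
  1 - n%:R * q / (s%:R - n%:R * q) ^+ 2 <= binomial_cdf n q s.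
Proof.
move=> q01 sm; rewrite (@binomial_cdf_widen _ _ _ _ (n + s).+1) ?ltnS ?leq_addr ?leq_addl//.
rewrite -[X in X - _](binomial_mean1 n q).
under [binomial_mean _ _ _]eq_bigr do rewrite mulr1.
rewrite lerBlDr (bigID (fun k => k <= s)%N)/= lerD2l.
apply: binomial_chebyshev; rewrite ?subr_gt0// => k; rewrite -ltnNge => ks.
have : s%:R <= k%:R :> R by rewrite ler_nat ltnW.
by move=> ?; rewrite ger0_norm; lra.
Qed.

(** * Real powers and perturbation of the binomial *)

Lemma powR_anti (R : realType) (r x y : R) : 0 <= r -> 0 < x -> x <= y ->
  y `^ (- r) <= x `^ (- r).
Proof.
move=> r0 x0 xy; have y0 := lt_le_trans x0 xy.
by rewrite !powRN lef_pV2 ?posrE ?powR_gt0// ge0_ler_powR ?nnegrE ?(ltW x0) ?(ltW y0).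
Qed.

Lemma powR_small (R : realType) (r e : R) : 0 < r -> 0 < e ->
  \forall n \near \oo, (n : nat)%:R `^ (- r) <= e.
Proof.
move=> r0 e0; near=> n.
have h : e `^ (- r^-1) <= n%:R by near: n; apply: nbhs_infty_ger.
apply: le_trans (powR_anti (ltW r0) _ h) _; first by rewrite powR_gt0.
by rewrite -powRrM mulrNN mulVf ?gt_eqF// powRr1// ltW.
Unshelve. all: by end_near. Qed.

Lemma powR_small_cvg (R : realType) (r : R) : 0 < r ->
  (fun n : nat => n%:R `^ (- r)) @ \oo --> (0 : R).
Proof.
move=> r0; apply/cvgr0Pnorm_le => e e0; near=> n.
by rewrite ger0_norm ?powR_ge0//; near: n; apply: powR_small.
Unshelve. all: by end_near. Qed.

Lemma expR_powR_bound (R : realType) (c v : R) : 0 < c -> exists2 K : R, 0 < K &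
  forall x : R, 1 <= x -> expR (- (c * x)) * x `^ v <= K / x.
Proof.
move=> c0; pose n := (Num.truncn `|v + 1|).+1.
have vn : v + 1 <= n%:R.
  by apply: le_trans (ler_norm _) (ltW (truncnS_gt _)).
exists (n`!%:R / c ^+ n); first by rewrite divr_gt0 ?exprn_gt0// ltr0n fact_gt0.
move=> x x1; have x0 : 0 < x by apply: lt_le_trans x1.
rewrite ler_pdivlMr// -mulrA.
have -> : x `^ v * x = x `^ (v + 1).
  by rewrite powRD ?(gt_eqF x0) ?implybT// powRr1// ltW.
apply: (@le_trans _ _ (expR (- (c * x)) * x ^+ n)).
  by rewrite ler_wpM2l ?expR_ge0// -powR_mulrn ?(ltW x0)// ler_powR.
rewrite expRN mulrC ler_pdivrMr ?expR_gt0// mulrAC ler_pdivlMr ?exprn_gt0//.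
rewrite -exprMn (mulrC x) [leRHS]mulrC.
have := @expR_ge1Dxn R (c * x) n.-1 (ltW (mulr_gt0 c0 x0)).
rewrite prednK// => h; rewrite -ler_pdivrMr ?ltr0n ?fact_gt0//.
by apply: le_trans h; rewrite lerDr.
Qed.

(** With z = 1/x, this rests on z / (1 + z) <= ln (1 + z) <= z. Both sides agree with 1 - be/x up to
    order x^(-2). *)
Lemma powR_succ_ratio (R : realType) (be : R) (x : nat) : 0 <= be -> (0 < x)%N ->
  x%:R `^ (- be) * (1 - be / x%:R) <= x.+1%:R `^ (- be) <=
  x%:R `^ (- be) * (1 - be / (x%:R + 1 + be)).
Proof.
move=> be0 x0; have xp : 0 < x%:R :> R by rewrite ltr0n.
pose z : R := x%:R^-1; have z0 : 0 < z by rewrite invr_gt0.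
have xS : x.+1%:R = x%:R * (1 + z) :> R by rewrite mulrDr mulr1 mulfV ?gt_eqF// natr1.
have z1 : 0 < 1 + z by rewrite addr_gt0.
rewrite xS powRM ?(ltW xp) ?(ltW z1)// !ler_pM2l ?powR_gt0//.
pose L := ln (1 + z).
have e : (1 + z) `^ (- be) = expR (- (be * L)) by rewrite /powR gt_eqF// mulNr.
rewrite e.
have Lz : L <= z by apply: le_ln1Dx; lra.
have zL : z / (1 + z) <= L.
  have h : ln (1 + - (z / (1 + z))) <= - (z / (1 + z)).
    by apply: le_ln1Dx; rewrite ltrN2 ltr_pdivrMr//; lra.
  have e2 : 1 + - (z / (1 + z)) = (1 + z)^-1 by field; rewrite gt_eqF.
  by rewrite e2 lnV ?posrE// in h; rewrite /L; lra.
apply/andP; split.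
  apply: le_trans (expR_ge1Dx _); rewrite lerD2l lerN2.
  by rewrite ler_wpM2l.
have L0 : 0 <= L by apply: le_trans zL; rewrite divr_ge0// ltW.
have -> : 1 - be / (x%:R + 1 + be) = (1 + be * (z / (1 + z)))^-1.
  rewrite /z; field.
  by rewrite !gt_eqF//; lra.
rewrite expRN lef_pV2 ?posrE ?expR_gt0//.
  by apply: le_trans (expR_ge1Dx _); rewrite lerD2l ler_wpM2l.
by rewrite ltr_wpDr// mulr_ge0// divr_ge0 ?ltW.
Qed.

(* Tilting: a change of the success parameter costs the first-order term of the
   likelihood ratio, since ln (1 + z) <= z. *)
Lemma binomial_pmf_tilt (R : realType) n s (u q : R) : 0 < u < 1 -> 0 < q < 1 ->
  binomial_pmf n u s <=
  binomial_pmf n q s * expR ((q - u) * (n%:R * q - s%:R) / (q * (1 - q))).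
Proof.
move=> /andP[u0 u1] /andP[q0 q1].
have [sn|ns] := leqP s n; last by rewrite !binomial_pmf_small// mul0r.
have p1 : 0 < 1 - q by rewrite subr_gt0.
rewrite !binomial_pmfE -3!mulrA ler_wpM2l//.
have -> : (q - u) * (n%:R * q - s%:R) / (q * (1 - q)) =
    s%:R * (- ((q - u) / q)) + (n - s)%:R * ((q - u) / (1 - q)).
  by rewrite natrB//; field; rewrite !gt_eqF.
rewrite expRD !expRM_natl mulrA mulrACA -!exprMn.
have us : u <= q * expR (- ((q - u) / q)).
  have -> : u = q * (1 + - ((q - u) / q)) by field; rewrite gt_eqF.
  by rewrite [X in _ <= _ * expR (- ((q - X) / q))](_ : _ = u)
    ?ler_pM2l ?expR_ge1Dx//; field; rewrite gt_eqF.
have vs : 1 - u <= (1 - q) * expR ((q - u) / (1 - q)).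
  have -> : 1 - u = (1 - q) * (1 + (q - u) / (1 - q)) by field; rewrite gt_eqF.
  by rewrite ler_pM2l ?expR_ge1Dx.
by rewrite ler_pM ?exprn_ge0 ?lerXn2r ?nnegrE ?mulr_ge0 ?expR_ge0 ?subr_ge0// ltW.
Qed.

Definition power_weight (R : realType) (b be : R) (q : nat -> R) : Prop :=
  [/\ 0 < b /\ (be = 0 -> b < 1), 0 <= be < 1, forall x, 0 <= q x <= 1,
      forall x, (0 < x)%N -> q x <= b * x%:R `^ (- be) &
      \forall x \near \oo, q x = b * x%:R `^ (- be)].

(** If be > 0, then q tends to 0; if be = 0, the factor be vanishes and b < 1 keeps q below 1. The
    odds q / (1 - q) are what tilting costs. *)
Lemma weight_odds_small (R : realType) (b be : R) (q : nat -> R) (e : R) :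
  power_weight b be q -> 0 < e ->
  \forall x \near \oo, q x < 1 /\ be * (q x / (1 - q x)) <= e.
Proof.
move=> [[b0 bb] /andP[be0 be1] q01 qle qE] e0; have [be_0|be_n0] := eqVneq be 0.
  near=> x; have -> : q x = b.
    have -> : q x = b * x%:R `^ (- be) by near: x.
    by rewrite be_0 oppr0 powRr0 mulr1.
  by rewrite be_0 mul0r; split; [apply: bb|apply: ltW].
have bep : 0 < be by rewrite lt_neqAle eq_sym be_n0.
pose d : R := Num.min (2^-1) (e / 2).
have d0 : 0 < d by rewrite lt_min invr_gt0 ltr0n divr_gt0.
have d2 : d <= 2^-1 by rewrite ge_min lexx.
have de : d <= e / 2 by rewrite ge_min lexx orbT.
near=> x; have qd : q x <= d.
  have -> : q x = b * x%:R `^ (- be) by near: x.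
  rewrite -ler_pdivlMl// mulrC; near: x; apply: powR_small => //.
  by rewrite divr_gt0.
have [q0 _] := andP (q01 x).
split; first lra.
rewrite mulrA ler_pdivrMr; last lra.
have h1 : be * q x <= q x by rewrite ler_piMl// ltW.
have : e * (1 - q x) >= e / 2 by rewrite ler_pM2l//; lra.
lra.
Unshelve. all: by end_near. Qed.

Lemma le_of_eq (R : realType) (x y : R) : x = y -> x <= y.
Proof. by move->. Qed.

(** Tilting is applied in both directions. Its exponent has the form (q - u) |mean - s| / (variance
    per trial); as q - u is at most be q / x while s and the mean are of order at most x q, it is
    bounded by a multiple of be q / (1 - q). *)
Lemma binomial_pmf_tilt_bounds (R : realType) (n s : nat) (x be q u t : R) :
  0 < x -> 0 <= be -> 0 < t -> 0 < u <= q -> q < 1 -> q / 2 <= u ->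
  q - u <= be / x * q -> n%:R <= x -> s%:R <= 4 * (x * q) ->
  be * (q / (1 - q)) <= t / 8 ->
  binomial_pmf n q s * expR (- t) <= binomial_pmf n u s <=
  binomial_pmf n q s * expR t.
Proof.
move=> xp be0 t0 /andP[u0 u2] q1 uq du nx sle qt.
have q0 : 0 < q by lra.
have u1 : u < 1 by lra.
have q01 : 0 <= q <= 1 by apply/andP; lra.
have u01 : 0 < u < 1 by apply/andP; lra.
have q01' : 0 < q < 1 by apply/andP; lra.
have p1 : 0 < 1 - q by lra.
have p2 : 0 < 1 - u by lra.
have s0 : 0 <= s%:R :> R by [].
have du0 : 0 <= q - u by lra.
have h : be * q <= t / 8 * (1 - q) by move: qt; rewrite mulrA ler_pdivrMr.
apply/andP; split.
  rewrite expRN ler_pdivrMr ?expR_gt0//.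
  apply: le_trans (@binomial_pmf_tilt _ n s q u q01' u01) _.
  rewrite ler_wpM2l ?binomial_pmf_ge0//; first by apply/andP; lra.
  rewrite ler_expR ler_pdivrMr ?mulr_gt0//.
  apply: (@le_trans _ _ ((q - u) * s%:R)).
    rewrite -opprB mulNr -mulrN ler_wpM2l// opprB gerBl.
    by rewrite mulr_ge0// ltW.
  apply: (@le_trans _ _ (be * q * (4 * q))).
    apply: (@le_trans _ _ ((be / x * q) * (4 * (x * q)))); first by rewrite ler_pM.
    by apply: le_of_eq; field; rewrite gt_eqF.
  apply: (@le_trans _ _ (t / 8 * (1 - q) * (4 * q))).
    by rewrite ler_wpM2r// mulr_ge0// ltW.
  have h2 : (1 - q) * (q / 2) <= (u * (1 - u)).
    by rewrite mulrC ler_pM//; lra.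
  by have := ler_wpM2l (ltW t0) h2; clear; lra.
apply: le_trans (@binomial_pmf_tilt _ n s u q u01 q01') _.
rewrite ler_wpM2l ?binomial_pmf_ge0//.
rewrite ler_expR ler_pdivrMr ?mulr_gt0//.
apply: (@le_trans _ _ (be * q * q)).
  apply: (@le_trans _ _ ((q - u) * (x * q))).
    rewrite ler_wpM2l// lerBlDr; have := ler_wpM2r (ltW q0) nx.
    by move: s0; clear; lra.
  rewrite mulrA ler_wpM2r ?(ltW q0)//.
  apply: le_trans (ler_wpM2r (ltW xp) du) _.
  by rewrite mulrAC -(mulrA be) mulVf ?gt_eqF// mulr1.
rewrite mulrCA (mulrC q) ler_wpM2r ?(ltW q0)//.
have := mulr_gt0 t0 p1; move: h; clear; lra.
Qed.

(** The error bookkeeping for [binomial_cdf_increment]: N is the number of trials, d the drop of the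
    success parameter, B and P the probabilities at q and at the mean value point. N d is be q, and
    P is B, each up to a relative error of order t. *)
Lemma increment_bounds (R : realType) (be e t N d x r q B P ex eNx : R) :
  0 <= be -> be < 1 -> 0 < t -> t <= 2^-1 -> t <= e / 4 -> 0 <= r ->
  0 < x -> r + 1 <= t * x -> N = x + 1 - r -> 0 <= N -> 0 < q ->
  q * (be / (x + 1 + be)) <= d <= be / x * q -> 0 <= B -> 0 <= P ->
  ex <= 1 + 2 * t -> 1 - t <= eNx -> B * eNx <= P <= B * ex ->
  `|be * (q * B) - N * d * P| <= e * (q * B).
Proof.
move=> be0 be1 t0 t2 te r0 x0 xtr NE N0 q0 /andP[dlo dhi] B0 P0 exle eNle /andP[BP PB].
set qB := q * B; have qB0 : 0 <= qB by rewrite mulr_ge0// ltW.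
have d0 : 0 <= d.
  apply: le_trans dlo; rewrite mulr_ge0 ?(ltW q0)// divr_ge0//.
  by move: x0 be0; clear; lra.
have up : N * d * P <= (1 + t) * be * (1 + 2 * t) * qB.
  have h1 : N * d <= (1 + t) * be * q.
    apply: (@le_trans _ _ (N * (be / x * q))); first by rewrite ler_wpM2l.
    rewrite mulrA ler_pM2r// mulrA ler_pdivrMr// mulrAC ler_wpM2r//.
    by move: NE xtr r0 t0 x0; clear; lra.
  apply: (@le_trans _ _ ((1 + t) * be * q * (B * (1 + 2 * t)))).
    by rewrite ler_pM ?mulr_ge0//; apply: le_trans PB _; rewrite ler_wpM2l.
  by rewrite /qB; apply: le_of_eq; ring.
have lw : (1 - t) * be * (1 - t) * qB <= N * d * P.
  have h1 : (1 - t) * be * q <= N * d.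
    have xb : 0 < x + 1 + be by move: x0 be0; clear; lra.
    apply: (@le_trans _ _ (N * (q * (be / (x + 1 + be))))); last first.
      by rewrite ler_wpM2l.
    rewrite mulrCA (mulrC _ q) ler_pM2l// mulrA ler_pdivlMr// mulrAC ler_wpM2r//.
    have : 0 <= t * be by rewrite mulr_ge0// ltW.
    by move: NE xtr be1 t0 t2; clear; lra.
  apply: (@le_trans _ _ ((1 - t) * be * q * (B * (1 - t)))).
    by rewrite /qB; apply: le_of_eq; ring.
  have t1 : 0 <= 1 - t by move: t2; clear; lra.
  rewrite ler_pM ?mulr_ge0 ?(ltW q0)//.
  by apply: le_trans BP; rewrite ler_wpM2l.
have m1 : 0 <= t * (1 - be) by rewrite mulr_ge0 ?(ltW t0)// subr_ge0 ltW.
have m2 : 0 <= be * (t * (2^-1 - t)) by rewrite mulr_ge0// mulr_ge0 ?(ltW t0)// subr_ge0.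
have m3 : 0 <= be * (t * t) by rewrite mulr_ge0// mulr_ge0 ?(ltW t0).
have a1 : (1 + t) * be * (1 + 2 * t) <= be + e by move: m1 m2 te; clear; lra.
have a2 : be - e <= (1 - t) * be * (1 - t) by move: m1 m3 te t0; clear; lra.
have b1 := ler_wpM2r qB0 a1; have b2 := ler_wpM2r qB0 a2.
by rewrite ler_norml; apply/andP; move: up lw b1 b2; clear; split; lra.
Qed.

(** The passage from x to x + 1 is split in two. Adding a trial lowers the distribution function by
    exactly q B. Lowering the parameter raises it by N (q x - q x.+1) P, where P is the probability
    at a nearby parameter; this is close to be q B. The bound on s keeps P close to B. *)
Lemma binomial_cdf_increment (R : realType) (b be : R) (q : nat -> R) r (e : R) :
  power_weight b be q -> 0 < e -> \forall x \near \oo, forall s : nat,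
  s%:R <= 4 * (x%:R * q x) ->
  `|binomial_cdf (x - r) (q x) s - binomial_cdf (x.+1 - r) (q x.+1) s
    - (1 - be) * (q x * binomial_pmf (x - r) (q x) s)|
  <= e * (q x * binomial_pmf (x - r) (q x) s).
Proof.
move=> pw e0; have [[b0 bb] /andP[be0 be1] q01 qle qE] := pw.
pose t : R := Num.min (2^-1) (e / 4).
have t0 : 0 < t by rewrite lt_min invr_gt0 ltr0n divr_gt0.
have t2 : t <= 2^-1 by rewrite ge_min lexx.
have te : t <= e / 4 by rewrite ge_min lexx orbT.
have qE1 : \forall x \near \oo, q x.+1 = b * x.+1%:R `^ (- be).
  by case: qE => N _ H; exists N => // n /= Nn; apply: H; apply: leqW.
near=> x => s sle.
have rx : (r < x)%N by near: x; apply: nbhs_infty_gt.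
have x0 : (0 < x)%N by apply: leq_ltn_trans rx.
have xp : 0 < x%:R :> R by rewrite ltr0n.
have x2 : 2 <= x%:R :> R by near: x; apply: nbhs_infty_ger.
have xt : r.+1%:R / t <= x%:R by near: x; apply: nbhs_infty_ger.
have [q1 qt] : q x < 1 /\ be * (q x / (1 - q x)) <= t / 8.
  by near: x; apply: (weight_odds_small pw); rewrite divr_gt0.
have qx : q x = b * x%:R `^ (- be) by near: x.
have qx1 : q x.+1 = b * x.+1%:R `^ (- be).
  by near: x.
have q0 : 0 < q x by rewrite qx mulr_gt0// powR_gt0.
have [lo hi] : q x * (1 - be / x%:R) <= q x.+1 /\ q x.+1 <= q x * (1 - be / (x%:R + 1 + be)).
  have /andP[h1 h2] := powR_succ_ratio be0 x0.
  by rewrite qx qx1 -!mulrA !ler_pM2l.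
set n := (x - r)%N; have -> : (x.+1 - r)%N = n.+1 by rewrite subSn// ltnW.
have nE : n.+1%:R = x%:R + 1 - r%:R :> R by rewrite -natr1 /n natrB ?(ltnW rx)//; ring.
have nx : n%:R <= x%:R :> R by rewrite ler_nat leq_subr.
have q'q : q x.+1 <= q x.
  apply: le_trans hi _; rewrite ler_piMr ?(ltW q0)//.
  by rewrite gerBl divr_ge0//; lra.
have [u /andP[u1 u2] mvt] := @binomial_cdf_mvt R n s _ _ q'q.
have bex : be / x%:R <= 2^-1 by rewrite ler_pdivrMr//; move: be1 x2; clear; lra.
have uq : q x / 2 <= u.
  by apply: le_trans u1; apply: le_trans lo; rewrite ler_pM2l//; move: bex; clear; lra.
have u0 : 0 < u by apply: lt_le_trans uq; rewrite divr_gt0.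
set B := binomial_pmf n (q x) s; set P := binomial_pmf n u s in mvt *.
have dle : q x - q x.+1 <= be / x%:R * q x by move: lo; clear; lra.
have BP : B * expR (- t) <= P <= B * expR t.
  apply: (@binomial_pmf_tilt_bounds _ n s x%:R be) => //; first by rewrite u0.
  by move: u1 dle; clear; lra.
have -> : binomial_cdf n (q x) s - binomial_cdf n.+1 (q x.+1) s - (1 - be) * (q x * B)
    = be * (q x * B) - n.+1%:R * (q x - q x.+1) * P.
  by have := binomial_cdfS n (q x) s; rewrite -/B; move: mvt; clear; lra.
apply: (@increment_bounds _ be e t _ _ x%:R r%:R _ _ _ (expR t) (expR (- t))) => //.
- by move: xt; rewrite ler_pdivrMr// -natr1; clear; lra.
- by rewrite dle andbT; move: hi; clear; lra.
- by rewrite binomial_pmf_ge0.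
- by rewrite binomial_pmf_ge0//; apply/andP; move: u0 u2 q1; clear; split; lra.
- apply: le_trans (expR_le_quad t2) _.
  have := mulr_ge0 (ltW t0) (_ : 0 <= 2^-1 - t); rewrite subr_ge0 => /(_ t2).
  by clear; lra.
- exact: expR_ge1Dx.
Unshelve. all: by end_near. Qed.

Lemma powR_continuous1 (R : realType) (v : R) : {for 1, continuous (fun x : R => x `^ v)}.
Proof.
rewrite /prop_for /continuous_at powR1.
have h : expR (v * ln x) @[x --> (1 : R)] --> (1 : R).
  have e : expR (v * ln 1) = (1 : R) by rewrite ln1 mulr0 expR0.
  rewrite -[X in _ --> X]e.
  apply: (@cvg_comp _ _ _ (fun x => v * ln x) expR).
    by apply: cvgM; [exact: cvg_cst|apply: continuous_ln].
  exact: continuous_expR.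
apply: cvg_trans h; apply: near_eq_cvg.
near=> x; rewrite /powR gt_eqF//; near: x.
by apply: (cvgr_gt (1 : R)); [exact: cvg_id|exact: ltr01].
Unshelve. all: by end_near. Qed.

Lemma cvg_powR1 (R : realType) (T : Type) (F : set_system T) (FF : Filter F)
    (f : T -> R) (v : R) :
  f @ F --> (1 : R) -> (fun t => f t `^ v) @ F --> (1 : R).
Proof.
move=> f1; have := cvg_comp _ _ f1 (@powR_continuous1 R v).
by rewrite /= powR1.
Qed.

(** * The mean of the mixed binomial around the mode *)

Section scale.
Context (R : realType) (b be : R).

(* The index x at which b x^(1-be), the mean of the mixed binomial, equals s. *)
Definition mode (s : nat) : R := (s%:R / b) `^ ((1 - be)^-1).

Lemma mode_ge0 s : 0 <= mode s. Proof. exact: powR_ge0. Qed.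

Lemma mode_gt0 s : 0 < b -> (0 < s)%N -> 0 < mode s.
Proof. by move=> b0 s0; rewrite powR_gt0// divr_gt0// ltr0n. Qed.

Lemma mode_pow s : 0 < b -> be < 1 -> b * mode s `^ (1 - be) = s%:R.
Proof.
move=> b0 be1; rewrite -powRrM mulVf ?gt_eqF ?subr_gt0// powRr1 ?divr_ge0// ?ltW//.
by rewrite mulrCA mulfV ?gt_eqF// mulr1.
Qed.

Lemma mode_large (X : R) : 0 < b -> be < 1 -> 0 <= X -> \forall s \near \oo, X <= mode s.
Proof.
move=> b0 be1 X0; near=> s.
have p : 0 < 1 - be by rewrite subr_gt0.
have h : b * X `^ (1 - be) <= s%:R by near: s; apply: nbhs_infty_ger.
have -> : X = (X `^ (1 - be)) `^ ((1 - be)^-1).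
  by rewrite -powRrM mulfV ?gt_eqF// powRr1.
rewrite ge0_ler_powR ?invr_ge0 ?nnegrE ?powR_ge0 ?(ltW p)//.
  by rewrite divr_ge0// ltW.
by rewrite ler_pdivlMr// mulrC.
Unshelve. all: by end_near. Qed.

End scale.

Lemma powR1B (R : realType) (x be : R) : 0 < x -> x * x `^ (- be) = x `^ (1 - be).
Proof. by move=> x0; rewrite powRD ?(gt_eqF x0) ?implybT// powRr1// ltW. Qed.

Lemma mean_below_mode (R : realType) (b be : R) q r (h : R) s x : power_weight b be q ->
  h < 1 -> x%:R <= (1 - h) * mode b be s ->
  (x - r)%:R * q x <= (1 - h) `^ (1 - be) * s%:R.
Proof.
move=> [[b0 bb] /andP[be0 be1] q01 qle qE] h1 xle.
have [x0|x0] := posnP x; first by rewrite x0 sub0n mul0r mulr_ge0// powR_ge0.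
have xp : 0 < x%:R :> R by rewrite ltr0n.
have p : 0 <= 1 - h by rewrite subr_ge0 ltW.
apply: (@le_trans _ _ (b * x%:R `^ (1 - be))).
  rewrite -powR1B// mulrCA; apply: ler_pM => //; first by case/andP: (q01 x).
    by rewrite ler_nat leq_subr.
  exact: qle.
rewrite -(@mode_pow _ b be s)// mulrCA ler_pM2l// -powRM ?mode_ge0//.
by rewrite ge0_ler_powR ?nnegrE ?subr_ge0 ?(ltW be1)// mulr_ge0// mode_ge0.
Qed.

Lemma mean_above_mode (R : realType) (b be : R) q r (h : R) : power_weight b be q ->
  0 < h -> exists2 h' : R, 0 < h' & \forall s \near \oo, forall x : nat,
  (1 + h) * mode b be s <= x%:R -> (1 + h') * s%:R <= (x - r)%:R * q x.
Proof.
move=> [[b0 bb] /andP[be0 be1] q01 qle [N _ qE]] h0.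
have p : 0 < 1 - be by rewrite subr_gt0.
have h1 : 1 < (1 + h) `^ (1 - be).
  by rewrite -[ltLHS](congr1 (@^~ (1 - be)) (@powR1 R)) gt0_ltr_powR ?nnegrE//; lra.
(* Half of the gain of the mean over s; the other half absorbs the r missing trials. *)
pose h' := ((1 + h) `^ (1 - be) - 1) / 2.
have h'0 : 0 < h' by rewrite divr_gt0// subr_gt0.
exists h' => //; near=> s => x xge.
have big : N%:R + r%:R + r%:R * (1 + 2 * h') / h' <= mode b be s.
  near: s; apply: mode_large => //.
  by rewrite addr_ge0// divr_ge0 ?(ltW h'0)// mulr_ge0//; lra.
have mx : mode b be s <= x%:R.
  by apply: le_trans xge; rewrite ler_peMl ?mode_ge0//; lra.
have c0 : 0 <= r%:R * (1 + 2 * h') / h'.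
  by rewrite divr_ge0 ?(ltW h'0)// mulr_ge0//; lra.
have [N0 r0] : 0 <= N%:R :> R /\ 0 <= r%:R :> R by split.
have xN : (N <= x)%N by rewrite -(ler_nat R); move: big mx c0 r0; clear; lra.
have xr : (r <= x)%N by rewrite -(ler_nat R); move: big mx c0 N0; clear; lra.
have s0 : (0 < s)%N by near: s; apply: nbhs_infty_gt.
have x0 : 0 < x%:R :> R by apply: lt_le_trans mx; apply: mode_gt0.
rewrite qE// natrB//.
have k : (1 + h') * x%:R <= (x%:R - r%:R) * (1 + 2 * h').
  have : r%:R * (1 + 2 * h') / h' <= x%:R by move: big mx N0 r0; clear; lra.
  by rewrite ler_pdivrMr//; clear; lra.
have e1 : (1 + 2 * h') * s%:R <= b * x%:R `^ (1 - be).
  have -> : 1 + 2 * h' = (1 + h) `^ (1 - be) by rewrite /h'; field.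
  rewrite -(@mode_pow _ b be s)// mulrCA ler_pM2l// -powRM ?mode_ge0//; last lra.
  by rewrite ge0_ler_powR ?nnegrE ?(ltW p)// ?mulr_ge0 ?mode_ge0//; lra.
have h2 : 0 < 1 + 2 * h' by have := h'0; clear; lra.
have hx : 0 <= (1 + h') * x%:R by rewrite mulr_ge0 ?(ltW x0)//; have := h'0; clear; lra.
rewrite -(ler_pM2r (mulr_gt0 h2 x0)).
apply: (@le_trans _ _ ((1 + h') * x%:R * (b * x%:R `^ (1 - be)))).
  by apply: le_trans (ler_wpM2l hx e1); apply: le_of_eq; ring.
rewrite -powR1B//.
have bx : 0 <= b * (x%:R * x%:R `^ (- be)).
  by rewrite mulr_ge0 ?(ltW b0)// mulr_ge0 ?powR_ge0 ?(ltW x0).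
by apply: le_trans (ler_wpM2r bx k) _; apply: le_of_eq; ring.
Unshelve. all: by end_near. Qed.

(** Supplies the size condition on s in [binomial_cdf_increment] throughout the window. *)
Lemma mean_window_mode (R : realType) (b be : R) q : power_weight b be q ->
  \forall s \near \oo, forall x : nat, 2^-1 * mode b be s <= x%:R ->
  s%:R <= 4 * (x%:R * q x).
Proof.
move=> [[b0 bb] /andP[be0 be1] q01 qle [N _ qE]].
near=> s => x xge.
have big : 2 * N%:R <= mode b be s by near: s; apply: mode_large.
have xN : (N <= x)%N by rewrite -(ler_nat R); lra.
have s0 : (0 < s)%N by near: s; apply: nbhs_infty_gt.
have m0 : 0 < mode b be s by apply: mode_gt0.
have x0 : 0 < x%:R :> R by apply: lt_le_trans xge; rewrite mulr_gt0.
rewrite qE// [x%:R * _]mulrCA powR1B//.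
have p : 0 < 1 - be by rewrite subr_gt0.
have : b * (2^-1 * mode b be s) `^ (1 - be) <= b * x%:R `^ (1 - be).
  by rewrite ler_pM2l// ge0_ler_powR ?nnegrE ?(ltW p)// ?(ltW x0)// mulr_ge0// ltW.
rewrite powRM ?(ltW m0)// mulrCA mode_pow//.
have : 2^-1 <= (2^-1 : R) `^ (1 - be) by rewrite ger1_powR; lra.
move=> /(ler_wpM2r (_ : 0 <= s%:R)) => /(_ (ler0n _ _)).
have : 0 <= s%:R :> R by []. by clear; lra.
Unshelve. all: by end_near. Qed.

Lemma binomial_off_mean (R : realType) n (q : R) s (h : R) : 0 <= q <= 1 ->
  0 < h -> (n%:R * q <= (1 - h) * s%:R \/ (1 + h) * s%:R <= n%:R * q) ->
  binomial_pmf n q s <= expR (- (h ^+ 2 / (8 * (1 + h) ^+ 2) * s%:R)).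
Proof.
move=> q01 h0 mh; apply: le_trans (binomial_chernoff _ _ q01) _.
rewrite ler_expR lerN2; set m := n%:R * q in mh *; set M := Num.max _ _.
have m0 : 0 <= m by rewrite mulr_ge0//; case/andP: q01.
have s0 : 0 <= s%:R :> R by [].
have sM : s%:R <= M by rewrite le_max lexx.
have [M0|Mn0] := eqVneq M 0.
  have -> : s%:R = 0 :> R by apply/eqP; rewrite eq_le s0 andbT -M0.
  by rewrite M0 !mulr0 invr0 mulr0.
have Mp : 0 < M by rewrite lt_neqAle eq_sym Mn0 (le_trans s0).
have h1 : 0 < 1 + h by lra.
(* With this k the deviation is at least k times the maximum M in Chernoff's bound, even when the
   mean is far larger than s. The exponent is therefore linear in s, uniformly in the mean. *)
pose k := h / (1 + h).
have k0 : 0 < k by rewrite divr_gt0.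
have kh : k <= h by rewrite ler_pdivrMr// ler_peMr ?(ltW h0)//; lra.
have kM : k * M <= `|s%:R - m|.
  case: mh => ml.
    have ms : m <= s%:R by rewrite (le_trans ml)// ler_piMl//; lra.
    rewrite /M max_l// ger0_norm ?subr_ge0//.
    by apply: le_trans (ler_wpM2r s0 kh) _; move: ml; clear; lra.
  have ms : s%:R <= m by apply: le_trans ml; rewrite ler_peMl//; lra.
  rewrite /M max_r// ler0_norm ?subr_le0// opprB /k mulrAC ler_pdivrMr//.
  by move: ml; clear; lra.
have -> : h ^+ 2 / (8 * (1 + h) ^+ 2) = k ^+ 2 / 8 by rewrite /k; field; rewrite gt_eqF.
rewrite ler_pdivlMr ?mulr_gt0//.
have -> : k ^+ 2 / 8 * s%:R * (8 * M) = k ^+ 2 * (s%:R * M) by field.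
apply: (@le_trans _ _ ((k * M) ^+ 2)).
  by rewrite [leRHS]exprMn ler_wpM2l ?sqr_ge0// expr2 ler_wpM2r// ltW.
by rewrite -[leRHS]real_normK ?num_real// lerXn2r ?nnegrE// mulr_ge0// ltW.
Qed.

Lemma binomial_cdf_below (R : realType) n (q : R) s (h : R) : 0 <= q <= 1 -> 0 < h ->
  (0 < s)%N -> n%:R * q <= (1 - h) * s%:R -> 1 - (h ^+ 2 * s%:R)^-1 <= binomial_cdf n q s.
Proof.
move=> q01 h0 s0 ml.
have sp : 0 < s%:R :> R by rewrite ltr0n.
have hs : 0 < h * s%:R by rewrite mulr_gt0.
have ms : n%:R * q < s%:R by move: ml hs; clear; lra.
have m0 : 0 <= n%:R * q by rewrite mulr_ge0//; case/andP: q01.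
apply: le_trans (binomial_cdf_lower q01 ms); rewrite lerD2l lerN2.
have h1 : (h * s%:R) ^+ 2 <= (s%:R - n%:R * q) ^+ 2.
  by rewrite lerXn2r ?nnegrE ?(ltW hs)//; move: ml ms; clear; lra.
apply: (@le_trans _ _ (s%:R / (h * s%:R) ^+ 2)).
  by apply: ler_pM => //; [rewrite invr_ge0 sqr_ge0|exact: ltW|
    rewrite lef_pV2 ?posrE ?exprn_gt0// subr_gt0].
by apply: le_of_eq; field; rewrite !gt_eqF.
Qed.

Lemma binomial_cdf_above (R : realType) n (q : R) s (h : R) : 0 <= q <= 1 -> 0 < h ->
  (0 < s)%N -> (1 + h) * s%:R <= n%:R * q ->
  binomial_cdf n q s <= (1 + h) ^+ 2 / (h ^+ 2 * s%:R).
Proof.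
move=> q01 h0 s0; set m := n%:R * q => ml.
have sp : 0 < s%:R :> R by rewrite ltr0n.
have hs : 0 < h * s%:R by rewrite mulr_gt0.
have ms : s%:R < m by move: ml hs; clear; lra.
have mp : 0 < m by apply: lt_trans ms.
apply: le_trans (binomial_cdf_upper q01 ms) _; rewrite -/m.
have h1 : 0 < 1 + h by lra.
have k : h / (1 + h) * m <= m - s%:R.
  by rewrite mulrAC ler_pdivrMr//; move: ml; clear; lra.
have kp : 0 < h / (1 + h) * m by rewrite mulr_gt0// divr_gt0.
apply: (@le_trans _ _ (m / (h / (1 + h) * m) ^+ 2)).
  rewrite ler_wpM2l ?(ltW mp)// lef_pV2 ?posrE ?exprn_gt0 ?subr_gt0//.
  by rewrite lerXn2r ?nnegrE ?(ltW kp)// subr_ge0 ltW.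
have -> : m / (h / (1 + h) * m) ^+ 2 = (1 + h) ^+ 2 / h ^+ 2 / m.
  by field; rewrite !gt_eqF.
rewrite [(h ^+ 2 * _)^-1]invfM mulrA ler_wpM2l ?divr_ge0 ?sqr_ge0// lef_pV2 ?posrE//.
exact: ltW.
Qed.

(** * Binomial mixtures *)

(** The bound is uniform in x, so the x outside the window contribute at most the total weight times
    an exponentially small factor. *)
Lemma outside_window (R : realType) (b be : R) q r (h : R) : power_weight b be q ->
  0 < h -> h < 1 -> exists2 c : R, 0 < c & \forall s \near \oo, forall x : nat,
  (x%:R <= (1 - h) * mode b be s \/ (1 + h) * mode b be s <= x%:R) ->
  binomial_pmf (x - r) (q x) s <= expR (- (c * s%:R)).
Proof.
move=> pw h0 h1; have [_ /andP[be0 be1] q01 _ _] := pw.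
have [h' h'0 ab] := mean_above_mode r pw h0.
have p : 0 < 1 - be by rewrite subr_gt0.
pose k := Num.min h' (1 - (1 - h) `^ (1 - be)).
have t1 : (1 - h) `^ (1 - be) < 1.
  by rewrite -[ltRHS](congr1 (@^~ (1 - be)) (@powR1 R)) gt0_ltr_powR ?nnegrE//; lra.
have k0 : 0 < k by rewrite lt_min h'0 subr_gt0.
have kh : k <= h' by rewrite ge_min lexx.
have kt : k <= 1 - (1 - h) `^ (1 - be) by rewrite ge_min lexx orbT.
exists (k ^+ 2 / (8 * (1 + k) ^+ 2)).
  by rewrite divr_gt0 ?exprn_gt0// mulr_gt0// exprn_gt0//; lra.
near=> s => x xs; apply: binomial_off_mean => //.
have s0 : 0 <= s%:R :> R by [].
case: xs => xs; [left|right].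
  apply: le_trans (mean_below_mode r pw h1 xs) _; rewrite ler_wpM2r//.
  by have := kt; clear; lra.
have : (1 + h') * s%:R <= (x - r)%:R * q x by move: x xs; near: s.
by apply: le_trans; rewrite ler_wpM2r// lerD2l.
Unshelve. all: by end_near. Qed.

(** The mean is off s by a fixed proportion at either end, so Chebyshev's inequality gives an error
    of order 1/s. *)
Lemma cdf_window_ends (R : realType) (b be : R) q r (h e : R) : power_weight b be q ->
  0 < h -> h < 1 -> 0 < e -> \forall s \near \oo, forall x : nat,
  (x%:R <= (1 - h) * mode b be s -> 1 - e <= binomial_cdf (x - r) (q x) s) /\
  ((1 + h) * mode b be s <= x%:R -> binomial_cdf (x - r) (q x) s <= e).
Proof.
move=> pw h0 h1 e0; have [_ /andP[be0 be1] q01 _ _] := pw.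
have [h' h'0 ab] := mean_above_mode r pw h0.
have p : 0 < 1 - be by rewrite subr_gt0.
pose k := 1 - (1 - h) `^ (1 - be).
have k0 : 0 < k.
  rewrite subr_gt0 -[ltRHS](congr1 (@^~ (1 - be)) (@powR1 R)).
  by rewrite gt0_ltr_powR ?nnegrE//; lra.
near=> s => x; have s0 : (0 < s)%N by near: s; apply: nbhs_infty_gt.
have sp : 0 < s%:R :> R by rewrite ltr0n.
split=> xs.
  apply: le_trans (@binomial_cdf_below _ _ _ _ k (q01 x) k0 s0 _); last first.
    by rewrite /k opprB addrCA subrr addr0; apply: (mean_below_mode _ pw).
  rewrite lerD2l lerN2 invf_ple ?posrE ?mulr_gt0 ?exprn_gt0//.
  rewrite -ler_pdivrMl ?exprn_gt0//; near: s; exact: nbhs_infty_ger.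
have ab' : (1 + h') * s%:R <= (x - r)%:R * q x by move: x xs; near: s.
apply: le_trans (binomial_cdf_above (q01 x) h'0 s0 ab') _.
rewrite ler_pdivrMr ?mulr_gt0 ?exprn_gt0// mulrA -ler_pdivrMl ?mulr_gt0 ?exprn_gt0//.
near: s; exact: nbhs_infty_ger.
Unshelve. all: by end_near. Qed.

(** The error of each increment is relative to a nonnegative term, so summation keeps the same
    relative error. *)
Lemma window_sum (R : realType) (b be : R) q r (h e : R) : power_weight b be q ->
  0 < h -> h <= 2^-1 -> 0 < e -> \forall s \near \oo, forall L U : nat,
  (L <= U)%N -> (1 - h) * mode b be s <= L%:R ->
  `|binomial_cdf (L - r) (q L) s - binomial_cdf (U - r) (q U) s
    - (1 - be) * \sum_(L <= x < U) q x * binomial_pmf (x - r) (q x) s|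
  <= e * \sum_(L <= x < U) q x * binomial_pmf (x - r) (q x) s.
Proof.
move=> pw h0 h2 e0; have [[b0 _] /andP[be0 be1] q01 _ _] := pw.
have [N _ inc] := binomial_cdf_increment r pw e0.
near=> s => L U LU Lge.
have m0 := mode_ge0 b be s.
have NL : (N <= L)%N.
  rewrite -(ler_nat R); apply: le_trans Lge.
  have : 2 * N%:R <= mode b be s by near: s; apply: mode_large.
  have : 0 <= (2^-1 - h) * mode b be s by rewrite mulr_ge0// subr_ge0.
  by clear; lra.
have -> : binomial_cdf (L - r) (q L) s - binomial_cdf (U - r) (q U) s =
    \sum_(L <= x < U) (binomial_cdf (x - r) (q x) s - binomial_cdf (x.+1 - r) (q x.+1) s).
  rewrite -opprB -(telescope_sumr (fun x => binomial_cdf (x - r) (q x) s))// -sumrN.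
  by apply: eq_bigr => x _; rewrite opprB.
rewrite !mulr_sumr -sumrB; apply: le_trans (ler_norm_sum _ _ _) _.
apply: ler_sum_nat => x /andP[Lx xU].
apply: inc; first exact: leq_trans Lx.
have Lx' : L%:R <= x%:R :> R by rewrite ler_nat.
have : 2^-1 * mode b be s <= x%:R.
  apply: le_trans Lx'; apply: le_trans Lge; rewrite ler_wpM2r//.
  by have := h2; clear; lra.
by move: x {Lx Lx' xU}; near: s; apply: mean_window_mode pw.
Unshelve. all: by end_near. Qed.

(** On the window w x is about (A / b) x^(-(ga - be)) q x. The power of x varies there only by
    factors 1 - h and 1 + h, and is monotone as be <= ga; the remaining sum of q x times the
    probabilities is close to 1 / (1 - be). The window width h stays fixed here and is sent to 0
    afterwards. *)
Lemma mixture_bounds (R : realType) (b be : R) q r (w : nat -> R) (A ga W h : R)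
    (S : nat -> R) :
  power_weight b be q -> 0 < A -> be <= ga -> (forall x, 0 <= w x) ->
  (forall N, \sum_(0 <= x < N) w x <= W) ->
  (fun x : nat => w x * x%:R `^ ga) @ \oo --> A ->
  (forall s, (fun N => \sum_(0 <= x < N) w x * binomial_pmf (x - r) (q x) s) @ \oo --> S s) ->
  0 < h -> h <= 2^-1 -> h < 1 - be -> h < A ->
  \forall s \near \oo,
  (A - h) / b * (1 + h) `^ (- (ga - be)) * ((1 - 2 * h) / (1 - be + h))
  <= S s * mode b be s `^ (ga - be) <=
  (A + h) / b * (1 - h) `^ (- (ga - be)) * (1 - be - h)^-1 + h.
Proof.
move=> pw A0 bega w0 wW wA SS h0 h2 hbe hA.
have [[b0 _] /andP[be0 be1] q01 qle [N1 _ qE]] := pw.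
have W0 : 0 <= W by have := wW 0%N; rewrite big_nil.
set v := ga - be; have v0 : 0 <= v by rewrite subr_ge0.
have h1 : h < 1 by have := h2; clear; lra.
have hh0 : 0 < h / 2 by rewrite divr_gt0.
have hh1 : h / 2 < 1 by have := h2; clear; lra.
have p : 0 < 1 - be by rewrite subr_gt0.
have [c c0 out] := outside_window r pw h0 h1.
have [N2 _ wN] : \forall x \near \oo, A - h <= w x * x%:R `^ ga <= A + h.
  move/cvgrPdist_le: wA => /(_ h h0); apply: filterS => x; rewrite ler_norml.
  by clear => /andP[? ?]; apply/andP; split; lra.
have [K K0 expK] := @expR_powR_bound R c ((1 - be)^-1 * v) c0.
have bv : 0 < b `^ ((1 - be)^-1 * v) by rewrite powR_gt0.
near=> s.
have s0 : (0 < s)%N by near: s; apply: nbhs_infty_gt.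
have sp : 0 < s%:R :> R by rewrite ltr0n.
have m0 : 0 < mode b be s by apply: mode_gt0.
have mN : 2 * (N1%:R + N2%:R) + 2 / h <= mode b be s.
  near: s; apply: mode_large => //.
  by apply: addr_ge0; [rewrite -natrD mulr_ge0|rewrite divr_ge0 ?(ltW h0)].
pose L := (Num.truncn ((1 - h) * mode b be s)).+1.
pose U := (Num.truncn ((1 + h) * mode b be s)).+1.
have [L1 L2] : (1 - h) * mode b be s < L%:R /\ L%:R <= (1 - h) * mode b be s + 1.
  split; first exact: truncnS_gt.
  rewrite /L -natr1 lerD2r truncn_le mulr_ge0 ?(ltW m0)//; have := h1; clear; lra.
have U1 : (1 + h) * mode b be s < U%:R by exact: truncnS_gt.
have xU x : (x < U)%N -> x%:R <= (1 + h) * mode b be s.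
  rewrite ltnS => xU; apply: (@le_trans _ _ (Num.truncn ((1 + h) * mode b be s))%:R).
    by rewrite ler_nat.
  by rewrite truncn_le mulr_ge0 ?(ltW m0)//; have := h0; clear; lra.
have xL x : (x < L)%N -> x%:R <= (1 - h) * mode b be s.
  rewrite ltnS => xL; apply: (@le_trans _ _ (Num.truncn ((1 - h) * mode b be s))%:R).
    by rewrite ler_nat.
  by rewrite truncn_le mulr_ge0 ?(ltW m0)//; have := h1; clear; lra.
have LU : (L <= U)%N.
  rewrite ltnS; apply: le_truncn; rewrite ler_wpM2r ?(ltW m0)//.
  by have := h0; clear; lra.
(* Rounding up puts L beyond (1 - h) times the mode. The distribution function at L is therefore
   controlled with h / 2 in place of h. *)
have L3 : L%:R <= (1 - h / 2) * mode b be s.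
  apply: le_trans L2 _.
  have : 2 / h <= mode b be s.
    by apply: le_trans mN; rewrite lerDr -natrD mulr_ge0.
  by rewrite ler_pdivrMr//; clear; lra.
have NL : (N1 <= L)%N /\ (N2 <= L)%N.
  have mm : 2 * (N1%:R + N2%:R) <= mode b be s.
    by apply: le_trans mN; rewrite lerDl divr_ge0// ltW.
  have hm : 0 <= (2^-1 - h) * mode b be s by rewrite mulr_ge0 ?(ltW m0)// subr_ge0.
  have [n1 n2] : 0 <= N1%:R :> R /\ 0 <= N2%:R :> R by split.
  by rewrite -!(ler_nat R); have := (L1, mm, hm, n1, n2); clear => -[[[[]]]] *; split; lra.
set v0B := fun x => binomial_pmf (x - r) (q x) s.
pose I := \sum_(L <= x < U) q x * v0B x.
have B0 x : 0 <= v0B x by apply: binomial_pmf_ge0.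
have I0 : 0 <= I by apply: sumr_ge0 => x _; rewrite mulr_ge0//; case/andP: (q01 x).
have [GL GU] : 1 - h <= binomial_cdf (L - r) (q L) s /\ binomial_cdf (U - r) (q U) s <= h.
  split.
    have : forall x : nat,
      (x%:R <= (1 - h / 2) * mode b be s -> 1 - h <= binomial_cdf (x - r) (q x) s) /\
      ((1 + h / 2) * mode b be s <= x%:R -> binomial_cdf (x - r) (q x) s <= h).
      by near: s; exact: cdf_window_ends.
    by move=> /(_ L)[+ _]; apply.
  have : forall x : nat,
      (x%:R <= (1 - h) * mode b be s -> 1 - h <= binomial_cdf (x - r) (q x) s) /\
      ((1 + h) * mode b be s <= x%:R -> binomial_cdf (x - r) (q x) s <= h).
    by near: s; exact: cdf_window_ends.
  by move=> /(_ U)[_]; apply; exact: ltW.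
have GL1 := binomial_cdf_le1 (L - r) s (q01 L).
have GU0 := binomial_cdf_ge0 (U - r) s (q01 U).
have IG : `|binomial_cdf (L - r) (q L) s - binomial_cdf (U - r) (q U) s - (1 - be) * I| <= h * I.
  have : forall L U : nat, (L <= U)%N -> (1 - h) * mode b be s <= L%:R ->
    `|binomial_cdf (L - r) (q L) s - binomial_cdf (U - r) (q U) s
    - (1 - be) * \sum_(L <= x < U) q x * binomial_pmf (x - r) (q x) s|
    <= h * \sum_(L <= x < U) q x * binomial_pmf (x - r) (q x) s.
    by near: s; exact: window_sum.
  by apply => //; exact: ltW.
have [Ilo Ihi] : (1 - 2 * h) / (1 - be + h) <= I /\ I <= (1 - be - h)^-1.
  move: IG; rewrite ler_norml => /andP[g1 g2].
  have d1 : 0 < 1 - be + h by have := (p, h0); clear => -[] *; lra.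
  have d2 : 0 < 1 - be - h by have := hbe; clear; lra.
  rewrite ler_pdivrMr// -[(1 - be - h)^-1]mul1r ler_pdivlMr//.
  by have := (g1, g2, GL, GU, GL1, GU0); clear => -[[[[[]]]]] *; split; lra.
have win x : (L <= x < U)%N ->
    (A - h) / b * ((1 + h) * mode b be s) `^ (- v) * (q x * v0B x) <= w x * v0B x
    <= (A + h) / b * ((1 - h) * mode b be s) `^ (- v) * (q x * v0B x).
  move=> /andP[Lx Ux].
  have x0 : 0 < x%:R :> R by rewrite ltr0n; apply: leq_trans Lx.
  have q_ : q x = b * x%:R `^ (- be) by apply: qE; apply: leq_trans Lx; case: NL.
  have /andP[w1 w2] : A - h <= w x * x%:R `^ ga <= A + h.
    by apply: wN; apply: leq_trans Lx; case: NL.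
  have g0 : 0 < x%:R `^ ga by rewrite powR_gt0.
  (* Trades x^(-ga) for q x times x^(-v): a factor q x is split off for the telescoping sum, and
     only x^(-v) is replaced by its value at the ends of the window. *)
  have e : q x * x%:R `^ (- v) = b * (x%:R `^ ga)^-1.
    rewrite q_ -mulrA -powRD ?(gt_eqF x0) ?implybT// -powRN; congr (_ * _ `^ _).
    by rewrite /v; clear; ring.
  have lo : ((1 + h) * mode b be s) `^ (- v) <= x%:R `^ (- v).
    by apply: powR_anti => //; apply: xU.
  have hi : x%:R `^ (- v) <= ((1 - h) * mode b be s) `^ (- v).
    apply: powR_anti => //; first by rewrite mulr_gt0// subr_gt0.
    by apply: le_trans (ltW L1) _; rewrite ler_nat.
  have q0 : 0 <= q x by case/andP: (q01 x).
  rewrite !mulrA !ler_wpM2r// /=.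
    apply: (@le_trans _ _ ((A + h) / b * (q x * x%:R `^ (- v)))).
      rewrite e mulrA mulfVK ?gt_eqF// ler_pdivlMr//.
    rewrite [q x * _]mulrC mulrA ler_wpM2r// ler_wpM2l// divr_ge0 ?(ltW b0)//.
    by have := (A0, h0); clear => -[] *; lra.
  apply: (@le_trans _ _ ((A - h) / b * (q x * x%:R `^ (- v)))).
    rewrite [q x * _]mulrC mulrA ler_wpM2r// ler_wpM2l// divr_ge0 ?(ltW b0)//.
    by have := hA; clear; lra.
  by rewrite e mulrA mulfVK ?gt_eqF// ler_pdivrMr.
have outx x : (x < L)%N \/ (U <= x)%N -> w x * v0B x <= expR (- (c * s%:R)) * w x.
  move=> xLU; rewrite mulrC ler_wpM2r//.
  have : x%:R <= (1 - h) * mode b be s \/ (1 + h) * mode b be s <= x%:R.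
    case: xLU => ?; [left; exact: xL|right].
    by apply: le_trans (ltW U1) _; rewrite ler_nat.
  by rewrite /v0B; move: x {xLU}; near: s.
have mv : 0 < mode b be s `^ v by rewrite powR_gt0.
have mvE a : 0 < a -> (a * mode b be s) `^ (- v) * mode b be s `^ v = a `^ (- v).
  move=> a0; rewrite powRM ?(ltW a0) ?(ltW m0)// -mulrA [mode _ _ _ `^ (- v)]powRN.
  by rewrite mulVf ?mulr1// gt_eqF.
have mvE2 X a : 0 < a ->
    X * (a * mode b be s) `^ (- v) * I * mode b be s `^ v = X * a `^ (- v) * I.
  by move=> a0; rewrite -(mvE a a0); ring.
have small : W * expR (- (c * s%:R)) * mode b be s `^ v <= h.
  rewrite /mode -powRrM powRM ?invr_ge0 ?(ltW b0)//.
  rewrite mulrA.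
  have s1 : 1 <= s%:R :> R by rewrite ler1n.
  apply: (@le_trans _ _ (W * (K / s%:R) * b^-1 `^ ((1 - be)^-1 * v))).
    by rewrite ler_wpM2r ?powR_ge0// -mulrA ler_wpM2l// expK.
  rewrite mulrA mulrAC ler_pdivrMr// -ler_pdivrMl//.
  by near: s; apply: nbhs_infty_ger.
have mid N : (U <= N)%N ->
  (A - h) / b * ((1 + h) * mode b be s) `^ (- v) * I <= \sum_(0 <= x < N) w x * v0B x
  <= (A + h) / b * ((1 - h) * mode b be s) `^ (- v) * I + W * expR (- (c * s%:R)).
  move=> UN; rewrite (big_cat_nat (leq0n L) (leq_trans LU UN))/= (big_cat_nat LU UN)/=.
  apply/andP; split.
    rewrite addrCA; apply: ler_wpDr.
      by rewrite addr_ge0// sumr_ge0// => x _; rewrite mulr_ge0.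
    by rewrite /I mulr_sumr; apply: ler_sum_nat => x /win /andP[].
  rewrite addrCA lerD//.
    by rewrite /I mulr_sumr; apply: ler_sum_nat => x /win /andP[].
  apply: (@le_trans _ _ (expR (- (c * s%:R)) * (\sum_(0 <= x < L) w x + \sum_(U <= x < N) w x))).
    rewrite mulrDr !mulr_sumr lerD//.
      by apply: ler_sum_nat => x /andP[_ ?]; apply: outx; left.
    by apply: ler_sum_nat => x /andP[? _]; apply: outx; right.
  rewrite mulrC ler_wpM2r ?expR_ge0//; apply: le_trans (wW N).
  rewrite (big_cat_nat (leq0n L) (leq_trans LU UN))/= lerD2l (big_cat_nat LU UN)/= lerDr.
  by apply: sumr_ge0.
have [Slo Shi] : (A - h) / b * ((1 + h) * mode b be s) `^ (- v) * I <= S s /\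
  S s <= (A + h) / b * ((1 - h) * mode b be s) `^ (- v) * I + W * expR (- (c * s%:R)).
  split.
    apply: (cvgr_to_ge (SS s)); exists U => // N /= UN.
    by have /andP[] := mid N UN.
  apply: (cvgr_to_le (SS s)); exists U => // N /= UN.
  by have /andP[] := mid N UN.
have ph : 0 < 1 + h by have := h0; clear; lra.
have mh : 0 < 1 - h by have := h1; clear; lra.
apply/andP; split.
  apply: le_trans (ler_wpM2r (ltW mv) Slo).
  rewrite mvE2// ler_wpM2l//.
  rewrite mulr_ge0 ?powR_ge0// divr_ge0 ?(ltW b0)//; have := hA; clear; lra.
apply: le_trans (ler_wpM2r (ltW mv) Shi) _; rewrite mulrDl lerD//.
rewrite mvE2// ler_wpM2l//.
rewrite mulr_ge0 ?powR_ge0// divr_ge0 ?(ltW b0)//; have := (A0, h0); clear => -[] *; lra.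
Unshelve. all: by end_near. Qed.

(** The two bounds of [mixture_bounds] have the same limit as h tends to 0 from the right, so one
    small h suffices for a given precision. *)
Lemma mixture_asymptotics (R : realType) (b be : R) q r (w : nat -> R) (A ga W : R)
    (S : nat -> R) :
  power_weight b be q -> 0 < A -> be <= ga -> (forall x, 0 <= w x) ->
  (forall N, \sum_(0 <= x < N) w x <= W) ->
  (fun x : nat => w x * x%:R `^ ga) @ \oo --> A ->
  (forall s, (fun N => \sum_(0 <= x < N) w x * binomial_pmf (x - r) (q x) s) @ \oo --> S s) ->
  (fun s : nat => S s * s%:R `^ ((ga - be) / (1 - be))) @ \oo -->
    A / (b * (1 - be)) * b `^ ((ga - be) / (1 - be)).
Proof.
move=> pw A0 bega w0 wW wA SS.
have [[b0 _] /andP[be0 be1] _ _ _] := pw.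
have p : 0 < 1 - be by rewrite subr_gt0.
set v := ga - be.
(* As the mode is (s / b)^(1 / (1 - be)), turning its power v into a power of s produces the factor
   b^(v / (1 - be)). *)
have -> : (fun s : nat => S s * s%:R `^ (v / (1 - be))) =
    (fun s : nat => S s * mode b be s `^ v * b `^ (v / (1 - be))).
  apply/funext => s; rewrite /mode -powRrM [_^-1 * v]mulrC -mulrA -powRM ?divr_ge0 ?(ltW b0)//.
  by rewrite mulfVK ?gt_eqF.
apply: cvgMl.
pose lo (h : R) := (A - h) / b * (1 + h) `^ (- v) * ((1 - 2 * h) / (1 - be + h)).
pose hi (h : R) := (A + h) / b * (1 - h) `^ (- v) * (1 - be - h)^-1 + h.
have id0 : (fun h : R => h) @ 0^'+ --> (0 : R) by apply: cvg_at_right_filter; exact: cvg_id.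
have cst (a : R) : (fun _ : R => a) @ 0^'+ --> a by exact: cvg_cst.
have add (a : R) : (fun h : R => a + h) @ 0^'+ --> a.
  by rewrite -[X in _ --> X]addr0; apply: cvgD.
have sub (a : R) : (fun h : R => a - h) @ 0^'+ --> a.
  by rewrite -[X in _ --> X]subr0; apply: cvgB.
have lo_cvg : lo @ 0^'+ --> A / (b * (1 - be)).
  have -> : A / (b * (1 - be)) = A / b * 1 * ((1 - 2 * 0) / (1 - be)).
    by field; rewrite !gt_eqF.
  apply: cvgM; first apply: cvgM; first exact: cvgMl (sub A).
    by apply: cvg_powR1; apply: add.
  apply: cvgM; first by apply: cvgB => //; apply: cvgM.
  by apply: cvgV; rewrite ?gt_eqF//; apply: add.
have hi_cvg : hi @ 0^'+ --> A / (b * (1 - be)).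
  have -> : A / (b * (1 - be)) = A / b * 1 * (1 - be)^-1 + 0.
    by field; rewrite !gt_eqF.
  apply: cvgD => //; apply: cvgM; first apply: cvgM; first exact: cvgMl (add A).
    by apply: cvg_powR1; apply: sub.
  by apply: cvgV; rewrite ?gt_eqF//; apply: sub.
apply/cvgrPdist_le => e e0.
have [h [h0 h2 hbe hA] [hlo hhi]] : exists2 h : R,
    [/\ 0 < h, h <= 2^-1, h < 1 - be & h < A] &
    `|A / (b * (1 - be)) - lo h| <= e /\ `|A / (b * (1 - be)) - hi h| <= e.
  have : \forall h \near 0^'+, [/\ 0 < h, h <= 2^-1, h < 1 - be & h < A] /\
    (`|A / (b * (1 - be)) - lo h| <= e /\ `|A / (b * (1 - be)) - hi h| <= e).
    near=> h; split; last first.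
      by split; near: h; [move/cvgrPdist_le: lo_cvg|move/cvgrPdist_le: hi_cvg]; apply.
    split; near: h.
    - exact: nbhs_right_gt.
    - exact: nbhs_right_le.
    - exact: nbhs_right_lt.
    - exact: nbhs_right_lt.
  by move=> /filter_ex[h [? ?]]; exists h.
have := mixture_bounds pw A0 bega w0 wW wA SS h0 h2 hbe hA.
apply: filterS => s; rewrite -/v -/(lo h) -/(hi h) => /andP[l1 l2].
move: hlo hhi; rewrite !ler_norml => /andP[? ?] /andP[? ?]; apply/andP; split; lra.
Unshelve. all: by end_near. Qed.

(** * Convolutions and compound Poisson laws *)

Lemma natr_shift_ratio (R : realType) (i : nat) :
  (fun t : nat => t%:R / (t - i)%:R : R) @ \oo --> (1 : R).
Proof.
apply/cvgrPdist_le => e e0; near=> t.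
have it : (i < t)%N by near: t; apply: nbhs_infty_gt.
have d0 : 0 < t%:R - i%:R :> R by rewrite subr_gt0 ltr_nat.
have big : i%:R / e + i%:R <= t%:R by near: t; apply: nbhs_infty_ger.
rewrite natrB ?(ltnW it)//.
have -> : 1 - t%:R / (t%:R - i%:R) = - (i%:R / (t%:R - i%:R)) :> R.
  by field; rewrite gt_eqF.
rewrite normrN ger0_norm ?divr_ge0 ?(ltW d0)// ler_pdivrMr// mulrC -ler_pdivrMr//.
by rewrite lerBrDr.
Unshelve. all: by end_near. Qed.

Lemma regular_shift (R : realType) (u : nat -> R) (k C : R) (i : nat) :
  (fun t : nat => u t * t%:R `^ k) @ \oo --> C ->
  (fun t : nat => u (t - i)%N * t%:R `^ k) @ \oo --> C.
Proof.
move=> uC.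
have h : (fun t : nat => u (t - i)%N * (t - i)%:R `^ k * (t%:R / (t - i)%:R) `^ k) @ \oo --> C.
  rewrite -[X in _ --> X]mulr1; apply: cvgM.
    have := uC; rewrite -(cvg_centern i); exact.
  by apply: cvg_powR1; apply: natr_shift_ratio.
apply: cvg_trans h; apply: near_eq_cvg; near=> t.
have it : (i < t)%N by near: t; apply: nbhs_infty_gt.
have d0 : 0 < (t - i)%:R :> R by rewrite ltr0n subn_gt0.
rewrite -mulrA -powRM ?divr_ge0// mulrCA mulfV ?mulr1//.
by rewrite gt_eqF.
Unshelve. all: by end_near. Qed.

Definition convol (R : realType) (f h : nat -> R) (t : nat) : R :=
  \sum_(0 <= i < t.+1) f i * h (t - i)%N.

Lemma convol_split (R : realType) (f h : nat -> R) M (t : nat) : (M.*2 <= t)%N ->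
  convol f h t = \sum_(0 <= i < M) f i * h (t - i)%N +
    \sum_(M <= i < t./2.+1) f i * h (t - i)%N +
    \sum_(t./2.+1 <= i < t.+1) f i * h (t - i)%N.
Proof.
move=> Mt; rewrite /convol.
have Mt2 : (M <= t./2.+1)%N.
  by apply: leqW; rewrite -[M]doubleK half_leq.
have tt : (t./2.+1 <= t.+1)%N by rewrite ltnS -{2}(odd_double_half t) -addnn addnA leq_addl.
by rewrite (big_cat_nat (leq0n _) tt)/= (big_cat_nat (leq0n M) Mt2).
Qed.

Lemma sum_rev_tail (R : realType) (h : nat -> R) m t : (m <= t.+1)%N ->
  \sum_(m <= i < t.+1) h (t - i)%N = \sum_(0 <= j < t.+1 - m) h j.
Proof.
move=> mt; rewrite [RHS]big_nat_rev/= add0n -{1}[m]addn0.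
rewrite -{1}(subnK mt) [(t.+1 - m + m)%N]addnC addn0 -{1}[m]add0n big_addn addKn.
rewrite big_nat [RHS]big_nat; apply: eq_bigr => i /andP[_ it]; congr h.
by rewrite [(t.+1 - m - i.+1)%N]subnAC subSS -subnDA addnC.
Qed.

Lemma partial_sum_le (R : realType) (f : nat -> R) (F : R) N : (forall i, 0 <= f i) ->
  (fun N => \sum_(0 <= i < N) f i) @ \oo --> F -> \sum_(0 <= i < N) f i <= F.
Proof.
move=> f0 fF; apply: (cvgr_to_ge fF); exists N => // n /= Nn.
by rewrite (big_cat_nat (leq0n N) Nn)/= lerDl sumr_ge0.
Qed.

Lemma half_powR (R : realType) (k : R) (t i : nat) : 0 <= k -> (t <= i.*2)%N ->
  t%:R `^ k <= 2 `^ k * i%:R `^ k.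
Proof.
move=> k0 ti; rewrite -powRM// ge0_ler_powR ?nnegrE ?mulr_ge0//.
by rewrite -natrM ler_nat mul2n.
Qed.

Lemma cvg_sum_nat (R : realType) (F : nat -> nat -> R) (L : nat -> R) M :
  (forall i, F i @ \oo --> L i) ->
  (fun t => \sum_(0 <= i < M) F i t) @ \oo --> \sum_(0 <= i < M) L i.
Proof.
move=> FL; elim: M => [|M IH].
  rewrite big_nil; have -> : (fun t => \sum_(0 <= i < 0) F i t) = (fun=> 0).
    by apply/funext => t; rewrite big_nil.
  exact: cvg_cst.
rewrite big_nat_recr//=.
have -> : (fun t => \sum_(0 <= i < M.+1) F i t) =
    (fun t => \sum_(0 <= i < M) F i t + F M t).
  by apply/funext => t; rewrite big_nat_recr.
exact: cvgD.
Qed.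

(** The sum is cut at a fixed M and at t/2. Below M each h (t - i) behaves like h t, which gives C
    times almost all of F. From M to t/2, h (t - i) is still of order t^(-k), but little mass of f
    is left. Beyond t/2, f i is o(t^(-k)) and h is summable. *)
Lemma convol_asymptotics (R : realType) (f h : nat -> R) (k C F H : R) :
  0 <= k -> (forall i, 0 <= f i) -> (forall i, 0 <= h i) ->
  (forall N, \sum_(0 <= i < N) h i <= H) ->
  (fun N => \sum_(0 <= i < N) f i) @ \oo --> F ->
  (fun t : nat => f t * t%:R `^ k) @ \oo --> (0 : R) ->
  (fun t : nat => h t * t%:R `^ k) @ \oo --> C ->
  (fun t : nat => convol f h t * t%:R `^ k) @ \oo --> C * F.
Proof.
move=> k0 f0 h0 hH fF fk hk.
have H0 : 0 <= H by have := hH 0%N; rewrite big_nil.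
have C0 : 0 <= C.
  by apply: (cvgr_to_ge hk); near=> t; rewrite mulr_ge0 ?powR_ge0.
have p2 : 0 < (2 : R) `^ k by rewrite powR_gt0.
apply/cvgrPdist_le => e e0.
(* [c1] collects the factors of the mass of f beyond M: C from truncating the head, 2^k (C + 1) from
   the middle range. [c2] is the factor of the last range. The summands 1 keep both positive. *)
pose c1 := C + 2 `^ k * (C + 1) + 1; pose c2 := 2 `^ k * H + 1.
have c10 : 0 < c1.
  by rewrite /c1 ltr_wpDl// addr_ge0// mulr_ge0 ?(ltW p2)// addr_ge0.
have c20 : 0 < c2 by rewrite /c2 ltr_wpDl// mulr_ge0 // ltW.
have e10 : 0 < e / 3 / c1 by rewrite !divr_gt0.
have e20 : 0 < e / 3 / c2 by rewrite !divr_gt0.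
have [M _ /(_ _ (leqnn M)) FM] := (iffLR (cvgrPdist_le _ _) fF) _ e10.
have [J _ hJ] : \forall t \near \oo, h t * t%:R `^ k <= C + 1.
  by apply: (cvgr_le C) => //; rewrite ltrDl.
have [J' _ fJ] : \forall t \near \oo, f t * t%:R `^ k <= e / 3 / c2.
  by apply: (cvgr_le 0).
have head : (fun t : nat => \sum_(0 <= i < M) f i * (h (t - i)%N * t%:R `^ k)) @ \oo -->
    \sum_(0 <= i < M) f i * C.
  apply: (@cvg_sum_nat _ (fun i t => f i * (h (t - i)%N * t%:R `^ k))) => i.
  by apply: cvgMr; apply: regular_shift.
near=> t.
have tM : (M.*2 <= t)%N by near: t; apply: nbhs_infty_ge.
have tJ : (J.*2.+2 <= t)%N by near: t; apply: nbhs_infty_ge.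
have tJ' : (J'.*2 <= t)%N by near: t; apply: nbhs_infty_ge.
have hd : `|\sum_(0 <= i < M) f i * C - \sum_(0 <= i < M) f i * (h (t - i)%N * t%:R `^ k)| <= e / 3.
  by near: t; apply: (iffLR (cvgrPdist_le _ _) head); rewrite divr_gt0.
rewrite (convol_split _ _ tM) 2!mulrDl.
set T1 := _ * _ `^ k; set T2 := _ * _ `^ k; set T3 := _ * _ `^ k.
have T1E : T1 = \sum_(0 <= i < M) f i * (h (t - i)%N * t%:R `^ k).
  by rewrite /T1 mulr_suml; apply: eq_bigr => i _; rewrite mulrA.
rewrite -mulr_suml -T1E in hd.
have FMle := partial_sum_le M f0 fF.
have FMe : F - \sum_(0 <= i < M) f i <= e / 3 / c1 by apply: le_trans FM; exact: ler_norm.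
have T20 : 0 <= T2 by rewrite mulr_ge0 ?powR_ge0// sumr_ge0// => i _; rewrite mulr_ge0.
have T30 : 0 <= T3 by rewrite mulr_ge0 ?powR_ge0// sumr_ge0// => i _; rewrite mulr_ge0.
have oddle : (t./2.*2 <= t)%N by rewrite -{2}(odd_double_half t) leq_addl.
have T2le : T2 <= 2 `^ k * (C + 1) * (e / 3 / c1).
  apply: (@le_trans _ _ (\sum_(M <= i < t./2.+1) f i * (2 `^ k * (C + 1)))).
    rewrite /T2 mulr_suml; apply: ler_sum_nat => i /andP[_ it].
    rewrite -mulrA ler_wpM2l//.
    have i2 : (i.*2 <= t)%N by apply: leq_trans oddle; rewrite leq_double -ltnS.
    have ti : (t <= (t - i).*2)%N.
      by rewrite doubleB -addnn -addnBA// leq_addr.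
    apply: (@le_trans _ _ (h (t - i)%N * (2 `^ k * (t - i)%:R `^ k))).
      by rewrite ler_wpM2l// half_powR.
    rewrite mulrCA ler_wpM2l ?(ltW p2)//; apply: hJ => /=.
    rewrite -leq_double; apply: leq_trans ti; apply: leq_trans tJ.
    by apply: leqW; apply: leqW.
  rewrite -mulr_suml mulrC ler_wpM2l ?mulr_ge0 ?(ltW p2) ?addr_ge0//.
  apply: le_trans FMe; rewrite lerBrDl.
  have Mt2 : (M <= t./2.+1)%N by apply: leqW; rewrite -[M]doubleK half_leq.
  by rewrite -[leLHS](big_cat_nat (leq0n M) Mt2); apply: partial_sum_le.
have T3le : T3 <= 2 `^ k * H * (e / 3 / c2).
  apply: (@le_trans _ _ (\sum_(t./2.+1 <= i < t.+1) (2 `^ k * (e / 3 / c2)) * h (t - i)%N)).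
    rewrite /T3 mulr_suml; apply: ler_sum_nat => i /andP[it1 it2].
    rewrite mulrAC ler_wpM2r//.
    have i2 : (t <= i.*2)%N.
      rewrite -(odd_double_half t); apply: (@leq_trans (t./2.+1).*2).
        by rewrite doubleS -addn2 addnC leq_add2l; case: odd.
      by rewrite leq_double.
    apply: (@le_trans _ _ (f i * (2 `^ k * i%:R `^ k))).
      by rewrite ler_wpM2l// half_powR.
    rewrite mulrCA ler_wpM2l ?(ltW p2)//; apply: fJ => /=.
    by rewrite -leq_double (leq_trans tJ').
  have -> : 2 `^ k * H * (e / 3 / c2) = 2 `^ k * (e / 3 / c2) * H by rewrite mulrAC.
  rewrite -mulr_sumr ler_wpM2l ?(ltW (mulr_gt0 p2 e20))//.
  have tt : (t./2.+1 <= t.+1)%N by rewrite ltnS -{2}(odd_double_half t) -addnn addnA leq_addl.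
  by rewrite sum_rev_tail.
have E1 : C * (F - \sum_(0 <= i < M) f i) <= C * (e / 3 / c1) by rewrite ler_wpM2l.
have E10 : 0 <= C * (F - \sum_(0 <= i < M) f i) by rewrite mulr_ge0// subr_ge0.
have E2 : (C + 2 `^ k * (C + 1)) * (e / 3 / c1) <= e / 3.
  rewrite mulrC -[leRHS](divfK (lt0r_neq0 c10)) ler_wpM2l ?(ltW e10)//.
  by rewrite /c1 lerDl.
have E3 : 2 `^ k * H * (e / 3 / c2) <= e / 3.
  rewrite mulrC -[leRHS](divfK (lt0r_neq0 c20)) ler_wpM2l ?(ltW e20)//.
  by rewrite /c2 lerDl.
move: hd; rewrite !ler_norml => /andP[h1 h2].
have := (h1, h2, T20, T30, T2le, T3le, E1, E10, E2, E3).
by clear => -[[[[[[[[[]]]]]]]]] *; apply/andP; split; lra.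
Unshelve. all: by end_near. Qed.

Lemma cvg_ubound (R : realType) (u : nat -> R) (l : R) : u @ \oo --> l ->
  exists2 A : R, 0 < A & forall n, u n <= A.
Proof.
move=> ul; have [N _ uN] : \forall n \near \oo, u n <= l + 1.
  by apply: (cvgr_le l) => //; rewrite ltrDl.
exists (`|l + 1| + \sum_(0 <= i < N) `|u i| + 1).
  by rewrite ltr_wpDl// addr_ge0// sumr_ge0.
move=> n; have s0 : 0 <= \sum_(0 <= i < N) `|u i| by apply: sumr_ge0.
have [Nn|nN] := leqP N n.
  apply: le_trans (uN n Nn) _; rewrite -addrA; apply: le_trans (ler_norm _) _.
  by rewrite lerDl addr_ge0.
have : `|u n| <= \sum_(0 <= i < N) `|u i|.
  rewrite (@bigD1_seq _ _ _ _ _ n) ?mem_index_iota ?iota_uniq//=.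
  by rewrite lerDl sumr_ge0.
have := (ler_norm (u n), normr_ge0 (l + 1)); clear => -[] *; lra.
Qed.

(** Comparison with a telescoping sum: by [powR_succ_ratio], the decrease of x^(1 - k) from x to x +
    1 is at least (k - 1) (x + 1)^(-k). The terms 0 and 1 are set apart because the comparison
    starts at x = 1. *)
Lemma powR_summable (R : realType) (h : nat -> R) (k C : R) : 1 < k ->
  (forall i, 0 <= h i) -> (fun t : nat => h t * t%:R `^ k) @ \oo --> C ->
  exists2 H : R, 0 < H & forall N, \sum_(0 <= i < N) h i <= H.
Proof.
move=> k1 h0 hC; have [A A0 hA] := cvg_ubound hC.
have k0 : 0 < k - 1 by rewrite subr_gt0.
pose c := A / (k - 1).
have c0 : 0 < c by rewrite divr_gt0.
suff H N : \sum_(0 <= i < N.+2) h i <= h 0%N + h 1%N + c * (1 - N.+1%:R `^ (1 - k)).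
  exists (h 0%N + h 1%N + c); first by rewrite ltr_wpDl// addr_ge0.
  move=> N; apply: (@le_trans _ _ (\sum_(0 <= i < N.+2) h i)).
    rewrite (@big_cat_nat _ _ _ N 0 N.+2)//=; last by apply: leqW.
    by rewrite lerDl sumr_ge0.
  apply: le_trans (H N) _; rewrite lerD2l; apply: ler_piMr; first exact: ltW.
  by rewrite lerBlDr lerDl powR_ge0.
elim: N => [|N IH].
  by rewrite big_nat_recr//= big_nat1 powR1 subrr mulr0 addr0.
rewrite big_nat_recr//=; apply: le_trans (lerD IH (lexx _)) _.
rewrite -addrA lerD2l -lerBrDl.
have -> : 1 - k = - (k - 1) by rewrite opprB.
set x := N.+1; have x0 : 0 < x%:R :> R by rewrite ltr0n.
have /andP[_ r] := @powR_succ_ratio R (k - 1) x (ltW k0) isT.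
have y0 : 0 < x.+1%:R :> R by rewrite ltr0n.
have hx : h x.+1 <= A * x.+1%:R `^ (- k).
  rewrite powRN ler_pdivlMr ?powR_gt0//; exact: hA.
apply: le_trans hx _.
have -> : c * (1 - x.+1%:R `^ (- (k - 1))) - c * (1 - x%:R `^ (- (k - 1))) =
    c * (x%:R `^ (- (k - 1)) - x.+1%:R `^ (- (k - 1))) by ring.
rewrite /c mulrAC -mulrA ler_wpM2l ?(ltW A0)// ler_pdivlMr//.
have e1 : x.+1%:R `^ (- (k - 1)) = x.+1%:R `^ (- k) * x.+1%:R.
  by rewrite -[X in _ = _ * X]powRr1 ?(ltW y0)// -powRD ?(gt_eqF y0) ?implybT//;
    congr (_ `^ _); ring.
have d0 : 0 < x%:R + 1 + (k - 1) by have := (x0, k0); clear => -[] *; lra.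
have r' : x.+1%:R `^ (- (k - 1)) * (1 + (k - 1) / (x%:R + 1)) <= x%:R `^ (- (k - 1)).
  have n1 : 0 < 1 + (k - 1) / (x%:R + 1) by rewrite ltr_wpDr// divr_ge0 ?(ltW k0)// addr_ge0// ltW.
  apply: le_trans (ler_wpM2r (ltW n1) r) _; apply: le_of_eq; field.
  by rewrite gt_eqF// gt_eqF//; have := x0; clear; lra.
move: r'; rewrite natr1 mulrDr mulr1 e1 mulrA [_ * x.+1%:R * (k - 1)]mulrAC.
by rewrite mulfK ?gt_eqF//; clear; lra.
Qed.

(* The recursion t f(t) = lam * sum_j j g(j) f(t - j), which compound Poisson laws
   satisfy, gives both the order of magnitude of f and, fed into
   [convol_asymptotics], its exact asymptotics. *)
Lemma panjer_bound (R : realType) (f g : nat -> R) (lam k C : R) : 0 < lam -> 1 < k ->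
  (forall i, 0 <= f i) -> (forall i, 0 <= g i) ->
  (forall N, \sum_(0 <= i < N) f i <= 1) ->
  (fun t : nat => g t * t%:R `^ (1 + k)) @ \oo --> C ->
  (forall t, t%:R * f t = lam * convol f (fun j => j%:R * g j) t) ->
  exists2 K : R, 0 < K & forall t, f t * t%:R `^ (1 + k) <= K.
Proof.
move=> lam0 k1 f0 g0 f1 gC rec.
have k0 : 0 <= k by apply: ltW; apply: lt_trans k1.
have k10 : 0 <= 1 + k by rewrite addr_ge0.
have kC : (fun t : nat => t%:R * g t * t%:R `^ k) @ \oo --> C.
  apply: cvg_trans gC; apply: near_eq_cvg; near=> t.
  have t0 : 0 < t%:R :> R by rewrite ltr0n; near: t; apply: nbhs_infty_gt.
  by rewrite powRD ?(gt_eqF t0) ?implybT// powRr1 ?(ltW t0)//; ring.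
have [A A0 hA] := cvg_ubound kC.
have [H H0 hH] := powR_summable k1 (fun i => mulr_ge0 (ler0n R i) (g0 i)) kC.
have p2 : 0 < (2 : R) `^ k by rewrite powR_gt0.
have p3 : 0 < (2 : R) `^ (1 + k) by rewrite powR_gt0.
(* The induction hypothesis carries the exponent 1 + k, one more than the factor t^k it meets, so
   the sum over i > t/2 gains a factor 1/t. From T on this makes it at most K / 2. *)
pose T := (Num.truncn (2 * (lam * H * 2 `^ (1 + k)))).+1.
have TE : 2 * (lam * H * 2 `^ (1 + k)) <= T%:R by apply: ltW; apply: truncnS_gt.
pose a := lam * (A * 2 `^ k).
have a0 : 0 < a by rewrite !mulr_gt0.
pose B := \sum_(0 <= i < T) f i * i%:R `^ (1 + k).
have B0 : 0 <= B by apply: sumr_ge0 => i _; rewrite mulr_ge0 ?powR_ge0.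
(* For t >= T the range i <= t/2 contributes at most a and the rest at most K / 2, and a + K / 2 <=
   K; B covers the t below T. *)
pose K := 2 * a + B.
have K0 : 0 < K by rewrite ltr_wpDr// mulr_gt0.
exists K => //; elim/ltn_ind => t IH.
have [tT|Tt] := ltnP t T.
  apply: (@le_trans _ _ B); last by rewrite /K lerDr mulr_ge0// ltW.
  rewrite /B (@bigD1_seq _ _ _ _ _ t) ?mem_index_iota ?iota_uniq//=.
  by rewrite lerDl sumr_ge0// => i _; rewrite mulr_ge0 ?powR_ge0.
have t0 : (0 < t)%N by apply: leq_trans Tt.
have tp : 0 < t%:R :> R by rewrite ltr0n.
have -> : f t * t%:R `^ (1 + k) = t%:R * f t * t%:R `^ k.
  by rewrite powRD ?(gt_eqF tp) ?implybT// powRr1 ?(ltW tp)//; ring.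
rewrite rec (@convol_split _ _ _ 0 t)// big_nil add0r -mulrA mulrDl.
set P1 := _ * _ `^ k; set P2 := _ * _ `^ k.
have oddle : (t./2.*2 <= t)%N by rewrite -{2}(odd_double_half t) leq_addl.
have P1le : P1 <= A * 2 `^ k.
  apply: (@le_trans _ _ (\sum_(0 <= i < t./2.+1) f i * (A * 2 `^ k))).
    rewrite /P1 mulr_suml; apply: ler_sum_nat => i /andP[_ it].
    rewrite -mulrA ler_wpM2l//.
    have i2 : (i.*2 <= t)%N by apply: leq_trans oddle; rewrite leq_double -ltnS.
    have ti : (t <= (t - i).*2)%N by rewrite doubleB -addnn -addnBA// leq_addr.
    apply: (@le_trans _ _ ((t - i)%:R * g (t - i)%N * (2 `^ k * (t - i)%:R `^ k))).
      by rewrite ler_wpM2l ?mulr_ge0// half_powR.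
    by rewrite mulrCA mulrC ler_wpM2r ?(ltW p2)//; apply: hA.
  by rewrite -mulr_suml ler_piMl// (ltW (mulr_gt0 A0 p2)).
have P2le : P2 * t%:R <= K * 2 `^ (1 + k) * H.
  apply: (@le_trans _ _ (\sum_(t./2.+1 <= i < t.+1)
      (K * 2 `^ (1 + k)) * ((t - i)%:R * g (t - i)%N))).
    rewrite /P2 -mulrA mulr_suml; apply: ler_sum_nat => i /andP[it1 it2].
    (* The weight j = t - i removes the term i = t, so the induction hypothesis is only invoked
       below t. *)
    have [iE|it] := eqVneq i t; first by rewrite iE subnn !mul0r mulr0 mul0r mulr0.
    have itl : (i < t)%N by rewrite ltn_neqAle it -ltnS.
    rewrite mulrAC ler_wpM2r ?mulr_ge0//.
    have i2 : (t <= i.*2)%N.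
      rewrite -(odd_double_half t); apply: (@leq_trans (t./2.+1).*2).
        by rewrite doubleS -addn2 addnC leq_add2l; case: odd.
      by rewrite leq_double.
    have -> : t%:R `^ k * t%:R = t%:R `^ (1 + k).
      by rewrite powRD ?(gt_eqF tp) ?implybT// powRr1 ?(ltW tp)//; ring.
    apply: (@le_trans _ _ (f i * (2 `^ (1 + k) * i%:R `^ (1 + k)))).
      by rewrite ler_wpM2l// half_powR.
    by rewrite mulrCA mulrC ler_wpM2r ?(ltW p3)//; apply: IH.
  rewrite -mulr_sumr ler_wpM2l ?(ltW (mulr_gt0 K0 p3))//.
  have tt : (t./2.+1 <= t.+1)%N by rewrite ltnS -{2}(odd_double_half t) -addnn addnA leq_addl.
  by rewrite (sum_rev_tail (fun j => j%:R * g j)).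
have P2le' : lam * P2 <= K / 2.
  rewrite -(ler_pM2r tp) -mulrA.
  apply: le_trans (ler_wpM2l (ltW lam0) P2le) _.
  have Tt' : T%:R <= t%:R :> R by rewrite ler_nat.
  have := ler_wpM2l (ltW K0) (le_trans TE Tt'); clear; lra.
have := ler_wpM2l (ltW lam0) P1le; rewrite -/a.
have -> : K = 2 * a + B by []. rewrite /K in P2le'.
rewrite mulrDr; move: P2le' B0; clear; lra.
Unshelve. all: by end_near. Qed.

Lemma panjer_asymptotics (R : realType) (f g : nat -> R) (lam k C : R) :
  0 < lam -> 1 < k ->
  (forall i, 0 <= f i) -> (forall i, 0 <= g i) ->
  (fun N => \sum_(0 <= i < N) f i) @ \oo --> (1 : R) ->
  (fun t : nat => g t * t%:R `^ (1 + k)) @ \oo --> C ->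
  (forall t, t%:R * f t = lam * convol f (fun j => j%:R * g j) t) ->
  (fun t : nat => f t * t%:R `^ (1 + k)) @ \oo --> lam * C.
Proof.
move=> lam0 k1 f0 g0 f1 gC rec.
have k0 : 0 <= k by apply: ltW; apply: lt_trans k1.
have kC : (fun t : nat => t%:R * g t * t%:R `^ k) @ \oo --> C.
  apply: cvg_trans gC; apply: near_eq_cvg; near=> t.
  have t0 : 0 < t%:R :> R by rewrite ltr0n; near: t; apply: nbhs_infty_gt.
  by rewrite powRD ?(gt_eqF t0) ?implybT// powRr1 ?(ltW t0)//; ring.
have [H H0 hH] := powR_summable k1 (fun i => mulr_ge0 (ler0n R i) (g0 i)) kC.
have [K K0 fK] := panjer_bound lam0 k1 f0 g0 (fun N => partial_sum_le N f0 f1) gC rec.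
have fk : (fun t : nat => f t * t%:R `^ k) @ \oo --> (0 : R).
  apply/cvgr0Pnorm_le => e e0; near=> t.
  have t0 : 0 < t%:R :> R by rewrite ltr0n; near: t; apply: nbhs_infty_gt.
  rewrite ger0_norm ?mulr_ge0 ?powR_ge0//.
  have tK : K / e <= t%:R by near: t; apply: nbhs_infty_ger.
  rewrite -(ler_pM2r t0); apply: le_trans (_ : K <= _); last first.
    by rewrite mulrC -ler_pdivrMr.
  have := fK t; rewrite powRD ?(gt_eqF t0) ?implybT// powRr1 ?(ltW t0)//.
  by rewrite [t%:R * _]mulrC mulrA.
have main := convol_asymptotics k0 f0 (fun i => mulr_ge0 (ler0n R i) (g0 i)) hH f1 fk kC.
rewrite mulr1 in main.
apply: cvg_trans (cvgMr (a := lam) main); apply: near_eq_cvg; near=> t.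
have t0 : 0 < t%:R :> R by rewrite ltr0n; near: t; apply: nbhs_infty_gt.
rewrite /= mulrA -rec powRD ?(gt_eqF t0) ?implybT// powRr1 ?(ltW t0)//; ring.
Unshelve. all: by end_near. Qed.

(** * Joint local asymptotics *)

(** Chernoff's bound with a cap on i in place of one on the mean. If the mean is i + e with e >= d,
    the exponent e^2 / (8 (i + e)) increases with e, and at e = d its denominator is at most 16
    M. *)
Lemma binomial_deviation (R : realType) n (q : R) (i : nat) (d M : R) : 0 <= q <= 1 ->
  0 < d -> d <= M -> i%:R <= M -> d <= `|i%:R - n%:R * q| ->
  binomial_pmf n q i <= expR (- (d ^+ 2 / (16 * M))).
Proof.
move=> q01 d0 dM iM dev; apply: le_trans (binomial_chernoff _ _ q01) _.
rewrite ler_expR lerN2; set m := n%:R * q in dev *; set X := Num.max _ _.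
have m0 : 0 <= m by rewrite mulr_ge0//; case/andP: q01.
have i0 : 0 <= i%:R :> R by [].
have M0 : 0 < M by apply: lt_le_trans dM.
have [mi|im] := lerP m i%:R.
  rewrite ger0_norm ?subr_ge0// in dev.
  have X0 : 0 < X by rewrite /X max_l//; move: dev d0 m0; clear; lra.
  have Xi : X = i%:R by rewrite /X max_l.
  rewrite ler_pdivrMr ?mulr_gt0// mulrAC ler_pdivlMr ?mulr_gt0//.
  have h : d ^+ 2 <= (i%:R - m) ^+ 2.
    by rewrite lerXn2r ?nnegrE ?(ltW d0)//; apply: le_trans dev; exact: ltW.
  rewrite Xi; apply: ler_pM => //; first exact: sqr_ge0.
  by move: iM M0; clear; lra.
rewrite ltr0_norm ?subr_lt0// opprB in dev.
have Xm : X = m by rewrite /X max_r// ltW.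
have mp : 0 < m by apply: le_lt_trans im.
have p8 : 0 < 8 * m by rewrite pmulr_rgt0.
have p16 : 0 < 16 * M by rewrite pmulr_rgt0.
rewrite Xm ler_pdivrMr// mulrAC ler_pdivlMr//.
set e := m - i%:R in dev *.
have -> : (i%:R - m) ^+ 2 = e ^+ 2 by rewrite /e; ring.
have -> : m = i%:R + e by rewrite /e; ring.
have e0 : 0 <= e by apply: le_trans dev; exact: ltW.
have h1 : d ^+ 2 <= e ^+ 2 by rewrite lerXn2r ?nnegrE ?(ltW d0).
have h2 : d ^+ 2 * i%:R <= e ^+ 2 * M by apply: ler_pM => //; exact: sqr_ge0.
have h3 : d ^+ 2 * e <= e ^+ 2 * M.
  apply: (@le_trans _ _ (e ^+ 2 * d)); last by rewrite ler_wpM2l ?sqr_ge0.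
  have -> : d ^+ 2 * e = (d * e) * d by ring.
  have -> : e ^+ 2 * d = (d * e) * e by ring.
  by rewrite ler_wpM2l// mulr_ge0// ltW.
have h4 : 0 <= e ^+ 2 * M by rewrite mulr_ge0 ?sqr_ge0// ltW.
move: h2 h3 h4; clear; lra.
Qed.

(** The exponent is that of [binomial_deviation] at distance delta/2 with M = t; the factor 64 is 16
    times 4. *)
Lemma ln_superpoly (R : realType) (v : R) : 0 <= v ->
  (fun t : nat => expR (- (ln (2 + t%:R) ^+ 8 / 64)) * t%:R `^ v) @ \oo --> (0 : R).
Proof.
move=> v0; apply/cvgr0Pnorm_le => e e0; near=> t.
have t0 : 0 < t%:R :> R by rewrite ltr0n; near: t; apply: nbhs_infty_gt.
have p2 : 0 < 2 + t%:R :> R by rewrite addr_gt0.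
rewrite ger0_norm ?mulr_ge0 ?expR_ge0 ?powR_ge0//.
set x := ln _.
have xE : expR x = 2 + t%:R by rewrite lnK ?posrE.
have xbig : 64 * (v + 1) <= x.
  rewrite -ler_expR xE.
  have : expR (64 * (v + 1)) <= t%:R by near: t; apply: nbhs_infty_ger.
  by clear; lra.
have x1 : 1 <= x by move: xbig v0; clear; lra.
have x0 : 0 <= x by apply: le_trans x1.
have tv : t%:R `^ v <= expR (v * x).
  rewrite mulrC expRM xE ge0_ler_powR ?nnegrE ?(ltW t0) ?(ltW p2)//.
  by clear; lra.
apply: (@le_trans _ _ (expR (- x))).
  apply: le_trans (ler_wpM2l (expR_ge0 _) tv) _.
  rewrite -expRD ler_expR.
  have x7 : x * x <= x ^+ 8.
    by rewrite -expr2 ler_weXn2l.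
  have : 64 * (v + 1) * x <= x * x by rewrite ler_wpM2r.
  move: x7; clear; lra.
rewrite expRN xE invf_ple ?posrE//.
have : e^-1 <= t%:R by near: t; apply: nbhs_infty_ger.
by clear; lra.
Unshelve. all: by end_near. Qed.

(* The probability that two copies of the compound law [f] plus an independent
   pair of law [F2] equal (T1, T2). *)
Definition joint_conv (R : realType) (f : nat -> R) (F2 : nat -> nat -> R) (T1 T2 : nat) : R :=
  \sum_(0 <= i < T1.+1) \sum_(0 <= j < T2.+1) f (T1 - i)%N * f (T2 - j)%N * F2 i j.

Lemma convolC (R : realType) (f h : nat -> R) t : convol f h t = convol h f t.
Proof.
rewrite /convol big_nat_rev/= add0n big_nat [RHS]big_nat.
apply: eq_bigr => i /andP[_ it]; rewrite subSS subKn 1?mulrC//.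
Qed.

Lemma sum_le1_rev (R : realType) (f : nat -> R) T : (forall N, \sum_(0 <= i < N) f i <= 1) ->
  \sum_(0 <= j < T.+1) f (T - j)%N <= 1.
Proof. by move=> f1; rewrite sum_rev_tail. Qed.

(** Near the diagonal j <= i + dl <= T1 + dl, so f (T2 - j) is evaluated at an argument of at least
    T2 - T1 - dl; summing F2 over j leaves its marginal, and summing over i a convolution. Off the
    diagonal F2 is at most E and the two copies of f have total mass at most 1. *)
Lemma joint_upper (R : realType) (f : nat -> R) F2 (m2 : nat -> R) T1 T2 (dl E U : R) :
  (forall i, 0 <= f i) -> (forall N, \sum_(0 <= i < N) f i <= 1) ->
  (forall i j, 0 <= F2 i j) -> (forall i N, \sum_(0 <= j < N) F2 i j <= m2 i) ->
  0 <= E -> (forall i j, (i <= T1)%N -> (j <= T2)%N -> dl < `|i%:R - j%:R| -> F2 i j <= E) ->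
  (forall u : nat, T2%:R - T1%:R - dl <= u%:R -> f u <= U) -> 0 <= U ->
  joint_conv f F2 T1 T2 <= U * convol f m2 T1 + E.
Proof.
move=> f0 f1 F20 F2m E0 off fU U0.
apply: (@le_trans _ _ (\sum_(0 <= i < T1.+1) (U * (f (T1 - i)%N * m2 i) + f (T1 - i)%N * E))).
  apply: ler_sum_nat => i /andP[_ iT].
  apply: (@le_trans _ _ (\sum_(0 <= j < T2.+1)
      (U * f (T1 - i)%N * F2 i j + f (T1 - i)%N * E * f (T2 - j)%N))).
    apply: ler_sum_nat => j /andP[_ jT].
    have [near_|far] := lerP `|i%:R - j%:R| dl.
      have u : T2%:R - T1%:R - dl <= (T2 - j)%:R.
        rewrite natrB; last by rewrite -ltnS.
        have iT' : i%:R <= T1%:R :> R by rewrite ler_nat -ltnS.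
        have := ler_norm (j%:R - i%:R : R); rewrite distrC.
        move: near_ iT'; clear; lra.
      apply: ler_wpDr; first by rewrite !mulr_ge0.
      by rewrite ler_wpM2r// mulrC ler_wpM2r// fU.
    apply: ler_wpDl; first by rewrite !mulr_ge0.
    rewrite mulrAC ler_wpM2r// ler_wpM2l// off//; by rewrite -ltnS.
  rewrite big_split/= -!mulr_sumr lerD//.
    by rewrite -mulrA ler_wpM2l// ler_wpM2l.
  by rewrite ler_piMr ?mulr_ge0// sum_le1_rev.
rewrite big_split/= -mulr_sumr -mulr_suml lerD//.
  rewrite ler_wpM2l// convolC; apply: le_of_eq; apply: eq_bigr => i _.
  exact: mulrC.
by rewrite ler_piMl// sum_le1_rev.
Qed.

(** Only the terms with i within M of T1 and j within dl of i are kept. For these T2 - j differs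
    from T2 - T1 by at most dl + M, so f (T2 - j) is bounded below uniformly. *)
Lemma joint_lower (R : realType) (f : nat -> R) F2 (m2 : nat -> R) T1 T2 M (dl E L e : R) :
  (forall i, 0 <= f i) -> (forall i j, 0 <= F2 i j) ->
  (M <= T1)%N -> T1%:R + dl <= T2%:R -> 0 <= L ->
  (forall i, (i <= T1)%N ->
    (1 - e) * m2 i - E <= \sum_(0 <= j < T2.+1 | `|i%:R - j%:R| <= dl) F2 i j) ->
  (forall u : nat, T2%:R - T1%:R - dl <= u%:R <= T2%:R - T1%:R + dl + M%:R -> L <= f u) ->
  L * \sum_(0 <= k < M) f k * ((1 - e) * m2 (T1 - k)%N - E) <= joint_conv f F2 T1 T2.
Proof.
move=> f0 F20 MT T12 L0 dev fL.
have MT1 : (T1.+1 - M <= T1.+1)%N by apply: leq_subr.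
rewrite /joint_conv (big_cat_nat (leq0n _) MT1)/=.
apply: ler_wpDl.
  by apply: sumr_ge0 => i _; apply: sumr_ge0 => j _; rewrite !mulr_ge0.
have -> : \sum_(0 <= k < M) f k * ((1 - e) * m2 (T1 - k)%N - E) =
    \sum_(T1.+1 - M <= i < T1.+1) f (T1 - i)%N * ((1 - e) * m2 i - E).
  transitivity (\sum_(T1.+1 - M <= i < T1.+1)
     (fun k => f k * ((1 - e) * m2 (T1 - k)%N - E)) (T1 - i)%N).
    rewrite (sum_rev_tail (fun k => f k * ((1 - e) * m2 (T1 - k)%N - E)))//.
    by rewrite subKn//; apply: leqW.
  by rewrite !big_nat; apply: eq_bigr => i /andP[_ iT]; rewrite subKn// -ltnS.
rewrite mulr_sumr; apply: ler_sum_nat => i /andP[Mi iT].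
have iT1 : (i <= T1)%N by rewrite -ltnS.
have iM : T1%:R - i%:R <= M%:R :> R.
  by rewrite -natrB// ler_nat leq_subLR; apply: ltnW; rewrite addnC -leq_subLR.
apply: (@le_trans _ _ (L * f (T1 - i)%N * \sum_(0 <= j < T2.+1 | `|i%:R - j%:R| <= dl) F2 i j)).
  by rewrite mulrA ler_wpM2l ?mulr_ge0// dev.
rewrite mulr_sumr big_mkcond/=; apply: ler_sum_nat => j /andP[_ jT].
have jT2 : (j <= T2)%N by rewrite -ltnS.
case: ifP => near_; last by rewrite !mulr_ge0.
rewrite ler_wpM2r// mulrC ler_wpM2l// fL// natrB//.
have iT1' : i%:R <= T1%:R :> R by rewrite ler_nat.
have h1 := ler_norm (j%:R - i%:R : R); have h2 := ler_norm (i%:R - j%:R : R).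
rewrite distrC in h1.
by move: h1 h2 near_ iM iT1'; clear => *; apply/andP; split; lra.
Qed.

(** Two coordinates that are independent binomials given x, with [m2] as marginal. Integrals are
    replaced by limits of partial sums over x, so that all estimates are made on finite sums. *)
Definition binomial_mixture (R : realType) (q w : nat -> R) (r : nat)
    (F2 : nat -> nat -> R) (m2 : nat -> R) (W : R) : Prop :=
  [/\ forall x, 0 <= q x <= 1, forall x, 0 <= w x,
      forall N, \sum_(0 <= x < N) w x <= W,
      forall i j, (fun N => \sum_(0 <= x < N)
        w x * (binomial_pmf (x - r) (q x) i * binomial_pmf (x - r) (q x) j))
        @ \oo --> F2 i j &
      forall i, (fun N => \sum_(0 <= x < N) w x * binomial_pmf (x - r) (q x) i)
        @ \oo --> m2 i].

Lemma mixture_pair_ge0 (R : realType) q w r F2 m2 (W : R) i j :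
  binomial_mixture q w r F2 m2 W -> 0 <= F2 i j.
Proof.
move=> [q01 w0 wW F2E m2E]; apply: (cvgr_to_ge (F2E i j)); near=> N; apply: sumr_ge0 => x _.
by rewrite !mulr_ge0 ?binomial_pmf_ge0.
Unshelve. all: by end_near. Qed.

Lemma mixture_pair_sum (R : realType) q w r F2 m2 (W : R) i (A : pred nat) N :
  binomial_mixture q w r F2 m2 W -> (fun N' => \sum_(0 <= x < N')
  w x * (binomial_pmf (x - r) (q x) i * \sum_(0 <= j < N | A j) binomial_pmf (x - r) (q x) j))
  @ \oo --> \sum_(0 <= j < N | A j) F2 i j.
Proof.
move=> [q01 w0 wW F2E m2E]; rewrite big_mkcond/=.
have -> : (fun N' => \sum_(0 <= x < N') w x * (binomial_pmf (x - r) (q x) i *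
      \sum_(0 <= j < N | A j) binomial_pmf (x - r) (q x) j)) =
    (fun N' => \sum_(0 <= j < N) if A j then \sum_(0 <= x < N')
      w x * (binomial_pmf (x - r) (q x) i * binomial_pmf (x - r) (q x) j) else 0).
  apply/funext => N'; rewrite -big_mkcond/= exchange_big/=; apply: eq_bigr => x _.
  by rewrite !mulr_sumr.
apply: (@cvg_sum_nat _ (fun j N' => if A j then \sum_(0 <= x < N')
      w x * (binomial_pmf (x - r) (q x) i * binomial_pmf (x - r) (q x) j) else 0)) => j.
by case: (A j); [exact: F2E|exact: cvg_cst].
Qed.

Lemma mixture_pair_marginal (R : realType) q w r F2 m2 (W : R) i N :
  binomial_mixture q w r F2 m2 W -> \sum_(0 <= j < N) F2 i j <= m2 i.
Proof.
move=> mix; have [q01 w0 wW F2E m2E] := mix.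
apply: (@ler_cvg_to _ \oo _ R
  (fun N' => \sum_(0 <= x < N') w x * (binomial_pmf (x - r) (q x) i *
     \sum_(0 <= j < N) binomial_pmf (x - r) (q x) j))
  (fun N' => \sum_(0 <= x < N') w x * binomial_pmf (x - r) (q x) i)).
- exact: mixture_pair_sum mix.
- exact: m2E.
near=> N'.
apply: ler_sum => x _; rewrite ler_wpM2l// ler_piMr ?binomial_pmf_ge0//.
case: N => [|N]; first by rewrite big_nil.
exact: binomial_cdf_le1.
Unshelve. all: by end_near. Qed.

(** Whatever x is, one of i and j lies at distance at least dl/2 from the common mean. *)
Lemma mixture_pair_off (R : realType) q w r F2 m2 (W : R) (i j : nat) (dl M : R) :
  binomial_mixture q w r F2 m2 W -> 0 < dl -> dl <= M -> i%:R <= M -> j%:R <= M ->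
  dl < `|i%:R - j%:R| -> F2 i j <= W * expR (- ((dl / 2) ^+ 2 / (16 * M))).
Proof.
move=> [q01 w0 wW F2E m2E] dl0 dlM iM jM far.
have d20 : 0 < dl / 2 by rewrite divr_gt0.
have d2M : dl / 2 <= M by move: dl0 dlM; clear; lra.
apply: (cvgr_to_le (F2E i j)); near=> N.
apply: (@le_trans _ _ (\sum_(0 <= x < N) w x * expR (- ((dl / 2) ^+ 2 / (16 * M))))).
  apply: ler_sum => x _; rewrite ler_wpM2l//.
  set m : R := (x - r)%:R * q x.
  have [ci|ci] := leP (dl / 2) `|i%:R - m|.
    apply: (@le_trans _ _ (binomial_pmf (x - r) (q x) i)).
      by rewrite ler_piMr ?binomial_pmf_ge0 ?binomial_pmf_le1.
    exact: binomial_deviation.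
  apply: (@le_trans _ _ (binomial_pmf (x - r) (q x) j)).
    by rewrite ler_piMl ?binomial_pmf_ge0 ?binomial_pmf_le1.
  apply: binomial_deviation => //.
  have := ler_normD (i%:R - m) (m - j%:R); rewrite addrA subrK [`|m - _|]distrC.
  by move: far ci; clear; rewrite -/m; lra.
by rewrite -mulr_suml ler_wpM2r ?expR_ge0.
Unshelve. all: by end_near. Qed.

(** For a given x, either i is at least dl/2 away from the mean, which is exponentially unlikely, or
    the mean is at most 2 M. In the second case the other coordinate lies within dl/2 of the mean by
    Chebyshev's inequality, with failure probability at most 2 M / (dl/2)^2. *)
Lemma mixture_pair_near (R : realType) q w r F2 m2 (W : R) (i N : nat) (dl M : R) :
  binomial_mixture q w r F2 m2 W -> 0 < dl -> dl <= M -> i%:R <= M ->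
  i%:R + dl < N%:R ->
  (1 - 8 * M / dl ^+ 2) * m2 i - W * expR (- ((dl / 2) ^+ 2 / (16 * M))) <=
  \sum_(0 <= j < N | `|i%:R - j%:R| <= dl) F2 i j.
Proof.
move=> mix; have [q01 w0 wW F2E m2E] := mix; move=> dl0 dlM iM iN; set E := expR _.
have d20 : 0 < dl / 2 by rewrite divr_gt0.
have d2M : dl / 2 <= M by move: dl0 dlM; clear; lra.
have M0 : 0 < M by apply: lt_le_trans dlM.
have e0 : 0 <= 8 * M / dl ^+ 2 by rewrite divr_ge0 ?sqr_ge0// mulr_ge0// ltW.
rewrite lerBlDr.
apply: (@ler_cvg_to _ \oo _ R
  (fun N' => (1 - 8 * M / dl ^+ 2) * \sum_(0 <= x < N') w x * binomial_pmf (x - r) (q x) i)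
  (fun N' => \sum_(0 <= x < N') w x * (binomial_pmf (x - r) (q x) i *
     \sum_(0 <= j < N | `|i%:R - j%:R| <= dl) binomial_pmf (x - r) (q x) j) + W * E)).
- by apply: cvgMr; exact: m2E.
- by apply: cvgD; [exact: mixture_pair_sum mix|exact: cvg_cst].
near=> N'.
apply: (@le_trans _ _ (\sum_(0 <= x < N') w x * (binomial_pmf (x - r) (q x) i *
     \sum_(0 <= j < N | `|i%:R - j%:R| <= dl) binomial_pmf (x - r) (q x) j) +
     \sum_(0 <= x < N') w x * E)); last first.
  by rewrite lerD2l -mulr_suml ler_wpM2r ?expR_ge0.
rewrite mulr_sumr -big_split/=; apply: ler_sum => x _.
rewrite mulrCA -mulrDr ler_wpM2l//.
set B := binomial_pmf _ _; set n := (x - r)%N in B *; set m : R := n%:R * q x.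
have B0 k : 0 <= B k by apply: binomial_pmf_ge0.
have [ci|ci] := leP (dl / 2) `|i%:R - m|.
  have BE : B i <= E by apply: binomial_deviation.
  apply: (@le_trans _ _ (B i)); first by rewrite ler_piMl// lerBlDr lerDl.
  by apply: ler_wpDl => //; rewrite mulr_ge0// sumr_ge0.
apply: ler_wpDr; first exact: expR_ge0.
rewrite mulrC ler_wpM2l//.
apply: (@le_trans _ _ (\sum_(0 <= j < n.+1 | `|i%:R - j%:R| <= dl) B j)); last first.
  have nN : (n.+1 <= N + n.+1)%N by apply: leq_addl.
  apply: (@le_trans _ _ (\sum_(0 <= j < N + n.+1 | `|i%:R - j%:R| <= dl) B j)).
    by rewrite [leRHS](big_cat_nat (leq0n _) nN)/= lerDl sumr_ge0.
  rewrite (big_cat_nat (leq0n _) (leq_addr n.+1 N))/= [X in _ + X]big1_seq ?addr0//.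
  move=> j /andP[jn]; rewrite mem_index_iota => /andP[Nj _]; exfalso.
  have Nj' : N%:R <= j%:R :> R by rewrite ler_nat.
  have := ler_norm (j%:R - i%:R : R); rewrite distrC.
  by move: jn Nj' iN; clear; lra.
have far : \sum_(0 <= j < n.+1 | ~~ (`|i%:R - j%:R| <= dl)) B j <= m / (dl / 2) ^+ 2.
  apply: binomial_chebyshev => // j; rewrite -ltNge => jfar.
  have := ler_normD (i%:R - m) (m - j%:R); rewrite addrA subrK [`|m - _|]distrC.
  by move: jfar ci; clear; rewrite -/m; lra.
have tot : \sum_(0 <= j < n.+1) B j = 1.
  by rewrite -(binomial_mean1 n (q x)); apply: eq_bigr => k _; rewrite mulr1.
rewrite (bigID (fun j : nat => `|i%:R - j%:R| <= dl))/= in tot.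
have mM : m / (dl / 2) ^+ 2 <= 8 * M / dl ^+ 2.
  have -> : 8 * M / dl ^+ 2 = 2 * M / (dl / 2) ^+ 2 by field; rewrite gt_eqF.
  rewrite ler_wpM2r ?invr_ge0 ?sqr_ge0//.
  have := ler_norm (m - i%:R); rewrite distrC.
  by move: ci iM d2M; clear; lra.
by move: tot far mM; clear; lra.
Unshelve. all: by end_near. Qed.

Lemma near_subsequence (u : nat -> nat) (P : nat -> Prop) : u @ \oo --> \oo ->
  (\forall t \near \oo, P t) -> \forall n \near \oo, P (u n).
Proof. by move=> uoo h; exact: uoo. Qed.

Lemma regular_lower (R : realType) (u : nat -> R) (k C : R) :
  (fun t : nat => u t * t%:R `^ (1 + k)) @ \oo --> C ->
  (fun t : nat => u t * t%:R `^ k) @ \oo --> (0 : R).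
Proof.
move=> uC.
have inv0 : (fun t : nat => t%:R `^ (- 1)) @ \oo --> (0 : R) by exact: powR_small_cvg.
have h : (fun t : nat => u t * t%:R `^ (1 + k) * t%:R `^ (- 1)) @ \oo --> (0 : R).
  by rewrite -(mulr0 C); exact: cvgM.
apply: cvg_trans h; apply: near_eq_cvg; near=> t.
have t0 : 0 < t%:R :> R by rewrite ltr0n; near: t; apply: nbhs_infty_gt.
rewrite -mulrA -powRD ?(gt_eqF t0) ?implybT//; congr (_ * _ `^ _).
by rewrite addrAC subrr add0r.
Unshelve. all: by end_near. Qed.

Lemma joint_asymptotics (R : realType) q w r F2 m2 (W H k C1 C2 : R) (f : nat -> R)
    (t1 t2 : nat -> nat) :
  binomial_mixture q w r F2 m2 W ->
  (forall i, 0 <= f i) -> (fun N => \sum_(0 <= i < N) f i) @ \oo --> (1 : R) ->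
  (forall i, 0 <= m2 i) -> (forall N, \sum_(0 <= i < N) m2 i <= H) ->
  0 <= k -> 0 < C1 -> 0 < C2 ->
  (fun t : nat => f t * t%:R `^ (1 + k)) @ \oo --> C1 ->
  (fun t : nat => m2 t * t%:R `^ k) @ \oo --> C2 ->
  t1 @ \oo --> \oo -> t2 @ \oo --> \oo ->
  (fun n => ((t2 n)%:R - (t1 n)%:R) / delta R (t2 n)) @ \oo --> +oo ->
  (fun n => joint_conv f F2 (t1 n).-1 (t2 n).-1 *
    ((t2 n)%:R - (t1 n)%:R) `^ (1 + k) * (t1 n)%:R `^ k) @ \oo --> C1 * C2.
Proof.
move=> mix f0 f1 m20 mH k0 C10 C20 fC mC t1oo t2oo sep.
have [q01 w0 wW F2E m2E] := mix.
have W0 : 0 <= W by have := wW 0%N; rewrite big_nil.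
have k10 : 0 <= 1 + k by rewrite addr_ge0.
have F20 i j := mixture_pair_ge0 i j mix.
have f1le N := partial_sum_le N f0 f1.
set X := fun n => _.
pose dl n := delta R (t2 n).
pose D n : R := (t2 n)%:R - (t1 n)%:R.
(* The relative error made when an argument within dl of D is replaced by D; the separation
   hypothesis says that it tends to 0. *)
pose rho n := dl n / D n.
pose lg n : R := ln (2 + (t2 n)%:R).
pose E n := W * expR (- (lg n ^+ 8 / 64)).
have lg_big (A : R) : \forall n \near \oo, A <= lg n.
  apply: (@near_subsequence t2 (fun t => A <= ln (2 + t%:R)) t2oo).
  near=> t; rewrite -ler_expR lnK ?posrE ?addr_gt0//.
    have : expR A <= t%:R by near: t; apply: nbhs_infty_ger.
    by clear; lra.
  by rewrite ltr0n; near: t; apply: nbhs_infty_gt.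
have dlE n : dl n ^+ 2 = (t2 n)%:R * lg n ^+ 8.
  by rewrite /dl /delta exprMn sqr_sqrtr// -exprM.
have basic : \forall n \near \oo, [/\ 1 <= dl n, 0 < rho n, rho n <= 2^-1, 0 < D n &
    (0 < t1 n)%N /\ (t1 n <= t2 n)%N].
  near=> n.
  have t10 : (0 < t1 n)%N.
    by near: n; apply: (@near_subsequence t1 (fun t => 0 < t)%N t1oo); apply: nbhs_infty_gt.
  have t20 : (0 < t2 n)%N.
    by near: n; apply: (@near_subsequence t2 (fun t => 0 < t)%N t2oo); apply: nbhs_infty_gt.
  have l1 : 1 <= lg n by near: n; apply: lg_big.
  have d1 : 1 <= dl n.
    have dp : 0 <= dl n by rewrite mulr_ge0 ?sqrtr_ge0// exprn_ge0// (le_trans _ l1).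
    rewrite -(@ler_pXn2r _ 2)// ?nnegrE// expr1n dlE.
    have : 1 <= (t2 n)%:R :> R by rewrite ler1n.
    have : 1 <= lg n ^+ 8 by rewrite exprn_ege1.
    by move=> a1 a2; exact: mulr_ege1.
  have d0 : 0 < dl n by apply: lt_le_trans d1.
  have : 2 <= D n / dl n by near: n; move/cvgryPge: sep; apply.
  rewrite ler_pdivlMr// => D2.
  have D0 : 0 < D n by apply: lt_le_trans D2; rewrite mulr_gt0.
  split => //; first by rewrite divr_gt0.
    by rewrite ler_pdivrMr//; move: D2; clear; lra.
  by split => //; rewrite -(ler_nat R); move: D0; rewrite /D; clear; lra.
have rho0 : rho @ \oo --> (0 : R).
  apply/cvgr0Pnorm_le => e e0; near=> n.
  have [d1 r0 _ D0 _] : [/\ 1 <= dl n, 0 < rho n, rho n <= 2^-1, 0 < D n &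
    (0 < t1 n)%N /\ (t1 n <= t2 n)%N] by near: n.
  rewrite ger0_norm ?(ltW r0)//.
  have d0 : 0 < dl n by apply: lt_le_trans d1.
  have : e^-1 <= D n / dl n by near: n; move/cvgryPge: sep; apply.
  rewrite ler_pdivlMr// => De; rewrite ler_pdivrMr//.
  by rewrite -ler_pdivrMl// ; exact: De.
have Dbig (A : R) : \forall n \near \oo, A <= D n * (1 - rho n).
  near=> n.
  have [d1 r0 r2 D0 _] : [/\ 1 <= dl n, 0 < rho n, rho n <= 2^-1, 0 < D n &
    (0 < t1 n)%N /\ (t1 n <= t2 n)%N] by near: n.
  have d0 : 0 < dl n by apply: lt_le_trans d1.
  have : 2 * `|A| + 1 <= D n / dl n by near: n; move/cvgryPge: sep; apply.
  rewrite ler_pdivlMr// => De.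
  have h1 : `|A| <= `|A| * dl n by rewrite ler_peMr.
  have h2 : D n / 2 <= D n * (1 - rho n) by rewrite ler_pM2l//; move: r2; clear; lra.
  by apply: le_trans (ler_norm _) _; move: De h1 h2 d0; clear; lra.
have convE : (fun n => convol f m2 (t1 n).-1 * (t1 n)%:R `^ k) @ \oo --> C2.
  have h := convol_asymptotics k0 f0 m20 mH f1 (regular_lower fC) mC.
  rewrite mulr1 in h.
  apply: cvg_trans (cvg_comp _ _ t1oo (@regular_shift _ _ _ _ 1 h)).
  by apply: near_eq_cvg; near=> n; rewrite /= subn1.
(* Both D and t1 are at most t2, so a single superpolynomial bound in t2 covers the two powers. *)
have small : (fun n => E n * D n `^ (1 + k) * (t1 n)%:R `^ k) @ \oo --> (0 : R).
  have v0 : 0 <= 1 + k + k by rewrite !addr_ge0.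
  have h := cvg_comp _ _ t2oo (ln_superpoly v0).
  have h' : (fun n => W * (expR (- (lg n ^+ 8 / 64)) * (t2 n)%:R `^ (1 + k + k))) @ \oo --> (0 : R).
    by rewrite -(mulr0 W); apply: cvgMr; exact: h.
  apply: (squeeze_cvgr _ (cvg_cst 0) h'); near=> n.
  have [d1 r0 r2 D0 [t10 t12]] : [/\ 1 <= dl n, 0 < rho n, rho n <= 2^-1, 0 < D n &
    (0 < t1 n)%N /\ (t1 n <= t2 n)%N] by near: n.
  have E0 : 0 <= E n by rewrite mulr_ge0 ?expR_ge0.
  rewrite !mulr_ge0 ?powR_ge0//= mulrA -/(E n) -mulrA ler_wpM2l//.
  have t20 : 0 < (t2 n)%:R :> R by rewrite ltr0n (leq_trans t10).
  rewrite [_ `^ (1 + k + k)]powRD ?(gt_eqF t20) ?implybT//.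
  apply: ler_pM; rewrite ?powR_ge0//.
    by apply: (ge0_ler_powR k10); rewrite ?nnegrE ?(ltW D0) ?(ltW t20)// /D lerBlDr lerDl.
  by apply: (ge0_ler_powR k0); rewrite ?nnegrE ?(ltW t20)// ler_nat.
have Esmall : (fun n => E n * (t1 n)%:R `^ k) @ \oo --> (0 : R).
  apply: (squeeze_cvgr _ (cvg_cst 0) small); near=> n.
  have [d1 r0 r2 D0 [t10 t12]] : [/\ 1 <= dl n, 0 < rho n, rho n <= 2^-1, 0 < D n &
    (0 < t1 n)%N /\ (t1 n <= t2 n)%N] by near: n.
  have E0 : 0 <= E n by rewrite mulr_ge0 ?expR_ge0.
  have ET : 0 <= E n * (t1 n)%:R `^ k by rewrite mulr_ge0 ?powR_ge0.
  rewrite ET /= [leRHS]mulrAC ler_peMr//.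
  rewrite -[leLHS](congr1 (@^~ (1 + k)) (@powR1 R)).
  apply: (ge0_ler_powR k10); rewrite ?nnegrE ?(ltW D0)//.
  have : 1 <= D n * (1 - rho n) by near: n.
  move/le_trans; apply; apply: ler_piMr; first exact: ltW.
  by move: r0; clear; lra.
(* The fourth power of the logarithm in [delta] becomes the eighth power in the exponent here. *)
have ED n : (0 < t2 n)%N -> W * expR (- ((dl n / 2) ^+ 2 / (16 * (t2 n)%:R))) = E n.
  move=> t20; have t2p : (t2 n)%:R != 0 :> R by rewrite pnatr_eq0 -lt0n.
  rewrite /E; congr (_ * expR (- _)).
  have -> : (dl n / 2) ^+ 2 / (16 * (t2 n)%:R) = dl n ^+ 2 / (64 * (t2 n)%:R).
    by field.
  by rewrite dlE; field.
have facts : \forall n \near \oo, [/\ [/\ 1 <= dl n, 0 < rho n, rho n <= 2^-1 & 0 < D n],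
   (0 < t1 n)%N, (0 < t2 n)%N, dl n <= (t2 n)%:R &
   (t2 n).-1%:R - (t1 n).-1%:R = D n /\ D n * rho n = dl n].
  near=> n.
  have [d1 r0 r2 D0 [t10 t12]] : [/\ 1 <= dl n, 0 < rho n, rho n <= 2^-1, 0 < D n &
    (0 < t1 n)%N /\ (t1 n <= t2 n)%N] by near: n.
  have t20 : (0 < t2 n)%N by apply: leq_trans t12.
  have Dr : D n * rho n = dl n by rewrite /rho mulrCA mulfV ?mulr1// gt_eqF.
  split => //.
    have : D n * rho n <= D n * 2^-1 by rewrite ler_wpM2l// ltW.
    have : 0 <= (t1 n)%:R :> R by [].
    rewrite Dr; move: D0; rewrite /D; clear; lra.
  by split => //; rewrite -!subn1 !natrB// /D; ring.
have upper h : 0 < h -> \forall n \near \oo, X n <=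
    (C1 + h) * (1 - rho n) `^ (- (1 + k)) * (convol f m2 (t1 n).-1 * (t1 n)%:R `^ k) +
    E n * D n `^ (1 + k) * (t1 n)%:R `^ k.
  move=> h0.
  have [N0 _ fN] : \forall t \near \oo, f t * t%:R `^ (1 + k) <= C1 + h.
    by apply: (cvgr_le C1) => //; rewrite ltrDl.
  near=> n.
  have [[d1 r0 r2 D0] t10 t20 dt [TD Dr]] : [/\ [/\ 1 <= dl n, 0 < rho n, rho n <= 2^-1 & 0 < D n],
   (0 < t1 n)%N, (0 < t2 n)%N, dl n <= (t2 n)%:R &
   (t2 n).-1%:R - (t1 n).-1%:R = D n /\ D n * rho n = dl n] by near: n.
  have Db : N0%:R + 1 <= D n * (1 - rho n) by near: n.
  have r1 : 0 < 1 - rho n by move: r2; clear; lra.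
  have DD0 : 0 < D n * (1 - rho n) by rewrite mulr_gt0.
  have d0 : 0 < dl n by apply: lt_le_trans d1.
  have t1p : 0 <= (t1 n)%:R `^ k by exact: powR_ge0.
  have Dk : 0 < D n `^ (1 + k) by rewrite powR_gt0.
  have E0 : 0 <= E n by rewrite mulr_ge0 ?expR_ge0.
  pose U := (C1 + h) * (D n * (1 - rho n)) `^ (- (1 + k)).
  have Ch : 0 <= C1 + h by rewrite (ltW (addr_gt0 C10 h0)).
  have U0 : 0 <= U by rewrite mulr_ge0 ?powR_ge0.
  have ju : joint_conv f F2 (t1 n).-1 (t2 n).-1 <= U * convol f m2 (t1 n).-1 + E n.
    apply: (joint_upper (dl := dl n)) => //.
    - by move=> i N; apply: mixture_pair_marginal mix.
    - move=> i j iT jT far; rewrite -ED//; apply: (mixture_pair_off mix) => //.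
        rewrite ler_nat; have : (t1 n <= t2 n)%N.
          by rewrite -(ler_nat R); move: D0; rewrite /D; clear; lra.
        by apply: leq_trans; apply: leq_trans iT (leq_pred _).
      by rewrite ler_nat; apply: leq_trans jT (leq_pred _).
    - move=> u; rewrite TD => uge.
      have uD : D n * (1 - rho n) <= u%:R by rewrite mulrBr mulr1 Dr.
      have up : 0 < u%:R :> R by apply: lt_le_trans uD.
      apply: (@le_trans _ _ ((C1 + h) * u%:R `^ (- (1 + k)))).
        rewrite powRN ler_pdivlMr ?powR_gt0//; apply: fN => /=.
        by rewrite -(ler_nat R); move: Db uD; clear; lra.
      rewrite ler_wpM2l//.
      exact: powR_anti.
  rewrite /X -/(D n).
  apply: (@le_trans _ _ ((U * convol f m2 (t1 n).-1 + E n) * D n `^ (1 + k) * (t1 n)%:R `^ k)).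
    by rewrite ler_wpM2r// ler_wpM2r// ltW.
  have UE : U * D n `^ (1 + k) = (C1 + h) * (1 - rho n) `^ (- (1 + k)).
    rewrite /U powRM ?(ltW D0) ?(ltW r1)// [D n `^ (- _)]powRN.
    by field; rewrite gt_eqF.
  by rewrite -UE; apply: le_of_eq; ring.
have lower h M : 0 < h -> h < C1 -> \forall n \near \oo,
    (C1 - h) * (1 + rho n + M%:R / D n) `^ (- (1 + k)) *
    ((1 - 8 / lg n ^+ 8) * \sum_(0 <= i < M) f i * (m2 ((t1 n).-1 - i)%N * (t1 n)%:R `^ k) -
     E n * (t1 n)%:R `^ k) <= X n.
  move=> h0 hC.
  have [N0 _ fN] : \forall t \near \oo, C1 - h <= f t * t%:R `^ (1 + k).
    by apply: (cvgr_ge C1) => //; rewrite ltrBlDr ltrDl.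
  near=> n.
  have [[d1 r0 r2 D0] t10 t20 dt [TD Dr]] : [/\ [/\ 1 <= dl n, 0 < rho n, rho n <= 2^-1 & 0 < D n],
   (0 < t1 n)%N, (0 < t2 n)%N, dl n <= (t2 n)%:R &
   (t2 n).-1%:R - (t1 n).-1%:R = D n /\ D n * rho n = dl n] by near: n.
  have Db : N0%:R + 1 <= D n * (1 - rho n) by near: n.
  have tM : (M < t1 n)%N.
    by near: n; apply: (@near_subsequence t1 (fun t => M < t)%N t1oo); apply: nbhs_infty_gt.
  have r1 : 0 < 1 - rho n by move: r2; clear; lra.
  have DD0 : 0 < D n * (1 - rho n) by rewrite mulr_gt0.
  have d0 : 0 < dl n by apply: lt_le_trans d1.
  have l1 : 1 <= lg n by near: n; apply: lg_big.
  have Ch : 0 < C1 - h by rewrite subr_gt0.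
  have t1p : 0 <= (t1 n)%:R `^ k by exact: powR_ge0.
  have Dk : 0 < D n `^ (1 + k) by rewrite powR_gt0.
  have E0 : 0 <= E n by rewrite mulr_ge0 ?expR_ge0.
  have t2p : (t2 n)%:R != 0 :> R by rewrite pnatr_eq0 -lt0n.
  have lgp : lg n != 0 by rewrite gt_eqF// (lt_le_trans _ l1).
  have M0 : 0 <= M%:R :> R by [].
  have r3 : 0 < 1 + rho n + M%:R / D n.
    by rewrite ltr_wpDr ?divr_ge0 ?(ltW D0)//; move: r0; clear; lra.
  pose L := (C1 - h) * (D n * (1 + rho n + M%:R / D n)) `^ (- (1 + k)).
  have L0 : 0 <= L by rewrite mulr_ge0 ?powR_ge0// ltW.
  have DL : D n * (1 + rho n + M%:R / D n) = D n + dl n + M%:R.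
    by rewrite -Dr; field; rewrite gt_eqF.
  have jl : L * \sum_(0 <= i < M) f i * ((1 - 8 / lg n ^+ 8) * m2 ((t1 n).-1 - i)%N - E n) <=
      joint_conv f F2 (t1 n).-1 (t2 n).-1.
    apply: (joint_lower (dl := dl n)) => //.
    - by rewrite -ltnS prednK.
    - have : D n * rho n <= D n by rewrite ler_piMr ?(ltW D0)//; move: r2; clear; lra.
      by rewrite Dr -TD; clear; lra.
    - move=> i iT; rewrite -ED// prednK//.
      have -> : 8 / lg n ^+ 8 = 8 * (t2 n)%:R / dl n ^+ 2.
        by rewrite dlE; field; rewrite t2p lgp.
      have iT' : i%:R <= (t1 n).-1%:R :> R by rewrite ler_nat.
      have e1 : (t2 n)%:R = (t2 n).-1%:R + 1 :> R by rewrite natr1 prednK.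
      have iD : D n * rho n <= D n by rewrite ler_piMr ?(ltW D0)//; move: r2; clear; lra.
      apply: (mixture_pair_near mix) => //.
        by move: iT' e1 TD D0; clear; lra.
      by move: iT' e1 TD iD; rewrite Dr; clear; lra.
    - move=> u; rewrite TD => /andP[u1 u2].
      have uD : D n * (1 - rho n) <= u%:R by rewrite mulrBr mulr1 Dr.
      have up : 0 < u%:R :> R by apply: lt_le_trans uD.
      apply: (@le_trans _ _ ((C1 - h) * u%:R `^ (- (1 + k)))).
        rewrite ler_wpM2l ?(ltW Ch)//; apply: powR_anti => //.
        by rewrite DL.
      rewrite powRN ler_pdivrMr ?powR_gt0//; apply: fN => /=.
      by rewrite -(ler_nat R); move: Db uD; clear; lra.
  rewrite /X -/(D n).
  have LE : L * D n `^ (1 + k) = (C1 - h) * (1 + rho n + M%:R / D n) `^ (- (1 + k)).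
    rewrite /L powRM ?(ltW D0) ?(ltW r3)// [D n `^ (- _)]powRN.
    by field; rewrite gt_eqF.
  rewrite -LE.
  have jl' := ler_wpM2r t1p (ler_wpM2r (ltW Dk) jl).
  apply: le_trans jl'; set Z := \sum_(0 <= i < M) f i * ((1 - _) * _ - _).
  have -> : L * Z * D n `^ (1 + k) * (t1 n)%:R `^ k = L * D n `^ (1 + k) * (Z * (t1 n)%:R `^ k).
    by ring.
  rewrite ler_wpM2l ?(mulr_ge0 L0 (ltW Dk))// /Z.
  rewrite mulr_suml.
  under [leRHS]eq_bigr do rewrite mulrBr mulrBl.
  rewrite sumrB lerD//.
    by rewrite mulr_sumr; apply: le_of_eq; apply: eq_bigr => i _; ring.
  rewrite lerN2 -mulr_suml ler_wpM2r// -mulr_suml ler_piMl//.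
have hdE M : (fun n => \sum_(0 <= i < M) f i * (m2 ((t1 n).-1 - i)%N * (t1 n)%:R `^ k)) @ \oo -->
    \sum_(0 <= i < M) f i * C2.
  apply: (@cvg_sum_nat _ (fun i n => f i * (m2 ((t1 n).-1 - i)%N * (t1 n)%:R `^ k))) => i.
  (* The shift is i + 1: the extra 1 comes from the predecessor of t1, that is, from the Dirac mass
     at (1, 1). *)
  apply: cvgMr; apply: cvg_trans (cvg_comp _ _ t1oo (@regular_shift _ _ _ _ i.+1 mC)).
  by apply: near_eq_cvg; near=> n; rewrite /= -subn1 -subnDA add1n.
have lg8 : (fun n => 8 / lg n ^+ 8) @ \oo --> (0 : R).
  apply/cvgr0Pnorm_le => e e0; near=> n.
  have l1 : 1 <= lg n by near: n; apply: lg_big.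
  have le : 8 / e <= lg n by near: n; apply: lg_big.
  have l8 : lg n <= lg n ^+ 8 by rewrite ler_eXnr.
  have lp : 0 < lg n ^+ 8 by rewrite exprn_gt0// (lt_le_trans _ l1).
  rewrite ger0_norm ?divr_ge0 ?(ltW lp)// ler_pdivrMr// -ler_pdivrMl// mulrC.
  exact: le_trans l8.
have rpow (u : nat -> R) v : u @ \oo --> (0 : R) -> (fun n => (1 + u n) `^ v) @ \oo --> (1 : R).
  move=> u0; apply: cvg_powR1; rewrite -[X in _ --> X]addr0.
  by apply: cvgD => //; exact: cvg_cst.
have up_cvg h : (fun n => (C1 + h) * (1 - rho n) `^ (- (1 + k)) *
    (convol f m2 (t1 n).-1 * (t1 n)%:R `^ k) + E n * D n `^ (1 + k) * (t1 n)%:R `^ k) @ \oo -->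
    (C1 + h) * C2.
  have -> : (C1 + h) * C2 = (C1 + h) * 1 * C2 + 0 by ring.
  apply: cvgD => //; apply: cvgM => //; apply: cvgMr.
  by apply: (rpow (fun n => - rho n)); rewrite -oppr0; exact: cvgN.
have MD (M : nat) : (fun n => M%:R / D n) @ \oo --> (0 : R).
  apply/cvgr0Pnorm_le => e e0; near=> n.
  have [d1 r0 r2 D0 _] : [/\ 1 <= dl n, 0 < rho n, rho n <= 2^-1, 0 < D n &
    (0 < t1 n)%N /\ (t1 n <= t2 n)%N] by near: n.
  rewrite ger0_norm ?divr_ge0 ?(ltW D0)// ler_pdivrMr// -ler_pdivrMl// mulrC.
  have : M%:R / e <= D n * (1 - rho n) by near: n.
  move/le_trans; apply; apply: ler_piMr; first exact: ltW.
  by move: r0; clear; lra.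
have low_cvg h M : (fun n => (C1 - h) * (1 + rho n + M%:R / D n) `^ (- (1 + k)) *
    ((1 - 8 / lg n ^+ 8) * \sum_(0 <= i < M) f i * (m2 ((t1 n).-1 - i)%N * (t1 n)%:R `^ k) -
     E n * (t1 n)%:R `^ k)) @ \oo --> (C1 - h) * (\sum_(0 <= i < M) f i * C2).
  have -> : (C1 - h) * (\sum_(0 <= i < M) f i * C2) =
    (C1 - h) * 1 * ((1 - 0) * (\sum_(0 <= i < M) f i * C2) - 0) by ring.
  apply: cvgM.
    apply: cvgMr; under eq_fun do rewrite -addrA.
    by apply: (rpow (fun n => rho n + M%:R / D n)); rewrite -[X in _ --> X]addr0; exact: cvgD.
  by apply: cvgB => //; apply: cvgM => //; apply: cvgB => //; exact: cvg_cst.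
apply/cvgrPdist_le => e e0.
(* The first entry keeps C1 - h positive, the second bounds the loss h C2 by e / 4. *)
pose h := Num.min (C1 / 2) (e / (4 * C2)).
have h0 : 0 < h by rewrite lt_min !divr_gt0// mulr_gt0.
have hC : h < C1 by rewrite gt_min ltr_pdivrMr// ltr_pMr// ltrDl ltr01.
have h4 : h * C2 <= e / 4.
  have : h <= e / (4 * C2) by rewrite ge_min lexx orbT.
  move=> /(ler_wpM2r (ltW C20)) /le_trans; apply.
  by apply: le_of_eq; field; rewrite gt_eqF.
(* With this [eta], cutting the sum over f at M costs C1 eta C2 = e / 4. M is fixed before n, so M /
   D still tends to 0. *)
pose eta := e / (4 * C1 * C2).
have eta0 : 0 < eta by rewrite divr_gt0// !mulr_gt0.
have [M _ /(_ M (leqnn M)) FM] := (iffLR (cvgrPdist_le _ _) f1) _ eta0.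
have FM1 : 1 - eta <= \sum_(0 <= i < M) f i.
  by move: FM => /(le_trans (ler_norm _)); clear; lra.
have upe : (C1 + h) * C2 < C1 * C2 + e by move: h4 e0; clear; lra.
have lowe : C1 * C2 - e < (C1 - h) * (\sum_(0 <= i < M) f i * C2).
  have Ch : 0 <= C1 - h by rewrite subr_ge0 ltW.
  apply: (@lt_le_trans _ _ ((C1 - h) * ((1 - eta) * C2))); last first.
    by rewrite ler_wpM2l// -mulr_suml ler_wpM2r ?(ltW C20).
  have e4 : C1 * eta * C2 = e / 4 by rewrite /eta; field; rewrite !gt_eqF.
  have : 0 <= h * eta * C2 by rewrite (ltW (mulr_gt0 (mulr_gt0 h0 eta0) C20)).
  by move: e4 h4 e0; clear; lra.
have u1 := cvgr_le _ (up_cvg h) _ upe.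
have u2 := cvgr_ge _ (low_cvg h M) _ lowe.
near=> n.
have X1 : X n <= C1 * C2 + e.
  apply: le_trans (_ : _ <= (C1 + h) * (1 - rho n) `^ (- (1 + k)) *
    (convol f m2 (t1 n).-1 * (t1 n)%:R `^ k) + E n * D n `^ (1 + k) * (t1 n)%:R `^ k) _.
    by near: n; exact: upper.
  by near: n; exact: u1.
have X2 : C1 * C2 - e <= X n.
  apply: le_trans (_ : _ <= (C1 - h) * (1 + rho n + M%:R / D n) `^ (- (1 + k)) *
    ((1 - 8 / lg n ^+ 8) * \sum_(0 <= i < M) f i * (m2 ((t1 n).-1 - i)%N * (t1 n)%:R `^ k) -
     E n * (t1 n)%:R `^ k)) _.
    by near: n; exact: u2.
  by near: n; exact: lower.
by rewrite ler_norml; move: X1 X2; clear => *; apply/andP; split; lra.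
Unshelve. all: by end_near. Qed.

(** * Laws on the integers *)

Lemma measurable_fun_nat (d : measure_display) (T : measurableType d) (D : set nat)
  (f : nat -> T) : measurable_fun D f.
Proof. by []. Qed.

Lemma measurable_fun_natX (R : realType) (h : nat * R -> R) :
  (forall n, measurable_fun [set: R] (fun y => h (n, y))) ->
  measurable_fun [set: nat * R] h.
Proof.
move=> mh _ B mB; rewrite setTI.
have -> : h @^-1` B = \bigcup_n ([set n] `*` ((fun y => h (n, y)) @^-1` B)).
  apply/seteqP; split=> [[n y] /= hB|[n y] [k _ [/= ->]]//].
  by exists n.
apply: bigcup_measurable => n _; apply: measurableX => //.
by rewrite -[X in measurable X]setTI; exact: mh.
Qed.

Lemma trivIset_set1 : trivIset [set: nat] (fun k => [set k]).
Proof.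
apply/trivIsetP => i j _ _ ij; apply/seteqP; split=> // x [/= -> ji].
by rewrite ji eqxx in ij.
Qed.

Lemma setT_bigcup_set1 : [set: nat] = \bigcup_k [set k].
Proof. by apply/seteqP; split=> // x _; exists x. Qed.

Lemma ge0_integral_nat (R : realType) (p : {measure set nat -> \bar R}) (g : nat -> \bar R) :
  (forall x, (0 <= g x)%E) -> (\int[p]_x g x = \sum_(x <oo) g x * p [set x])%E.
Proof.
move=> g0.
rewrite setT_bigcup_set1.
rewrite ge0_integral_bigcup//.
- apply: eq_eseriesr => k _; rewrite (eq_integral (cst (g k))); last first.
    by move=> x; rewrite inE /= => ->.
  by rewrite integral_cst.
- exact: trivIset_set1.
Qed.

Definition graph_map (R : realType) (q : nat -> R) (x : nat) : nat * R := (x, q x).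

Lemma graph_measureE (R : realType) (p : probability nat R) (q : nat -> R)
    (P : probability (nat * R)%type R) A : is_graph_measure p q P -> measurable A ->
  P A = p (graph_map q @^-1` A).
Proof.
move=> gP mA; rewrite gP//.
rewrite (eq_integral (fun x => (\1_(graph_map q @^-1` A) x)%:E)); last first.
  move=> x _; rewrite diracE indicE; congr ((nat_of_bool _)%:R%:E).
  by apply/idP/idP; rewrite !inE /graph_map/= /xsection/= ?inE.
by rewrite integral_indic// setIT.
Qed.

(** P is the image of p under the graph map. Off the graph h may be negative, as binomial
    polynomials are outside [0, 1], so the integral is split into positive and negative parts, and
    the latter vanishes on the graph. *)
Lemma graph_integral (R : realType) (p : probability nat R) (q : nat -> R)
    (P : probability (nat * R)%type R) (h : nat * R -> R) : is_graph_measure p q P ->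
  (forall n, measurable_fun [set: R] (fun y => h (n, y))) ->
  (forall x, 0 <= h (x, q x)) ->
  (\int[P]_z (h z)%:E = \sum_(x <oo) (h (x, q x))%:E * p [set x])%E.
Proof.
move=> gP mh h0.
have mE : measurable_fun setT (EFin \o h) by apply/measurable_EFinP; apply: measurable_fun_natX.
have mg : measurable_fun [set: nat] (graph_map q) by apply: measurable_fun_nat.
have push f : measurable_fun [set: nat * R] f -> (forall z, (0 <= f z)%E) ->
    (\int[P]_z f z = \int[p]_x f (x, q x))%E.
  move=> mf f0.
  rewrite (@eq_measure_integral _ _ _ _ (pushforward p (graph_map q))); last first.
    by move=> A mA _; exact: (graph_measureE gP mA).
  rewrite (@ge0_integral_pushforward _ _ _ _ R _ mg p setT f)//.
rewrite integralE !push//.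
- have e1 x : ((EFin \o h)^\+ (x, q x) = (h (x, q x))%:E)%E.
    by rewrite funeposE/= max_l// lee_fin.
  have e2 x : ((EFin \o h)^\- (x, q x) = 0)%E.
    by rewrite funenegE/= max_r// lee_fin oppr_le0.
  rewrite (eq_integral (fun x => (h (x, q x))%:E)); last by move=> x _; exact: e1.
  rewrite [X in (_ - X)%E](eq_integral (cst 0%E)); last by move=> x _; exact: e2.
  by rewrite integral_cst// mul0e sube0 ge0_integral_nat// => x; rewrite lee_fin.
- exact: measurable_funeneg.
- exact: measurable_funepos.
Qed.

Lemma cvg_bounded_sum (R : realType) (u : nat -> R) (H : R) : (forall x, 0 <= u x) ->
  (forall N, \sum_(0 <= x < N) u x <= H) ->
  exists2 l, (fun N => \sum_(0 <= x < N) u x) @ \oo --> l &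
    (\sum_(x <oo) (u x)%:E = l%:E)%E.
Proof.
move=> u0 uH.
have cv : cvgn (fun N => \sum_(0 <= x < N) u x).
  apply: nondecreasing_is_cvgn.
    by move=> m n mn; rewrite [leRHS](big_cat_nat (leq0n m) mn)/= lerDl sumr_ge0.
  by exists H => _ [N _ <-]; exact: uH.
exists (limn (fun N => \sum_(0 <= x < N) u x)) => //.
rewrite -EFin_lim//; congr (lim (_ @ \oo)); apply/funext => N /=.
by rewrite sumEFin.
Qed.

Lemma graph_Rintegral (R : realType) (p : probability nat R) (q : nat -> R)
    (P : probability (nat * R)%type R) (h : nat * R -> R) (H : R) : is_graph_measure p q P ->
  (forall n, measurable_fun [set: R] (fun y => h (n, y))) ->
  (forall x, 0 <= h (x, q x)) ->
  (forall N, \sum_(0 <= x < N) fine (p [set x]) * h (x, q x) <= H) ->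
  (fun N => \sum_(0 <= x < N) fine (p [set x]) * h (x, q x)) @ \oo --> \int[P]_z h z.
Proof.
move=> gP mh h0 hH.
have u0 x : 0 <= fine (p [set x]) * h (x, q x) by rewrite mulr_ge0// fine_ge0.
have [l ul le] := cvg_bounded_sum u0 hH.
suff -> : \int[P]_z h z = l by [].
rewrite /Rintegral (graph_integral gP mh h0) -[RHS]/(fine l%:E) -le; congr fine.
apply: eq_eseriesr => x _; rewrite mulrC EFinM fineK//.
exact: fin_num_measure.
Qed.

Lemma probability_nat_sum (R : realType) (f : probability nat R) :
  (fun N => \sum_(0 <= i < N) fine (f [set i])) @ \oo --> (1 : R).
Proof.
have f0 i : 0 <= fine (f [set i]) by rewrite fine_ge0.
have tot : (\sum_(i <oo) (fine (f [set i]))%:E = 1)%E.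
  rewrite -(@probability_setT _ _ _ f) setT_bigcup_set1 measure_bigcup//; last exact: trivIset_set1.
  rewrite [RHS](eq_eseriesl (Q := xpredT)); last by move=> i; rewrite mem_set.
  by apply: eq_eseriesr => i _; rewrite fineK// fin_num_measure.
have fH N : \sum_(0 <= i < N) fine (f [set i]) <= 1.
  rewrite -lee_fin -tot -sumEFin; apply: nneseries_lim_ge => i _ _.
  by rewrite lee_fin.
have [l ul le] := cvg_bounded_sum f0 fH.
suff -> : (1 : R) = l by [].
by apply: EFin_inj; rewrite -le tot.
Qed.

(** * Compound Poisson probabilities *)

Definition gen_poly (R : realType) (g : nat -> R) (t : nat) : {poly R} := \poly_(j < t.+1) g j.

(* The t-th coefficient of the n-th power involves only the coefficients of degree at
   most t, so truncating the generating series at degree t loses nothing. *)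
Definition conv_pow (R : realType) (g : nat -> R) (n t : nat) : R := (gen_poly g t ^+ n)`_t.

Lemma coef_exp_trunc (R : realType) (p p' : {poly R}) n t :
  (forall j, (j <= t)%N -> p`_j = p'`_j) -> forall j, (j <= t)%N -> (p ^+ n)`_j = (p' ^+ n)`_j.
Proof.
move=> pp; elim: n => [|n IH] j jt; first by rewrite !expr0.
rewrite !exprS !coefM; apply: eq_bigr => i _.
rewrite pp ?IH//; first by apply: leq_trans jt; apply: leq_subr.
by apply: leq_trans jt; rewrite -ltnS.
Qed.

(** Compares coefficients in (G^(n+1))' = (n+1) G^n G', where G is the generating polynomial; the
    coefficients of G' carry the weights j g(j). *)
Lemma conv_pow_panjer (R : realType) (g : nat -> R) n t :
  t%:R * conv_pow g n.+1 t =
  n.+1%:R * \sum_(0 <= i < t.+1) conv_pow g n i * ((t - i)%:R * g (t - i)%N).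
Proof.
case: t => [|t].
  by rewrite mul0r big_nat1 subnn mul0r !mulr0.
have h : ((gen_poly g t.+1 ^+ n.+1)^`())`_t =
    (gen_poly g t.+1 ^+ n.+1)`_t.+1 *+ t.+1 by rewrite coef_deriv.
rewrite /conv_pow mulr_natl -h deriv_exp coefMn /= mulr_natl; congr (_ *+ _).
rewrite mulrC coefM big_nat_recr//= subnn mul0r mulr0 addr0 big_mkord.
apply: eq_bigr => i _; have it : (i <= t)%N by rewrite -ltnS.
rewrite coef_deriv coef_poly -subSn// ltnS leq_subr [X in _ = _ * X]mulr_natl; congr (_ * _).
apply: (@coef_exp_trunc R _ _ n i) => // j ji.
rewrite !coef_poly !ltnS ji; by rewrite (leq_trans ji)// ltnW.
Qed.

Lemma conv_pow0 (R : realType) (g : nat -> R) t : conv_pow g 0 t = (t == 0%N)%:R.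
Proof. by rewrite /conv_pow expr0 coef1. Qed.

Lemma conv_powS (R : realType) (g : nat -> R) n t :
  conv_pow g n.+1 t = \sum_(0 <= j < t.+1) conv_pow g n (t - j) * g j.
Proof.
rewrite /conv_pow exprS coefM big_mkord; apply: eq_bigr => j _.
rewrite mulrC coef_poly ltn_ord; congr (_ * _).
apply: (@coef_exp_trunc R _ _ n (t - j)) => // i ij.
by rewrite !coef_poly !ltnS ij (leq_trans ij)// leq_subr.
Qed.

Lemma conv_pow_ge0 (R : realType) (g : nat -> R) n t : (forall j, 0 <= g j) ->
  0 <= conv_pow g n t.
Proof.
move=> g0; elim: n t => [|n IH] t; first by rewrite conv_pow0.
by rewrite conv_powS sumr_ge0// => j _; rewrite mulr_ge0.
Qed.

Lemma measurable_RV_nat (d : measure_display) (T : measurableType d) (f : T -> nat) (A : set nat) :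
  measurable_fun [set: T] f -> measurable (f @^-1` A).
Proof. by move=> mf; rewrite -[X in measurable X]setTI; apply: mf. Qed.

Lemma measure_split_nat (R : realType) (d : measure_display) (T : measurableType d)
    (mu : {measure set T -> \bar R}) (A : set T) (Z : T -> nat) N :
  measurable A -> measurable_fun [set: T] Z -> (forall w, A w -> (Z w < N)%N) ->
  mu A = (\sum_(0 <= j < N) mu (A `&` Z @^-1` [set j]))%E.
Proof.
move=> mA mZ AN; rewrite big_mkord.
pose F j := A `&` Z @^-1` [set j].
rewrite -(@measure_bigsetU _ _ _ mu F).
- congr (mu _); rewrite -bigcup_mkord; apply/seteqP; split=> [w Aw|w [j _ []]//].
  by exists (Z w) => //; exact: AN.
- by move=> j; apply: measurableI => //; exact: measurable_RV_nat.
- apply/trivIsetP => i j _ _ ij; apply/seteqP; split=> // w [[_ /= e1] [_ /= e2]].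
  by move: ij; rewrite -e1 -e2 eqxx.
Qed.

(** Cancels the factor n + 1 of [conv_pow_panjer], which turns the identities for fixed n into one
    recursion for the compound law. *)
Lemma poisson_pmfS (R : realType) (lam : R) n : 0 < lam ->
  poisson_pmf lam n.+1 * n.+1%:R = lam * poisson_pmf lam n.
Proof.
move=> lam0; rewrite /poisson_pmf lam0 factS natrM exprS.
by field; rewrite nat1r !pnatr_eq0 -lt0n fact_gt0.
Qed.

Section compound.
Context (R : realType) (d : measure_display) (Omega : measurableType d)
  (Pr : probability Omega R) (Lam : {RV Pr >-> nat}) (H : nat -> {RV Pr >-> nat}).

(** The first m summands enter through their sum, the later ones through prescribed values.
    Induction on m then resolves the sum one variable at a time, and independence is only invoked at
    m = 0, for a joint point event. *)
Definition compound_event n m t (v : nat -> nat) : set Omega :=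
  [set w | [/\ Lam w = n, (\sum_(1 <= k < m.+1) H k w)%N = t &
    forall k, (m < k <= n)%N -> H k w = v k]].

Lemma measurable_partial_sum m :
  measurable_fun [set: Omega] (fun w => (\sum_(1 <= k < m.+1) H k w)%N).
Proof.
elim: m => [|m IH].
  have -> : (fun w => (\sum_(1 <= k < 1) H k w)%N) = cst 0%N.
    by apply/funext => w; rewrite big_geq.
  exact: measurable_cst.
have -> : (fun w => (\sum_(1 <= k < m.+2) H k w)%N) =
    (fun w => (\sum_(1 <= k < m.+1) H k w + H m.+1 w)%N).
  by apply/funext => w; rewrite big_nat_recr.
by apply: measurable_fun_addn => //; exact: measurable_funPT.
Qed.

Lemma measurable_compound_event n m t v : measurable (compound_event n m t v).
Proof.
have -> : compound_event n m t v = (Lam @^-1` [set n]) `&`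
   ((fun w => (\sum_(1 <= k < m.+1) H k w)%N) @^-1` [set t]) `&`
   \bigcap_(k in [set k | (m < k <= n)%N]) (H k @^-1` [set v k]).
  by apply/seteqP; split=> w [] //= [? ?] ?.
apply: measurableI; first apply: measurableI.
- by apply: measurable_RV_nat; exact: measurable_funPT.
- by apply: measurable_RV_nat; exact: measurable_partial_sum.
- by apply: bigcap_measurableType => k _; apply: measurable_RV_nat; exact: measurable_funPT.
Qed.

Lemma compound_event_pr (g pois : nat -> R) n m t v :
  mutually_independent (fun k : nat => if k is 0%N then Lam else H k) ->
  (forall n, Pr (Lam @^-1` [set n]) = (pois n)%:E) ->
  (forall k s, (0 < k)%N -> Pr (H k @^-1` [set s]) = (g s)%:E) ->
  (m <= n)%N ->
  Pr (compound_event n m t v) =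
  (pois n * conv_pow g m t * \prod_(m.+1 <= k < n.+1) g (v k))%:E.
Proof.
move=> ind pL pH; elim: m t v => [|m IH] t v mn.
  rewrite conv_pow0; have [->|t0] := eqVneq t 0%N; last first.
    have -> : compound_event n 0 t v = set0.
      apply/seteqP; split=> // w [_].
      by rewrite big_geq// => /esym /eqP; rewrite (negbTE t0).
    by rewrite measure0 mulr0 mul0r.
  pose X := fun k : nat => if k is 0%N then Lam else H k.
  pose A := fun k : nat => if k is 0%N then [set n] else [set v k].
  have -> : compound_event n 0 0 v = \bigcap_(i in [set` index_iota 0 n.+1]) (X i @^-1` A i).
    apply/seteqP; split=> [w [wn _ wv] [|k]/= kn|w wX] //.
      by apply: wv; rewrite mem_index_iota in kn.
    split; first by apply: (wX 0%N); rewrite /= mem_index_iota.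
      by rewrite big_geq.
    case=> // k kn; apply: (wX k.+1); by rewrite /= mem_index_iota.
  have indE : Pr (\bigcap_(i in [set` index_iota 0 n.+1]) (X i @^-1` A i)) =
      (\prod_(0 <= i < n.+1) Pr (X i @^-1` A i))%E by apply: ind => //; exact: iota_uniq.
  rewrite indE.
  have e0 : Pr (X 0%N @^-1` A 0%N) = (pois n)%:E by exact: pL.
  have eS k : Pr (X k.+1 @^-1` A k.+1) = (g (v k.+1))%:E by exact: pH.
  have -> : (\prod_(0 <= i < n.+1) Pr (X i @^-1` A i) =
      Pr (X 0%N @^-1` A 0%N) * \prod_(0 <= i < n) Pr (X i.+1 @^-1` A i.+1))%E.
    exact: big_nat_recl.
  rewrite e0 mulr1 EFinM; congr (_ * _)%E.
  rewrite big_add1/= -prodEFin; apply: eq_bigr => k _.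
  exact: eS.
rewrite (@measure_split_nat _ _ _ _ _ (H m.+1) t.+1); last 3 first.
- exact: measurable_compound_event.
- exact: measurable_funPT.
- by move=> w [_ + _]; rewrite big_nat_recr//= => <-; rewrite ltnS leq_addl.
rewrite conv_powS mulr_sumr mulr_suml -sumEFin.
apply: eq_big_nat => j /andP[_ jt].
pose v' k := if k == m.+1 then j else v k.
have -> : compound_event n m.+1 t v `&` H m.+1 @^-1` [set j] = compound_event n m (t - j) v'.
  apply/seteqP; split=> w.
    move=> [[wn wt wv] /= wj]; split => //.
      by move: wt; rewrite big_nat_recr//= wj => <-; rewrite addnK.
    move=> k /andP[mk kn]; rewrite /v'; case: eqP => [->//|/eqP km].
    by apply: wv; rewrite kn ltn_neqAle eq_sym km mk.
  move=> [wn wt wv]; have wj : H m.+1 w = j.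
    by rewrite wv /v' ?eqxx// ltnSn.
  split => //; split => //.
    by rewrite big_nat_recr//= wt wj subnK.
  move=> k /andP[mk kn]; rewrite wv; last by rewrite kn (ltnW mk).
  by rewrite /v' gtn_eqF.
apply: (etrans (IH (t - j)%N v' (ltnW mn))).
congr (_%:E); rewrite big_ltn; last by rewrite ltnS.
rewrite {1}/v' eqxx !mulrA; congr (_ * _).
by apply: eq_big_nat => k /andP[mk _]; rewrite /v' gtn_eqF.
Qed.

End compound.

Lemma f1_bar_pmf (R : realType) (mu : R) (P : probability (nat * R)%type R)
    (f1 : probability nat R) : is_f1_bar mu P f1 ->
  (forall s, 0 <= g_pmf P s) /\
  forall t, (fun N => \sum_(0 <= n < N) poisson_pmf (mu * moment P 1 0) n * conv_pow (g_pmf P) n t)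
    @ \oo --> fine (f1 [set t]).
Proof.
case=> dd [Om [Pr [Lam [H [ind pL pH f1E]]]]].
have g0 s : 0 <= g_pmf P s by rewrite -lee_fin -(pH 1%N).
split; first exact: g0.
move=> t; pose u n := poisson_pmf (mu * moment P 1 0) n * conv_pow (g_pmf P) n t.
rewrite -/u.
have u0 n : 0 <= u n by rewrite mulr_ge0 ?poisson_pmf_ge0 ?conv_pow_ge0.
have f1u : (\sum_(n <oo) (u n)%:E)%E = f1 [set t].
  rewrite f1E//.
  have -> : [set w | [set t] (\sum_(1 <= k < (Lam w).+1) H k w)%N] =
      \bigcup_n compound_event Lam H n n t (fun=> 0%N).
    apply/seteqP; split=> [w /= wt|w [n _ [wn wt _]] /=]; last by rewrite wn.
    exists (Lam w) => //; split => // k /andP[k1 k2].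
    by move: (leq_trans k1 k2); rewrite ltnn.
  rewrite measure_bigcup; last 2 first.
  - by move=> n _; exact: measurable_compound_event.
  - apply/trivIsetP => i j _ _ ij; apply/seteqP; split=> // w [[/= e1 _ _] [/= e2 _ _]].
    by move: ij; rewrite -e1 -e2 eqxx.
  rewrite [RHS](eq_eseriesl (Q := xpredT)); last by move=> i; rewrite mem_set.
  apply: eq_eseriesr => n _.
  have := compound_event_pr t (fun=> 0%N) ind pL pH (leqnn n).
  by rewrite big_geq// mulr1 => e; exact: esym e.
have uH N : \sum_(0 <= n < N) u n <= fine (f1 [set t]).
  rewrite -lee_fin fineK ?fin_num_measure// -f1u -sumEFin; apply: nneseries_lim_ge => n _ _.
  by rewrite lee_fin.
have [l ul le] := cvg_bounded_sum u0 uH.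
suff -> : fine (f1 [set t]) = l by [].
by rewrite -f1u le.
Qed.

Lemma f1_bar_panjer (R : realType) (mu : R) (P : probability (nat * R)%type R)
    (f1 : probability nat R) t : 0 < mu * moment P 1 0 -> is_f1_bar mu P f1 ->
  t%:R * fine (f1 [set t]) = mu * moment P 1 0 *
    convol (fun i => fine (f1 [set i])) (fun j => j%:R * g_pmf P j) t.
Proof.
set lam := mu * _ => lam0 /f1_bar_pmf[g0]; rewrite -/lam => f1c.
pose c n i := conv_pow (g_pmf P) n i.
have lhs : (fun N => t%:R * \sum_(0 <= n < N.+1) poisson_pmf lam n * c n t) @ \oo -->
    t%:R * fine (f1 [set t]).
  by apply: cvgMr; have := f1c t; rewrite -cvg_shiftS; exact.
have rhs : (fun N => lam * \sum_(0 <= i < t.+1)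
      (\sum_(0 <= n < N) poisson_pmf lam n * c n i) * ((t - i)%:R * g_pmf P (t - i)%N)) @ \oo -->
    lam * convol (fun i => fine (f1 [set i])) (fun j => j%:R * g_pmf P j) t.
  apply: cvgMr.
  apply: (@cvg_sum_nat _ (fun i N => (\sum_(0 <= n < N) poisson_pmf lam n * c n i) *
    ((t - i)%:R * g_pmf P (t - i)%N))) => i.
  by apply: cvgMl; exact: f1c.
(* The Poisson identity shifts n by one and the term n = 0 on the left vanishes, so the partial sums
   over n <= N and n < N agree exactly, before any limit. *)
suff e : (fun N => t%:R * \sum_(0 <= n < N.+1) poisson_pmf lam n * c n t) =
    (fun N => lam * \sum_(0 <= i < t.+1)
      (\sum_(0 <= n < N) poisson_pmf lam n * c n i) * ((t - i)%:R * g_pmf P (t - i)%N)).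
  by rewrite e in lhs; exact: (cvg_unique _ lhs rhs).
apply/funext => N.
rewrite big_nat_recl//= mulrDr {1}/c conv_pow0.
have -> : t%:R * (poisson_pmf lam 0 * (t == 0%N)%:R) = 0.
  by case: t {f1c lhs rhs} => [|t]; rewrite ?mul0r ?mulr0.
rewrite add0r mulr_sumr.
transitivity (\sum_(0 <= n < N) lam * (poisson_pmf lam n *
    \sum_(0 <= i < t.+1) c n i * ((t - i)%:R * g_pmf P (t - i)%N))).
  apply: eq_bigr => n _.
  by rewrite [RHS]mulrA -(poisson_pmfS n lam0) -mulrA -conv_pow_panjer mulrCA.
rewrite -mulr_sumr; congr (_ * _).
transitivity (\sum_(0 <= n < N) \sum_(0 <= i < t.+1)
    poisson_pmf lam n * (c n i * ((t - i)%:R * g_pmf P (t - i)%N))).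
  by apply: eq_bigr => n _; rewrite mulr_sumr.
rewrite exchange_big/=; apply: eq_bigr => i _; rewrite mulr_suml.
by apply: eq_bigr => n _; rewrite mulrA.
Qed.

(** * Convolutions on pairs of integers *)

Lemma measurable_nat_pair (A : set (nat * nat)) : measurable A.
Proof.
have -> : A = \bigcup_n ([set n] `*` [set m | A (n, m)]).
  by apply/seteqP; split=> [[n m] Anm|[n m] [k _ [/= ->]]//]; exists n.
by apply: bigcup_measurable => n _; exact: measurableX.
Qed.

Lemma convolution_point (R : realType) (m1 m2 : probability (nat * nat)%type R) (s t : nat) :
  (convolution m1 m2 [set (s, t)] =
   \sum_(0 <= i < s.+1) \sum_(0 <= j < t.+1) m1 [set (s - i, t - j)%N] * m2 [set (i, j)])%E.
Proof.
change ((m1 \x m2)%E (Defs.add_pair @^-1` [set (s, t)]) = (\sum_(0 <= i < s.+1)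
  \sum_(0 <= j < t.+1) m1 [set (s - i, t - j)%N] * m2 [set (i, j)])%E).
have mS : measurable (Defs.add_pair @^-1` [set (s, t)]).
  by rewrite -[X in measurable X]setTI; apply: Defs.measurable_add_pair => //;
    exact: measurable_nat_pair.
have mZ1 : measurable_fun setT (fun w : (nat * nat) * (nat * nat) => w.2.1).
  by apply: (measurableT_comp measurable_fst); exact: measurable_snd.
have mZ2 : measurable_fun setT (fun w : (nat * nat) * (nat * nat) => w.2.2).
  by apply: (measurableT_comp measurable_snd); exact: measurable_snd.
rewrite (measure_split_nat _ mS mZ1 (N := s.+1)); last first.
  by move=> w [<- _]; rewrite ltnS leq_addl.
apply: eq_big_nat => i /andP[_ si].
rewrite (@measure_split_nat _ _ _ _ _ (fun w => w.2.2) t.+1) //; last 2 first.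
- by apply: measurableI => //; exact: measurable_RV_nat.
- by move=> w [[_ <-] _]; rewrite ltnS leq_addl.
apply: eq_big_nat => j /andP[_ tj].
rewrite (_ : _ `&` _ `&` _ = [set (s - i, t - j)%N] `*` [set (i, j)]).
  by apply: product_measure1E; exact: measurable_nat_pair.
apply/seteqP; split=> [[[x y] [e f]] /= [[[<- <-] <-] <-]|[[x y] [e f]] /= [[-> ->] [-> ->]]].
  by rewrite !addnK.
by rewrite /Defs.add_pair/= !subnK.
Qed.

Lemma convolution_marginal (R : realType) (m1 m2 : probability (nat * nat)%type R) (s : nat) :
  (convolution m1 m2 ([set s] `*` setT) =
   \sum_(0 <= i < s.+1) m1 ([set (s - i)%N] `*` setT) * m2 ([set i] `*` setT))%E.
Proof.
change ((m1 \x m2)%E (Defs.add_pair @^-1` ([set s] `*` setT)) = (\sum_(0 <= i < s.+1)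
  m1 ([set (s - i)%N] `*` setT) * m2 ([set i] `*` setT))%E).
have mS : measurable (Defs.add_pair @^-1` ([set s] `*` setT)).
  by rewrite -[X in measurable X]setTI; apply: Defs.measurable_add_pair => //;
    exact: measurable_nat_pair.
have mZ1 : measurable_fun setT (fun w : (nat * nat) * (nat * nat) => w.2.1).
  by apply: (measurableT_comp measurable_fst); exact: measurable_snd.
rewrite (measure_split_nat _ mS mZ1 (N := s.+1)); last first.
  by move=> w [<- _]; rewrite ltnS leq_addl.
apply: eq_big_nat => i /andP[_ si].
rewrite (_ : _ `&` _ = ([set (s - i)%N] `*` setT) `*` ([set i] `*` setT)).
  by apply: product_measure1E; exact: measurable_nat_pair.
apply/seteqP; split=> [[[x y] [e f]] /= [[<- _] <-]|[[x y] [e f]] /= [[-> _] [-> _]]].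
  by rewrite !addnK.
by rewrite /Defs.add_pair/= subnK.
Qed.

Lemma convolution_dirac (R : realType) (m : probability (nat * nat)%type R) A :
  (convolution (\d_((1, 1)%N : nat * nat)) m A = m [set z | A (z.1.+1, z.2.+1)])%E.
Proof.
change ((\d_((1, 1)%N : nat * nat) \x m)%E (Defs.add_pair @^-1` A) =
  m [set z | A (z.1.+1, z.2.+1)]).
rewrite /product_measure1 /= integral_dirac//; last first.
  by move=> _ B _; exact: measurable_nat_pair.
rewrite diracT mul1e; congr (m _); apply/seteqP.
by split=> z; rewrite /xsection/= inE.
Qed.

Section bidegree.
Context (R : realType) (mu : R) (P : probability (nat * R)%type R)
  (f2 : probability (nat * nat)%type R).

Lemma shifted_product_point (f1 : probability nat R) i j :
  (convolution (\d_((1, 1)%N : nat * nat)) (f1 \x f1) [set (i, j)] =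
   if (0 < i)%N && (0 < j)%N then f1 [set i.-1] * f1 [set j.-1] else 0)%E.
Proof.
rewrite convolution_dirac; case: i => [|i] /=; last case: j => [|j] /=.
- by rewrite (_ : [set _ | _] = set0) ?measure0//; apply/seteqP; split=> // z [].
- by rewrite (_ : [set _ | _] = set0) ?measure0//; apply/seteqP; split=> // z [].
rewrite -product_measure1E//; congr (_ _).
by apply/seteqP; split=> [[x y] /= [-> ->]|[x y] /= [-> ->]].
Qed.

Lemma shifted_product_marginal (f1 : probability nat R) i :
  (convolution (\d_((1, 1)%N : nat * nat)) (f1 \x f1) ([set i] `*` setT) =
   if (0 < i)%N then f1 [set i.-1] else 0)%E.
Proof.
rewrite convolution_dirac; case: i => [|i] /=.
  by rewrite (_ : [set _ | _] = set0) ?measure0//; apply/seteqP; split=> // z [].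
rewrite -[RHS]mule1 -(@probability_setT _ _ _ f1) -product_measure1E//; congr (_ _).
by apply/seteqP; split=> [[x y] /= [[->] _]|[x y] /= [-> _]].
Qed.

Lemma bidegree_law_convolutions : is_limiting_bidegree_law mu P f2 ->
  exists f1 f2', [/\ is_f1_bar mu P f1, is_f2' P f2',
    forall s t, fine (f2 [set (s.+1, t.+1)]) =
      joint_conv (fun i => fine (f1 [set i])) (f2'_pmf P) s t &
    forall s, fine (f2 ([set s.+1] `*` setT)) =
      convol (fun i => fine (f1 [set i])) (fun i => fine (f2' ([set i] `*` setT))) s].
Proof.
case=> f1 [f2' [h1 h2 h0]]; exists f1, f2'.
(* The shifted product is hidden behind Q; only its values at points and on vertical lines matter
   from here on. *)
have [Q [Qp Qm h]] : exists Q : probability (nat * nat)%type R, [/\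
    forall i j, (Q [set (i, j)] =
      if (0 < i)%N && (0 < j)%N then f1 [set i.-1] * f1 [set j.-1] else 0)%E,
    forall i, (Q ([set i] `*` setT) = if (0 < i)%N then f1 [set i.-1] else 0)%E &
    forall A, measurable A -> f2 A = convolution Q f2' A].
  exists (convolution (\d_((1, 1)%N : nat * nat)) (f1 \x f1)%E); split=> //.
    exact: shifted_product_point.
  exact: shifted_product_marginal.
have f1E i : f1 [set i] = (fine (f1 [set i]))%:E by rewrite fineK// fin_num_measure.
clear h0; split=> // s => [t|].
- rewrite h; last exact: measurable_nat_pair.
  (* The term i = s + 1 would leave Q a first coordinate 0, which the shift by (1, 1) excludes;
     likewise for j = t + 1 below. *)
  rewrite convolution_point /joint_conv big_nat_recr//= [X in (_ + X)%E]big1 ?adde0; last first.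
    by move=> j _; rewrite Qp subnn mul0e.
  transitivity (fine (\sum_(0 <= i < s.+1) \sum_(0 <= j < t.+1)
      (fine (f1 [set (s - i)%N]) * fine (f1 [set (t - j)%N]) * f2'_pmf P i j)%:E)).
    congr fine; apply: eq_big_nat => i /andP[_ si].
    rewrite big_nat_recr//= [X in (_ + X)%E](_ : _ = 0%E) ?adde0; last first.
      by rewrite Qp subnn andbF mul0e.
    apply: eq_big_nat => j /andP[_ tj].
    by rewrite Qp !subSn//= h2 2!EFinM -!f1E.
  rewrite -[RHS]/(fine (_%:E)) -sumEFin; congr fine.
  by apply: eq_bigr => i _; rewrite -sumEFin.
- rewrite h; last exact: measurable_nat_pair.
  rewrite convolution_marginal big_nat_recr//= Qm subnn mul0e adde0.
  rewrite -[RHS]/(fine (_%:E)) convolC /convol -sumEFin; congr fine.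
  apply: eq_big_nat => i /andP[_ si].
  rewrite Qm !subSn//= muleC EFinM -f1E fineK// fin_num_measure//.
  exact: measurable_nat_pair.
Qed.

End bidegree.

Lemma nat_pair_marginal (R : realType) (m : probability (nat * nat)%type R)
    (F2 : nat -> nat -> R) s : (forall i j, m [set (i, j)] = (F2 i j)%:E) ->
  (fun N => \sum_(0 <= j < N) F2 s j) @ \oo --> fine (m ([set s] `*` setT)).
Proof.
move=> mF.
have F0 j : 0 <= F2 s j by rewrite -lee_fin -mF.
have tot : (\sum_(j <oo) (F2 s j)%:E = m ([set s] `*` setT))%E.
  have -> : [set s] `*` [set: nat] = \bigcup_j [set (s, j)].
    by apply/seteqP; split=> [[i j] /= [-> _]|[i j] [k _ [-> ->]]//]; exists j.
  rewrite measure_bigcup//.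
  - rewrite [RHS](eq_eseriesl (Q := xpredT)); last by move=> i; rewrite mem_set.
    by apply: eq_eseriesr => j _; exact: (esym (mF _ _)).
  - by move=> j _; exact: measurable_nat_pair.
  - apply/trivIsetP => i j _ _ ij; apply/seteqP; split=> // z [/= -> [ji]].
    by rewrite ji eqxx in ij.
have FH N : \sum_(0 <= j < N) F2 s j <= fine (m ([set s] `*` setT)).
  rewrite -lee_fin fineK; last by rewrite fin_num_measure//; exact: measurable_nat_pair.
  rewrite -tot -sumEFin; apply: nneseries_lim_ge => i _ _.
  by rewrite lee_fin.
have [l ul le] := cvg_bounded_sum F0 FH.
suff -> : fine (m ([set s] `*` setT)) = l by [].
by rewrite -tot le.
Qed.

Lemma binomial_pmf_sum1 (R : realType) n (q : R) N : (n < N)%N ->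
  \sum_(0 <= k < N) binomial_pmf n q k = 1.
Proof.
move=> nN; rewrite (big_cat_nat (leq0n n.+1) nN)/= [X in _ + X]big_nat_cond.
rewrite [X in _ + X]big1 ?addr0; last first.
  by move=> k /andP[/andP[nk _] _]; rewrite binomial_pmf_small.
by rewrite -[RHS](binomial_mean1 n q); apply: eq_bigr => k _; rewrite mulr1.
Qed.

(** Here m2 is a sum over j of sums over x, whereas the definition asks for a sum over x alone. All
    terms are nonnegative, and the interchange is proved by two inequalities. *)
Lemma binomial_mixture_marginal (R : realType) (q w : nat -> R) r F2 (m2 : nat -> R) W :
  (forall x, 0 <= q x <= 1) -> (forall x, 0 <= w x) ->
  (forall N, \sum_(0 <= x < N) w x <= W) ->
  (forall i j, (fun N => \sum_(0 <= x < N)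
    w x * (binomial_pmf (x - r) (q x) i * binomial_pmf (x - r) (q x) j)) @ \oo --> F2 i j) ->
  (forall i, (fun N => \sum_(0 <= j < N) F2 i j) @ \oo --> m2 i) ->
  binomial_mixture q w r F2 m2 W.
Proof.
move=> q01 w0 wW F2E m2E.
pose l i : R := limn (fun N => \sum_(0 <= x < N) w x * binomial_pmf (x - r) (q x) i).
have lE i : (fun N => \sum_(0 <= x < N) w x * binomial_pmf (x - r) (q x) i) @ \oo --> l i.
  have u0 x : 0 <= w x * binomial_pmf (x - r) (q x) i by rewrite mulr_ge0 ?binomial_pmf_ge0.
  have uW N : \sum_(0 <= x < N) w x * binomial_pmf (x - r) (q x) i <= W.
    by apply: le_trans (wW N); apply: ler_sum => x _; rewrite ler_piMr ?binomial_pmf_le1.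
  have [l' ul _] := cvg_bounded_sum u0 uW.
  by rewrite /l (cvg_lim _ ul).
have mix : binomial_mixture q w r F2 l W by split.
have F20 i j := mixture_pair_ge0 i j mix.
suff e : l = m2 by rewrite -e.
apply/funext => i; apply/le_anti/andP; split; last first.
  by apply: (cvgr_to_le (m2E i)); near=> N; exact: mixture_pair_marginal mix.
apply: (cvgr_to_le (lE i)); near=> N.
apply: le_trans (partial_sum_le N (F20 i) (m2E i)).
(* For x < N the binomial is carried by j < N, so summing it over j < N gives exactly 1. *)
have -> : \sum_(0 <= x < N) w x * binomial_pmf (x - r) (q x) i = \sum_(0 <= j < N)
    \sum_(0 <= x < N) w x * (binomial_pmf (x - r) (q x) i * binomial_pmf (x - r) (q x) j).
  rewrite exchange_big/=; apply: eq_big_nat => x /andP[_ xN].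
  rewrite -mulr_sumr -mulr_sumr binomial_pmf_sum1 ?mulr1//.
  by apply: leq_ltn_trans xN; exact: leq_subr.
apply: ler_sum => j _; apply: partial_sum_le (F2E i j) => x.
by rewrite !mulr_ge0 ?binomial_pmf_ge0.
Unshelve. all: by end_near. Qed.

Lemma graph_weight_integral (R : realType) (p : probability nat R) (q : nat -> R)
    (P : probability (nat * R)%type R) (v phi : nat * R -> R) (H : R) : is_graph_measure p q P ->
  (forall n, measurable_fun [set: R] (fun y => v (n, y))) ->
  (forall n, measurable_fun [set: R] (fun y => phi (n, y))) ->
  (forall x, 0 <= v (x, q x)) -> (forall x, 0 <= phi (x, q x) <= 1) ->
  (forall N, \sum_(0 <= x < N) fine (p [set x]) * v (x, q x) <= H) ->
  (fun N => \sum_(0 <= x < N) fine (p [set x]) * v (x, q x) * phi (x, q x)) @ \oo -->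
    \int[P]_z (phi z * v z).
Proof.
move=> gP mv mphi v0 phi01 vH.
have -> : (fun N => \sum_(0 <= x < N) fine (p [set x]) * v (x, q x) * phi (x, q x)) =
    (fun N => \sum_(0 <= x < N) fine (p [set x]) * (phi (x, q x) * v (x, q x))).
  by apply/funext => N; apply: eq_bigr => x _; rewrite mulrCA mulrC.
apply: (@graph_Rintegral R p q P (fun z => phi z * v z) H gP).
- by move=> n; apply: measurable_funM.
- by move=> x; rewrite mulr_ge0//; have /andP[] := phi01 x.
move=> N; apply: le_trans (vH N); apply: ler_sum => x _.
rewrite ler_wpM2l ?fine_ge0// ler_piMl//; by have /andP[] := phi01 x.
Qed.

(** * Power-law weights and their moments *)

Lemma edge_weight_power (R : realType) (b beta : R) : 0 < b -> 0 <= beta < 1 ->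
  (beta = 0 -> b < 1) -> power_weight b beta (edge_weight b beta).
Proof.
move=> b0 /andP[be0 be1] bb; rewrite /edge_weight; split=> //; first exact/andP.
- move=> x; case: ifP => _; first by rewrite ler01 lexx.
  by rewrite le_min ge_min lexx ler01 mulr_ge0 ?powR_ge0 ?(ltW b0).
- by move=> x x0; rewrite gtn_eqF//= ge_min lexx orbT.
have [e|ne] := eqVneq beta 0.
  near=> x; rewrite e ltxx andbF oppr0 powRr0 mulr1 min_r//.
  exact: (ltW (bb e)).
have bep : 0 < beta by rewrite lt_neqAle eq_sym ne.
near=> x; have x0 : (0 < x)%N by near: x; apply: nbhs_infty_gt.
rewrite gtn_eqF//= min_r//.
have xp : 0 < x%:R `^ beta :> R by rewrite powR_gt0// ltr0n.
rewrite powRN -ler_pdivlMr ?invr_gt0// invrK mul1r.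
have -> : b = (b `^ beta^-1) `^ beta by rewrite -powRrM mulVf// powRr1// ltW.
apply: ge0_ler_powR => //; rewrite ?nnegrE ?powR_ge0//.
by near: x; apply: nbhs_infty_ger.
Unshelve. all: by end_near. Qed.

Lemma regular_mul (R : realType) (u v : nat -> R) (k l C D : R) :
  (fun t : nat => u t * t%:R `^ k) @ \oo --> C -> (fun t : nat => v t * t%:R `^ l) @ \oo --> D ->
  (fun t : nat => u t * v t * t%:R `^ (k + l)) @ \oo --> C * D.
Proof.
move=> uC vD; apply: cvg_trans (cvgM uC vD); apply: near_eq_cvg; near=> t.
have t0 : (0 < t)%N by near: t; apply: nbhs_infty_gt.
rewrite /= powRD; last by rewrite pnatr_eq0 -lt0n t0 implybT.
by rewrite mulrACA.
Unshelve. all: by end_near. Qed.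

(** Growth is written with a negative exponent, so that [regular_mul] only has to add exponents. *)
Lemma regular_natr (R : realType) : (fun t : nat => t%:R * t%:R `^ (-1)) @ \oo --> (1 : R).
Proof.
apply: cvg_near_cst; near=> t.
have t0 : (0 < t)%N by near: t; apply: nbhs_infty_gt.
by rewrite powRN powRr1// mulfV// pnatr_eq0 -lt0n.
Unshelve. all: by end_near. Qed.

Lemma regular_ffact2 (R : realType) : (fun t : nat => (t ^_ 2)%:R * t%:R `^ (-2)) @ \oo --> (1 : R).
Proof.
have h := regular_mul (@regular_natr R) (regular_shift 1 (@regular_natr R)).
rewrite mulr1 -opprD in h; apply: cvg_trans h; apply: near_eq_cvg; near=> t.
by rewrite -natrM subn1 ffactnS ffactn1.
Unshelve. all: by end_near. Qed.

Lemma regular_weight (R : realType) (b be : R) q : power_weight b be q ->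
  (fun x : nat => q x * x%:R `^ be) @ \oo --> b.
Proof.
move=> [_ _ _ _ qE]; apply: cvg_near_cst; near=> x.
have x0 : (0 < x)%N by near: x; apply: nbhs_infty_gt.
have -> : q x = b * x%:R `^ (- be) by near: x.
by rewrite -mulrA powRN mulVf ?mulr1// gt_eqF// powR_gt0// ltr0n.
Unshelve. all: by end_near. Qed.

Lemma regular_moment (R : realType) (p : probability nat R) (q : nat -> R)
    (P : probability (nat * R)%type R) r s (k A : R) : is_graph_measure p q P ->
  (forall x, 0 <= q x) -> 1 < k -> 0 < A ->
  (fun x : nat => fine (p [set x]) * ((x ^_ r)%:R * q x ^+ s) * x%:R `^ k) @ \oo --> A ->
  0 < moment P r s /\
  forall N, \sum_(0 <= x < N) fine (p [set x]) * ((x ^_ r)%:R * q x ^+ s / moment P r s) <= 1.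
Proof.
move=> gP q0 k1 A0 uA; pose u x := fine (p [set x]) * ((x ^_ r)%:R * q x ^+ s).
have u0 x : 0 <= u x by rewrite mulr_ge0 ?fine_ge0// mulr_ge0// exprn_ge0.
have [H _ uH] := powR_summable k1 u0 uA.
have uM : (fun N => \sum_(0 <= x < N) u x) @ \oo --> moment P r s.
  apply: (@graph_Rintegral R p q P (fun z => (z.1 ^_ r)%:R * z.2 ^+ s) H gP) => //.
  - by move=> n /=; apply: measurable_funM => //; exact: measurable_funX.
  - by move=> x /=; rewrite mulr_ge0// exprn_ge0.
have M0 : 0 < moment P r s.
  have : \forall x \near \oo, 0 < u x * x%:R `^ k by apply: (cvgr_gt A) => //; exact: uA.
  case=> x0 _ h; have := h x0 (leqnn x0).
  rewrite pmulr_lgt0; last first.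
    rewrite lt_neqAle powR_ge0 andbT eq_sym; apply: contraTneq (h x0 (leqnn x0)) => /= ->.
    by rewrite mulr0 ltxx.
  move=> ux; apply: lt_le_trans ux _.
  apply: le_trans (partial_sum_le x0.+1 u0 uM).
  by rewrite big_nat_recr//= lerDr sumr_ge0.
split=> // N; have -> : \sum_(0 <= x < N) fine (p [set x]) *
    ((x ^_ r)%:R * q x ^+ s / moment P r s) = (\sum_(0 <= x < N) u x) / moment P r s.
  by rewrite mulr_suml; apply: eq_bigr => x _; rewrite mulrA.
by rewrite ler_pdivrMr// mul1r; exact: partial_sum_le.
Qed.

Definition power_graph (R : realType) (a b alpha beta : R) (p : probability nat R)
    (q : nat -> R) (P : probability (nat * R)%type R) : Prop :=
  [/\ 0 < a, 0 < b, 2 < alpha, 3 < alpha + beta &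
  [/\ power_weight b beta q, (fun x : nat => fine (p [set x]) * x%:R `^ alpha) @ \oo --> a &
    is_graph_measure p q P]].

Lemma moment10 (R : realType) (a b alpha beta : R) p q
    (P : probability (nat * R)%type R) :
  power_graph a b alpha beta p q P ->
  0 < moment P 1 0 /\
  forall N, \sum_(0 <= x < N) fine (p [set x]) * (x%:R / moment P 1 0) <= 1.
Proof.
move=> [a0 b0 al2 alb [qW pa gP]]; have [_ _ q01 _ _] := qW.
have q0 x : 0 <= q x by case/andP: (q01 x).
have [||M0 h] := @regular_moment R p q P 1 0 (alpha - 1) a gP q0 _ a0.
- by rewrite ltrBrDr.
- have := regular_mul pa (@regular_natr R); rewrite mulr1; apply: cvg_trans; apply: near_eq_cvg.
  by near=> x; rewrite ffactn1 expr0 mulr1.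
split=> // N; apply: le_trans (h N).
by apply: ler_sum => x _; rewrite ffactn1 expr0 mulr1.
Unshelve. all: by end_near. Qed.

Lemma regular_moment21 (R : realType) (a b alpha beta : R) p q
    (P : probability (nat * R)%type R) :
  power_graph a b alpha beta p q P ->
  (fun x : nat => fine (p [set x]) * ((x ^_ 2)%:R * q x) * x%:R `^ (alpha + beta - 2))
    @ \oo --> a * b.
Proof.
move=> [a0 b0 al2 alb [qW pa gP]].
have := regular_mul pa (regular_mul (@regular_ffact2 R) (regular_weight qW)).
by rewrite mul1r addrCA (addrC (-2)).
Qed.

Lemma moment21 (R : realType) (a b alpha beta : R) p q
    (P : probability (nat * R)%type R) :
  power_graph a b alpha beta p q P ->
  0 < moment P 2 1 /\
  forall N, \sum_(0 <= x < N) fine (p [set x]) * ((x ^_ 2)%:R * q x / moment P 2 1) <= 1.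
Proof.
move=> pg; have uA := regular_moment21 pg.
have [a0 b0 al2 alb [qW pa gP]] := pg; have [_ _ q01 _ _] := qW.
have q0 x : 0 <= q x by case/andP: (q01 x).
apply: (@regular_moment R p q P 2 1 (alpha + beta - 2) (a * b) gP q0) => //.
(* This is where alpha + beta > 3 makes P_21 a convergent sum. *)
- by move: alb; clear; lra.
- exact: mulr_gt0.
Qed.

(** * Asymptotics of the component laws *)

Lemma g_pmf_asymptotics (R : realType) (a b alpha beta : R) p q
    (P : probability (nat * R)%type R) :
  power_graph a b alpha beta p q P ->
  (fun t : nat => g_pmf P t * t%:R `^ (1 + (alpha - 2) / (1 - beta))) @ \oo -->
    a * b `^ ((alpha - 2) / (1 - beta)) / (moment P 1 0 * (1 - beta)).
Proof.
move=> pg; have [M0 wM] := moment10 pg.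
have [a0 b0 al2 alb [qW pa gP]] := pg; have [_ be01 q01 _ _] := qW.
have [be0 be1] := andP be01.
pose w x := fine (p [set x]) * (x%:R / moment P 1 0).
have v0 (x : nat) : 0 <= x%:R / moment P 1 0 by rewrite divr_ge0// ltW.
have w0 x : 0 <= w x by rewrite mulr_ge0 ?fine_ge0.
have wA : (fun x : nat => w x * x%:R `^ (alpha - 1)) @ \oo --> a / moment P 1 0.
  have h : (fun x : nat => fine (p [set x]) * x%:R * x%:R `^ (alpha - 1) / moment P 1 0)
      @ \oo --> a / moment P 1 0.
    by apply: cvgMl; have := regular_mul pa (@regular_natr R); rewrite mulr1.
  apply: cvg_trans h; apply: near_eq_cvg; near=> x.
  by rewrite /w mulrA mulrAC.
have wg s : (fun N => \sum_(0 <= x < N) w x * binomial_pmf (x - 1) (q x) s) @ \oo --> g_pmf P s.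
  have := @graph_weight_integral R p q P (fun z => z.1%:R / moment P 1 0)
    (fun z => binomial_pmf z.1.-1 z.2 s) 1 gP.
  have -> : (fun N => \sum_(0 <= x < N) w x * binomial_pmf (x - 1) (q x) s) =
      (fun N => \sum_(0 <= x < N) w x * binomial_pmf x.-1 (q x) s).
    by apply/funext => N; apply: eq_bigr => x _; rewrite subn1.
  apply=> //.
  - by move=> n /=; exact: measurable_cst.
  - by move=> n /=; exact: measurable_binomial_pmf.
  - by move=> x; rewrite binomial_pmf_ge0//= binomial_pmf_le1.
(* The weights x p(x) / P_10 decay with exponent alpha - 1; dividing by q removes beta, and the
   scale of the mode divides by 1 - beta. *)
have gE : (alpha - 1 - beta) / (1 - beta) = 1 + (alpha - 2) / (1 - beta).
  by field; rewrite subr_eq0 gt_eqF.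
have := mixture_asymptotics qW (divr_gt0 a0 M0) _ w0 wM wA wg.
rewrite gE; have -> : a / moment P 1 0 / (b * (1 - beta)) * b `^ (1 + (alpha - 2) / (1 - beta)) =
    a * b `^ ((alpha - 2) / (1 - beta)) / (moment P 1 0 * (1 - beta)).
  rewrite powRD; last by rewrite (gt_eqF b0) implybT.
  by rewrite powRr1 ?(ltW b0)//; field; rewrite ?subr_eq0 !gt_eqF.
by apply; move: al2 be1; clear; lra.
Unshelve. all: by end_near. Qed.

(** The Poisson mean mu P_10 cancels the normalisation 1 / P_10 of [g_pmf], so P_10 is absent from
    the constant. *)
Lemma f1_bar_asymptotics (R : realType) (mu a b alpha beta : R) p q
    (P : probability (nat * R)%type R)
    (f1 : probability nat R) : 0 < mu -> power_graph a b alpha beta p q P -> is_f1_bar mu P f1 ->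
  (fun t : nat => fine (f1 [set t]) * t%:R `^ (1 + (alpha - 2) / (1 - beta))) @ \oo -->
    mu * a * b `^ ((alpha - 2) / (1 - beta)) / (1 - beta).
Proof.
move=> mu0 pg f1E; have [M0 wM] := moment10 pg.
have [a0 b0 al2 alb [qW _ _]] := pg; have [_ /andP[be0 be1] _ _ _] := qW.
have [g0 _] := f1_bar_pmf f1E.
have -> : mu * a * b `^ ((alpha - 2) / (1 - beta)) / (1 - beta) = mu * moment P 1 0 *
    (a * b `^ ((alpha - 2) / (1 - beta)) / (moment P 1 0 * (1 - beta))).
  by field; rewrite ?subr_eq0 !gt_eqF.
apply: (@panjer_asymptotics R _ (g_pmf P)) => //.
- exact: mulr_gt0.
(* alpha + beta > 3 in the form kappa > 1. *)
- by rewrite ltr_pdivlMr ?subr_gt0//; move: alb; clear; lra.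
- by move=> i; rewrite fine_ge0.
- exact: probability_nat_sum.
- exact: g_pmf_asymptotics pg.
- by move=> t; apply: f1_bar_panjer => //; exact: mulr_gt0.
Qed.

Lemma f2'_mixture (R : realType) (a b alpha beta : R) p q
    (P : probability (nat * R)%type R)
    (f2' : probability (nat * nat)%type R) : power_graph a b alpha beta p q P -> is_f2' P f2' ->
  binomial_mixture q (fun x => fine (p [set x]) * ((x ^_ 2)%:R * q x / moment P 2 1)) 2
    (f2'_pmf P) (fun s => fine (f2' ([set s] `*` setT))) 1.
Proof.
move=> pg f2E; have [M0 wM] := moment21 pg.
have [a0 b0 al2 alb [qW pa gP]] := pg; have [_ _ q01 _ _] := qW.
have q0 x : 0 <= q x by case/andP: (q01 x).
have v0 (x : nat) : 0 <= (x ^_ 2)%:R * q x / moment P 2 1.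
  by rewrite divr_ge0 ?(ltW M0)// mulr_ge0.
apply: binomial_mixture_marginal => //.
- by move=> x; rewrite mulr_ge0 ?fine_ge0.
- move=> i j.
  apply: (@graph_weight_integral R p q P (fun z => (z.1 ^_ 2)%:R * z.2 / moment P 2 1)
    (fun z => binomial_pmf (z.1 - 2) z.2 i * binomial_pmf (z.1 - 2) z.2 j) 1 gP) => //.
  + by move=> n /=; apply: measurable_funM => //; apply: measurable_funM.
  + by move=> n; apply: measurable_funM; exact: measurable_binomial_pmf.
  + move=> x; rewrite mulr_ge0 ?binomial_pmf_ge0//=.
    by rewrite mulr_ile1 ?binomial_pmf_ge0 ?binomial_pmf_le1.
- by move=> i; exact: nat_pair_marginal.
Qed.

(** The weights carry a factor q, so their exponent is alpha + beta - 2; splitting off q leaves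
    alpha - 2. This is 1 - beta less than for [g_pmf], hence one power of t less. *)
Lemma f2'_marginal_asymptotics (R : realType) (a b alpha beta : R) p q
    (P : probability (nat * R)%type R)
    (f2' : probability (nat * nat)%type R) : power_graph a b alpha beta p q P ->
  is_f2' P f2' ->
  (fun t : nat => fine (f2' ([set t] `*` setT)) * t%:R `^ ((alpha - 2) / (1 - beta))) @ \oo -->
    a * b `^ ((alpha - 2) / (1 - beta)) * (1 - beta)^-1 * (moment P 2 1)^-1.
Proof.
move=> pg f2E; have [M0 wM] := moment21 pg; have [_ w0 _ _ m2E] := f2'_mixture pg f2E.
have [a0 b0 al2 alb [qW pa gP]] := pg; have [_ /andP[be0 be1] _ _ _] := qW.
have wA : (fun x : nat => fine (p [set x]) * ((x ^_ 2)%:R * q x / moment P 2 1) *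
    x%:R `^ (alpha + beta - 2)) @ \oo --> a * b / moment P 2 1.
  have h : (fun x : nat => fine (p [set x]) * ((x ^_ 2)%:R * q x) * x%:R `^ (alpha + beta - 2) /
      moment P 2 1) @ \oo --> a * b / moment P 2 1.
    by apply: cvgMl; exact: regular_moment21 pg.
  apply: cvg_trans h; apply: near_eq_cvg; near=> x.
  by rewrite [in RHS]mulrA [RHS]mulrAC.
have gE : (alpha + beta - 2 - beta) / (1 - beta) = (alpha - 2) / (1 - beta).
  by congr (_ / _); ring.
have := mixture_asymptotics qW (divr_gt0 (mulr_gt0 a0 b0) M0) _ w0 wM wA m2E.
rewrite gE; have -> : a * b / moment P 2 1 / (b * (1 - beta)) * b `^ ((alpha - 2) / (1 - beta)) =
    a * b `^ ((alpha - 2) / (1 - beta)) * (1 - beta)^-1 * (moment P 2 1)^-1.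
  by field; rewrite ?subr_eq0 !gt_eqF.
by apply; move: al2; clear; lra.
Unshelve. all: by end_near. Qed.

Theorem theorem2 (R : realType) (mu a b alpha beta : R)
    (p : probability nat R) (P : probability (nat * R)%type R)
    (d : measure_display) (Omega : measurableType d) (Pr : probability Omega R)
    (D : {RV Pr >-> (nat * nat)%type}) :
  0 < mu -> 0 < a -> 0 < b ->
  2 < alpha -> 0 <= beta < 1 -> 3 < alpha + beta ->
  (beta = 0 -> b < 1) ->
  (fun x : nat => fine (p [set x]) / x%:R `^ (- alpha)) @ \oo --> a ->
  is_graph_measure p (edge_weight b beta) P ->
  is_limiting_bidegree_law mu P (distribution Pr D) ->
  let kappa := (alpha - 2) / (1 - beta) in
  let c' := a * b `^ kappa * (1 - beta)^-1 * (moment P 2 1)^-1 in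
  let c'' := mu * a ^+ 2 * b `^ (2 * (alpha - 2) / (1 - beta))
               * (1 - beta) ^- 2 * (moment P 2 1)^-1 in
  (fun t : nat => fine (Pr [set w | (D w).1 = t]) / (c' * t%:R `^ (- kappa)))
    @ \oo --> (1 : R)
  /\
  (forall t1 t2 : nat -> nat,
    t1 @ \oo --> \oo -> t2 @ \oo --> \oo ->
    (fun n => ((t2 n)%:R - (t1 n)%:R) / delta R (t2 n)) @ \oo --> +oo ->
    (fun n => fine (Pr [set w | (D w).1 = t1 n /\ (D w).2 = t2 n])
       / (c'' * ((t2 n)%:R - (t1 n)%:R) `^ (- 1 - kappa)
              * (t1 n)%:R `^ (- kappa)))
      @ \oo --> (1 : R)).
Proof.
move=> mu0 a0 b0 al2 be01 alb bb pa gP lim kappa c' c''.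
have [be0 be1] := andP be01.
have be1' : 0 < 1 - beta by rewrite subr_gt0.
have k1 : 1 < kappa by rewrite ltr_pdivlMr//; move: alb; clear; lra.
have k0 : 0 <= kappa by move: k1; clear; lra.
have pg : power_graph a b alpha beta p (edge_weight b beta) P.
  split=> //; split=> //; first exact: edge_weight_power.
  by apply: cvg_trans pa; apply: near_eq_cvg; near=> x; rewrite powRN invrK.
have [M0 _] := moment21 pg.
have [f1 [f2' [f1E f2E DE1 DE2]]] := bidegree_law_convolutions lim.
set f := fun i => fine (f1 [set i]) in DE1 DE2.
set m2 := fun i => fine (f2' ([set i] `*` setT)) in DE2.
have f0 i : 0 <= f i by rewrite fine_ge0.
have fsum : (fun N => \sum_(0 <= i < N) f i) @ \oo --> (1 : R) by exact: probability_nat_sum.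
have m20 i : 0 <= m2 i by rewrite fine_ge0.
have fC := f1_bar_asymptotics mu0 pg f1E.
have mC := f2'_marginal_asymptotics pg f2E.
rewrite -/kappa in fC mC; rewrite -/c' in mC.
have bk0 : 0 < b `^ kappa by rewrite powR_gt0.
have c'0 : 0 < c' by rewrite !mulr_gt0// invr_gt0.
pose C1 := mu * a * b `^ kappa / (1 - beta).
have C10 : 0 < C1 by rewrite !mulr_gt0// invr_gt0.
(* The joint constant is the product of the constant of f1, for the jump t2 - t1, and that of the
   marginal of f2', for t1. *)
have c''E : c'' = C1 * c'.
  rewrite /c'' (_ : 2 * (alpha - 2) / (1 - beta) = kappa + kappa); last first.
    by rewrite /kappa; ring.
  rewrite powRD; last by rewrite (gt_eqF b0) implybT.
  by rewrite /C1 /c'; field; rewrite !gt_eqF.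
have [H _ mH] := powR_summable k1 m20 mC.
clearbody c' c''.
split.
- have fk := regular_lower fC.
  have h := regular_shift 1 (convol_asymptotics k0 f0 m20 mH fsum fk mC).
  rewrite mulr1 in h.
  have h1 : (fun t : nat => convol f m2 (t - 1) * t%:R `^ kappa / c') @ \oo --> c' / c'.
    exact: cvgMl.
  rewrite (mulfV (lt0r_neq0 c'0)) in h1.
  apply: cvg_trans h1; apply: near_eq_cvg; near=> t.
  have t0 : (0 < t)%N by near: t; apply: nbhs_infty_gt.
  rewrite powRN invfM invrK [RHS]mulrA [RHS]mulrAC; congr (_ * _ * _).
  rewrite subn1 -DE2 prednK//; congr (fine (Pr _)).
  by apply/seteqP; split=> w /=; [case|].
- move=> t1 t2 t1oo t2oo sep.
  have := joint_asymptotics (f2'_mixture pg f2E) f0 fsum m20 mH k0 C10 c'0 fC mC t1oo t2oo sep.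
  rewrite -c''E => h.
  have c''0 : 0 < c'' by rewrite c''E mulr_gt0.
  have h1 : (fun n => joint_conv f (f2'_pmf P) (t1 n).-1 (t2 n).-1 *
      ((t2 n)%:R - (t1 n)%:R) `^ (1 + kappa) * (t1 n)%:R `^ kappa / c'') @ \oo --> c'' / c''.
    exact: cvgMl.
  rewrite (mulfV (lt0r_neq0 c''0)) in h1.
  apply: cvg_trans h1; apply: near_eq_cvg; near=> n.
  have t1p : (0 < t1 n)%N.
    by near: n; apply: (@near_subsequence t1 (fun m => 0 < m)%N t1oo); apply: nbhs_infty_gt.
  have t2p : (0 < t2 n)%N.
    by near: n; apply: (@near_subsequence t2 (fun m => 0 < m)%N t2oo); apply: nbhs_infty_gt.
  rewrite -opprD !powRN !invfM !invrK -DE1 !prednK//.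
  rewrite (_ : Pr _ = distribution Pr D [set (t1 n, t2 n)]); first by ring.
  congr (Pr _); apply/seteqP; split=> w /=; last by move=> ->.
  by move=> [<- <-]; case: (D w).
Unshelve. all: by end_near. Qed.
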